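(* If $\rho=\rho(n)\in[0,0.5]$ and $\rho^{-1}=n^{o(1)}$, then, as $n\to\infty$, $$\operatorname{lbp}(n,\rho)\le\left(\frac12+o(1)\right)\cdot h_2(\rho)\,\frac{n}{\lg n}.$$ Furthermore, given an $n$-vertex graph $G$ with $m$ edges satisfying $\min\{d(v)/(n-1),\,1-d(v)/(n-1)\}\le\rho$ for all $v\in V(G)$, represented as an adjacency list, a biclique partition realizing the upper bound can be constructed in time $O(m)$ by a randomized algorithm with high probability.
   Context: All graphs are finite, simple and undirected; $\lg$ is the base-2 logarithm; $h_2(x)=-x\lg x-(1-x)\lg(1-x)$ is the binary entropy function; $d(v)$ is the degree of $v$. A biclique of a graph $G$ is a (not necessarily induced) complete bipartite subgraph of $G$. A biclique partition of $G$ is a family of bicliques of $G$ whose edge sets partition $E(G)$. $\operatorname{lbp}(G)$ is the least natural number $\ell$ such that $G$ has a biclique partition in which every vertex belongs to at most $\ell$ bicliques. For $\rho\in[0,0.5]$, $\operatorname{lbp}(n,\rho)$ is the maximum of $\operatorname{lbp}(G)$ over all $n$-vertex graphs $G$ such that $\min\{d(v)/(n-1),\,1-d(v)/(n-1)\}\le\rho$ for all $v\in V(G)$. A partition ''realizes the upper bound'' if every vertex belongs to at most $(\frac12+o(1))h_2(\rho)\frac n{\lg n}$ bicliques. ''With high probability'' means with probability tending to $1$ as $n\to\infty$. Running times are in the standard word-RAM model with words of $\Theta(\lg n)$ bits.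
   Formalization: The adjacency list omits isolated vertices (their lists are empty), since with n lists time O(m) is impossible when m = o(n), e.g. for a single edge; for m = 0 the time O(m) is read as O(1). *)

(* Defs.v *)
(* MathComp / MathComp-Analysis *)
From HB Require Import structures.
From Stdlib Require PeanoNat.
From mathcomp Require Import all_boot all_order all_algebra.
From mathcomp Require Import all_classical all_reals all_analysis.
Set Implicit Arguments.
Unset Strict Implicit.
Unset Printing Implicit Defensive.
Import Order.TTheory GRing.Theory Num.Theory.

(** ** Graphs and biclique partitions *)

Section Graphs.
Variable T : finType.

Record sgraph := SGraph {
  edges : {set {set T}};
  edges_card2 : [forall e in edges, #|e| == 2]
}.

HB.instance Definition _ := [isSub for edges].
HB.instance Definition _ := [Countable of sgraph by <:].
HB.instance Definition _ := [Finite of sgraph by <:].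

Definition degree (G : sgraph) (v : T) : nat := #|[set e in edges G | v \in e]|.

Definition neighbours (G : sgraph) (v : T) : {set T} :=
  [set u | [set v; u]%SET \in edges G].

(* A complete bipartite graph is given by its two sides. *)
Definition bedges (K : {set T} * {set T}) : {set {set T}} :=
  [set [set a; b]%SET | a in K.1, b in K.2].

Definition bvertices (K : {set T} * {set T}) : {set T} := K.1 :|: K.2.

Definition is_biclique (G : sgraph) (K : {set T} * {set T}) : bool :=
  [&& K.1 != finset.set0, K.2 != finset.set0, [disjoint K.1 & K.2]
    & bedges K \subset edges G].

Definition biclique_partition (G : sgraph) (P : seq ({set T} * {set T})) : bool :=
  all (is_biclique G) P &&
  [forall e in edges G, count (fun K => e \in bedges K) P == 1].

(* the number of members of P to which v belongs *)
Definition load (P : seq ({set T} * {set T})) (v : T) : nat :=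
  count (fun K => v \in bvertices K) P.

Definition has_lbp (G : sgraph) (l : nat) : Prop :=
  exists2 P, biclique_partition G P & forall v, load P v <= l.

Lemma has_lbp_exists (G : sgraph) : exists l, `[< has_lbp G l >].
Proof.
pose P := [seq ([set p.1]%SET, [set p.2]%SET) | p : T * T <-
  [seq p <- enum [set: T * T]%SET |
    ([set p.1; p.2]%SET \in edges G) && (enum_rank p.1 < enum_rank p.2)]].
exists (size P); apply/asboolP; exists P; last by move=> v; exact: count_size.
have bE (a b : T) : bedges ([set a]%SET, [set b]%SET) = [set [set a; b]]%SET.
  apply/setP => e; rewrite inE; apply/imset2P/eqP => [[x y] /=|->].
    by move=> /set1P -> /set1P ->.
  by exists a b; rewrite ?finset.set11.
apply/andP; split.
  apply/allP => K /mapP [[a b]]; rewrite mem_filter /= => /andP [/andP [abG ab] _] ->.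
  have nab : a != b by apply: contraTneq ab => ->; rewrite ltnn.
  apply/and4P; split => /=.
  - by apply/set0Pn; exists a; rewrite finset.set11.
  - by apply/set0Pn; exists b; rewrite finset.set11.
  - by rewrite disjoints1 inE.
  - by rewrite bE finset.sub1set.
apply/forallP => e; apply/implyP => eG.
have /cards2P [a0 [b0 [nab0 e0]]] : #|e| == 2.
  by have /forallP/(_ e)/implyP/(_ eG) := edges_card2 G.
wlog ab : a0 b0 nab0 e0 / enum_rank a0 < enum_rank b0.
  move=> H; case: (ltngtP (enum_rank a0) (enum_rank b0)) => ab.
  - exact: (H a0 b0).
  - by apply: (H b0 a0) => //; [rewrite eq_sym|rewrite e0 finset.setUC].
  - by move: nab0; rewrite (enum_rank_inj (val_inj ab)) eqxx.
rewrite count_map (eq_in_count (a2 := pred1 (a0, b0))); last first.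
  move=> [a b]; rewrite mem_filter /= => /andP [/andP [_ ab'] _].
  rewrite bE inE e0; apply/eqP/eqP => [E|[-> ->]//].
  have : a \in [set a0; b0]%SET by rewrite E !inE eqxx.
  have : b \in [set a0; b0]%SET by rewrite E !inE eqxx orbT.
  rewrite !inE => /orP [] /eqP hb /orP [] /eqP ha; subst a b => //.
  - by rewrite ltnn in ab'.
  - by move: (ltn_trans ab ab'); rewrite ltnn.
  - by rewrite ltnn in ab'.
rewrite count_uniq_mem; last by apply: filter_uniq; exact: enum_uniq.
by rewrite (mem_filter _ (a0, b0)) /= -e0 eG ab mem_enum finset.in_setT.
Qed.

Definition lbp (G : sgraph) : nat := ex_minn (has_lbp_exists G).

End Graphs.

(** ** Asymptotic quantities *)

Section Reals.
Variable R : realType.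
Local Open Scope ring_scope.

Definition lg (x : R) : R := ln x / ln 2.

(* Since ln 0 = 0 here, h2 0 = h2 1 = 0, as usual. *)
Definition h2 (x : R) : R := - x * lg x - (1 - x) * lg (1 - x).

Definition degree_cond n (G : sgraph 'I_n) (rho : R) : bool :=
  [forall v : 'I_n, Num.min ((degree G v)%:R / n.-1%:R)
                            (1 - (degree G v)%:R / n.-1%:R) <= rho].

Definition lbp_max (n : nat) (rho : R) : nat :=
  \max_(G : sgraph 'I_n | degree_cond G rho) lbp G.

Definition lbp_bound (eps rho : R) (n : nat) : R :=
  (2^-1 + eps) * h2 rho * (n%:R / lg n%:R).

Definition prob (Omega : finType) (E : Omega -> Prop) : R :=
  #|[pred t | `[< E t >]]|%:R / #|Omega|%:R.

End Reals.

(** ** The word-RAM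

  Words of [w] bits are represented by natural numbers below [2 ^ w].  A
  program is a structured command over finitely many word registers and a
  memory addressed by words.  The syntax does not depend on [w], so that one
  program serves all input sizes. *)

Inductive binop :=
  | OAdd | OSub | OMul | ODiv | OMod | OAnd | OOr | OXor | OShl | OShr | OEq | OLt.

Inductive com :=
  | Skip
  | Const of nat & nat              (* Const x c     : x := c            *)
  | Op of binop & nat & nat & nat   (* Op o x y z    : x := y o z        *)
  | Read of nat & nat               (* Read x y      : x := mem[y]       *)
  | Write of nat & nat              (* Write x y     : mem[x] := y       *)
  | Rand of nat                     (* Rand x        : x := random word  *)
  | Seq of com & com
  | If of nat & com & com           (* tests whether the register is nonzero *)
  | While of nat & com.

Definition eval_op (w : nat) (o : binop) (a b : nat) : nat :=
  match o with
  | OAdd => (a + b) %% 2 ^ w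
  | OSub => (a + 2 ^ w - b) %% 2 ^ w
  | OMul => (a * b) %% 2 ^ w
  | ODiv => a %/ b
  | OMod => a %% b
  | OAnd => PeanoNat.Nat.land a b
  | OOr => PeanoNat.Nat.lor a b
  | OXor => PeanoNat.Nat.lxor a b
  | OShl => (a * 2 ^ b) %% 2 ^ w
  | OShr => a %/ 2 ^ b
  | OEq => a == b
  | OLt => a < b
  end.

(* [todo] is the stack of commands still to be executed; [tape] holds the
   random words not yet consumed. *)
Record config := Config {
  todo : seq com;
  regs : nat -> nat;
  memory : nat -> nat;
  tape : seq nat
}.

Definition step (w : nat) (s : config) : config :=
  let: Config td r m t := s in
  match td with
  | [::] => s
  | c :: k =>
    match c with
    | Skip => Config k r m t
    | Const x a => Config k [eta r with x |-> a %% 2 ^ w] m t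
    | Op o x y z => Config k [eta r with x |-> eval_op w o (r y) (r z)] m t
    | Read x y => Config k [eta r with x |-> m (r y)] m t
    | Write x y => Config k r [eta m with r x |-> r y] t
    | Rand x => Config k [eta r with x |-> head 0 t] m (behead t)
    | Seq c1 c2 => Config [:: c1, c2 & k] r m t
    | If x c1 c2 => Config ((if r x != 0 then c1 else c2) :: k) r m t
    | While x c1 => Config (if r x != 0 then [:: c1, c & k] else k) r m t
    end
  end.

(* The configuration after [time] unit-cost steps; the input occupies the
   memory cells 0, 1, ..., and all other cells and registers hold 0. *)
Definition run (w : nat) (A : com) (input rnd : seq nat) (time : nat) : config :=
  iter time (step w) (Config [:: A] (fun=> 0) (nth 0 input) rnd).

(* The run has terminated, and [out] is stored in memory from the address
   held by register 0 on. *)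
Definition outputs (s : config) (out : seq nat) : Prop :=
  todo s = [::] /\ forall i, i < size out -> memory s (regs s 0 + i) = nth 0 out i.

(* Numbers at most n fit in one such block of bits; for K > 2 (and n > 2) all
   the cells of the input below are addressable. *)
Definition word_size (K n : nat) : nat := K * (trunc_log 2 n).+1.

(** ** Input and output encodings *)

(* [inp] is an adjacency list of G: n, the number of listed vertices, and for
   every listed vertex its name, its degree and its neighbours; vertices and
   neighbours come in arbitrary order.  Isolated vertices, whose lists are
   empty, are not listed: with n lists, reading the input could take more than
   O(m) steps when m = o(n). *)
Definition adjacency_list n (G : sgraph 'I_n) (inp : seq nat) : Prop :=
  exists (vs : seq 'I_n) (nb : 'I_n -> seq 'I_n),
  [/\ perm_eq vs [seq v <- enum 'I_n | 0 < degree G v],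
      forall v, perm_eq (nb v) (enum (neighbours G v))
    & inp = [:: n, size vs & flatten
        [seq [:: val v, size (nb v) & [seq val u | u <- nb v]] | v <- vs]]].

Definition encode_bicliques n (L : seq (seq 'I_n * seq 'I_n)) : seq nat :=
  size L :: flatten
    [seq [:: size K.1, size K.2 & [seq val v | v <- K.1 ++ K.2]] | K <- L].

(* At [s] the program has halted and has written down, side by side and
   without repetitions, the bicliques of the family P. *)
Definition outputs_bicliques n (s : config)
    (P : seq ({set 'I_n} * {set 'I_n})) : Prop :=
  exists L : seq (seq 'I_n * seq 'I_n),
  [/\ all (fun K => uniq K.1 && uniq K.2) L,
      P = [seq ([set v in K.1]%SET, [set v in K.2]%SET) | K <- L]
    & outputs s (encode_bicliques L)].

(* Main.v *)
Require Import Defs.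
From mathcomp Require Import all_boot all_order all_algebra.
From mathcomp Require Import all_classical all_reals all_analysis.
From mathcomp Require Import zify ring lra.
Import Order.TTheory GRing.Theory Num.Theory numFieldNormedType.Exports.

(** The partition is found by a one-pass greedy algorithm on a randomly oriented
    graph.  Number the N non-isolated vertices 0, ..., N - 1 in the order of the
    input, and cut this range into about N^(1/8) blocks of consecutive vertices.
    One coin for every pair of blocks ([coin]) decides which end of an edge is
    responsible for the other one ([resp]); so every edge {u, v} is recorded in
    exactly one of the rows of u and of v, the row of v being the increasing list
    of the neighbours for which v is responsible ([row]).  A row is cut from left
    to right into phrases ([parse]): a phrase lies in one block, has span at most
    X, and there are at most M sets of its size inside its span.  For every
    distinct phrase S that occurs, the biclique between S and the set of all
    vertices having S as a phrase is output.  These bicliques partition the edges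
    ([outP_partition]).

    A vertex lies on the phrase side of at most X^3 M bicliques ([good_count]),
    because start, span and size of a phrase through it leave X^3 possibilities
    and then at most M patterns; M = N / X^4 makes this at most N / X.  It lies on
    the other side of as many bicliques as its row has phrases.  Cuts caused by
    the span, by the end of a block, or inside the block of the vertex itself
    are few.  If f phrases are closed because of M, if Z is the number of
    non-neighbours for which v is responsible, and O the number of neighbours,
    then (M / X)^f is at most the binomial coefficient of Z + O over O, since the
    binomial coefficients of the phrases multiply up inside that one
    ([phrases_count]).

    A Chernoff bound shows that, with probability at least 1 - 1/n, for every
    vertex v of degree d simultaneously, O exceeds d / 2 and Z exceeds (N - d) / 2
    only by lower-order terms ([bad_card], [prob_bound]).  This is where the factor 1/2 comes
    from.  The logarithm of the binomial coefficient is then at most about half of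
    n times the entropy of rho ([ln_bin_ent]), and as M / X = n^(1 - o(1)), the
    number f is at most (1/2 + o(1)) h n / ln n, where h is the entropy of rho in
    natural units ([f_small]).  This requires X = n^o(1); otherwise every vertex
    has very few neighbours or very few non-neighbours and f, which is at most
    both Z and O, is negligible anyway ([D_small]).  If N itself is small, then
    the load of at most 2 N is good enough ([load_2N]).

    The program keeps the trie of all phrases with directly addressed child
    tables, which is possible because memory is initially zero, and compares
    binomial coefficients by means of a table capped at M + 1; so every edge costs
    constant time, and N^(1/4) coins suffice.  It is verified in a Hoare logic
    whose clock counts machine steps ([wp_sound], [prog_run]), and the result for
    an arbitrary tape of random words is [algorithm].

    The bound on lbp follows because an event of positive probability occurs
    ([lbp_max_le]).  All this holds for each fixed eps > 0 and large n; a diagonal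
    choice ([diagonal]) yields one sequence eps(n) that tends to 0. *)

(** * Hoare logic with a clock for the word-RAM *)

Module WordRam.
Set Implicit Arguments.
Unset Strict Implicit.
Unset Printing Implicit Defensive.
Local Open Scope nat_scope.

(** Commands over a memory that is divided into arrays: array [i] occupies the
    addresses from i * S to i * S + S - 1.  Register 1 is reserved for address
    computations, register 2 holds S, and register 0 is for the output address. *)
Inductive acom :=
  | AOp of binop & nat & nat & nat
  | AConst of nat & nat
  | ARd of nat & nat & nat
  | AWr of nat & nat & nat
  | ARnd of nat
  | ASeq of acom & acom
  | AIf of nat & acom & acom
  | AWhile of nat & acom.

Fixpoint compile (c : acom) : com :=
  match c with
  | AOp o x y z => Op o x y z
  | AConst x v => Const x v
  | ARd x a y => Seq (Const 1 a) (Seq (Op OMul 1 1 2) (Seq (Op OAdd 1 1 y) (Read x 1)))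
  | AWr a y z => Seq (Const 1 a) (Seq (Op OMul 1 1 2) (Seq (Op OAdd 1 1 y) (Write 1 z)))
  | ARnd x => Rand x
  | ASeq c1 c2 => Seq (compile c1) (compile c2)
  | AIf x c1 c2 => If x (compile c1) (compile c2)
  | AWhile x c1 => While x (compile c1)
  end.

(** Register and array numbers are always concrete, so that [eqn] lets
    simplification evaluate every lookup; array indices are symbolic, and their
    updates must not unfold. *)
Definition upd (T : Type) (f : nat -> T) (x : nat) (v : T) : nat -> T :=
  fun y => if eqn y x then v else f y.

Definition updm (f : nat -> nat) (x v : nat) : nat -> nat :=
  fun y => if y == x then v else f y.

Arguments upd T f x v y /.
Arguments updm : simpl never.

Lemma updmE f x v y : updm f x v y = if y == x then v else f y.
Proof. by []. Qed.

(** The abstract state: registers, arrays, unread random words, and a clock that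
    counts the machine steps made so far. *)
Record ast := Ast {
  rg : nat -> nat;
  ar : nat -> nat -> nat;
  tp : seq nat;
  ck : nat
}.

Definition setr a x v d := Ast (upd (rg a) x v) (ar a) (tp a) (ck a + d).
Definition seta a i j v d := Ast (rg a) (upd (ar a) i (updm (ar a i) j v)) (tp a) (ck a + d).
Definition tick a d := Ast (rg a) (ar a) (tp a) (ck a + d).

Arguments setr a x v d /.
Arguments seta a i j v d /.
Arguments tick a d /.

Definition iev (o : binop) (a b : nat) : nat :=
  match o with
  | OAdd => a + b
  | OSub => a - b
  | OMul => a * b
  | ODiv => a %/ b
  | OMod => a %% b
  | OShr => a %/ 2 ^ b
  | OEq => a == b
  | OLt => a < b
  | _ => 0
  end.

Lemma loc_inj S a i b j : i < S -> j < S -> (a * S + i == b * S + j) = (a == b) && (i == j).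
Proof.
move=> iS jS; apply/eqP/andP => [|[/eqP -> /eqP ->] //].
move=> e; have S0 : 0 < S by lia.
have := congr1 (divn^~ S) e; rewrite /= !divnMDl // !divn_small // !addn0 => ->.
by have := congr1 (modn^~ S) e; rewrite /= !modnMDl !modn_small // => ->.
Qed.

Section Wp.
Variables (w S : nat).
Hypothesis w0 : 0 < w.
Let U := 2 ^ w.

(** No overflow: the machine operation then agrees with the one on unbounded
    numbers. *)
Definition oko (o : binop) (a b : nat) : Prop :=
  match o with
  | OAdd => a + b < U
  | OMul => a * b < U
  | OSub => b <= a
  | OAnd | OOr | OXor | OShl => False
  | _ => True
  end.

(** Weakest preconditions.  The clock advances by the exact number of steps of
    the compiled code, so that a bound on the running time is an ordinary
    postcondition, and the variant of a loop gives its termination.  Results are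
    named by an equation, which keeps the terms small in long blocks of code. *)
Fixpoint wp (c : acom) (Q : ast -> Prop) (a : ast) : Prop :=
  match c with
  | AOp o x y z => [/\ 2 < x, 2 < y, 2 < z, oko o (rg a y) (rg a z) &
      forall v, v = iev o (rg a y) (rg a z) -> Q (setr a x v 1)]
  | AConst x v => [/\ 2 < x, v < U & Q (setr a x v 1)]
  | ARd x i y => [/\ 2 < x, 2 < y, rg a y < S, i * S + S < U &
      forall v, v = ar a i (rg a y) -> Q (setr a x v 7)]
  | AWr i y z => [/\ 2 < y, 2 < z, rg a y < S, i * S + S < U &
      Q (seta a i (rg a y) (rg a z) 7)]
  | ARnd x => 2 < x /\ Q (Ast (upd (rg a) x (head 0 (tp a))) (ar a) (behead (tp a)) (ck a + 1))
  | ASeq c1 c2 => wp c1 (wp c2 Q) (tick a 1)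
  | AIf x c1 c2 => [/\ 2 < x, rg a x != 0 -> wp c1 Q (tick a 1)
                     & rg a x = 0 -> wp c2 Q (tick a 1)]
  | AWhile x c1 => 2 < x /\ exists (I : ast -> Prop) (f : ast -> nat),
      [/\ I a,
          forall b, I b -> rg b x != 0 -> wp c1 (fun b' => I b' /\ f b' < f b) (tick b 1)
        & forall b, I b -> rg b x = 0 -> Q (tick b 1)]
  end.

Definition rep (r m : nat -> nat) (t : seq nat) (a : ast) : Prop :=
  [/\ forall x, 2 < x -> r x = rg a x /\ rg a x < U,
      r 2 = S,
      forall i j, j < S -> m (i * S + j) = ar a i j /\ ar a i j < U
    & t = tp a /\ all (fun v => v < U) t].

Lemma rep_setr r m t a x v d : 2 < x -> v < U -> rep r m t a ->
  rep [eta r with x |-> v] m t (setr a x v d).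
Proof.
move=> x2 vU [h1 h2 h3 h4]; split=> //.
- by move=> y y2 /=; rewrite eqnE; case: eqP => // _; exact: h1.
- by rewrite /=; case: eqP x2 => // <-.
Qed.

Lemma iev_lt o a b : oko o a b -> a < U -> b < U -> iev o a b < U /\ eval_op w o a b = iev o a b.
Proof.
have U1 : 0 < U by rewrite expn_gt0.
have U1' : 1 < U by rewrite -(expn0 2) ltn_exp2l.
case: o => //= h ha hb.
- by rewrite modn_small.
- split; first by apply: leq_ltn_trans ha; exact: leq_subr.
  rewrite -/U -addnBAC // modnDr modn_small //.
  by apply: leq_ltn_trans ha; exact: leq_subr.
- by rewrite modn_small.
- by split=> //; apply: leq_ltn_trans ha; exact: leq_div.
- by split=> //; apply: leq_ltn_trans ha; exact: leq_mod.
- by split=> //; apply: leq_ltn_trans ha; exact: leq_div.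
- by split=> //; case: (a == b) => //=; exact: leq_ltn_trans U1'.
- by split=> //; case: (a < b) => //=; exact: leq_ltn_trans U1'.
Qed.

(** Quantifying over the stack [k] makes runs composable. *)
Definition steps (c : com) T r m t r' m' t' := forall k,
  iter T (step w) (Config (c :: k) r m t) = Config k r' m' t'.

Lemma steps_seq c1 c2 T1 T2 r m t r1 m1 t1 r2 m2 t2 :
  steps c1 T1 r m t r1 m1 t1 -> steps c2 T2 r1 m1 t1 r2 m2 t2 ->
  steps (Seq c1 c2) (1 + T1 + T2) r m t r2 m2 t2.
Proof. by move=> h1 h2 k; rewrite addnC iterD add1n iterSr /= h1 h2. Qed.

Lemma steps_addr a i y r m t (c : com) r' m' t' :
  i < S -> a * S + S < U -> r 2 = S -> r y = i -> 2 < y ->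
  (forall r1, r1 1 = a * S + i -> (forall x, x != 1 -> r1 x = r x) -> steps c 1 r1 m t r' m' t') ->
  steps (Seq (Const 1 a) (Seq (Op OMul 1 1 2) (Seq (Op OAdd 1 1 y) c))) 7 r m t r' m' t'.
Proof.
move=> iS aS r2 ry y2 hc.
have aU : a < U by nia.
have aSU : a * S < U by lia.
have aSiU : a * S + i < U by lia.
have y1 : (y == 1) = false by apply/eqP; lia.
apply: (@steps_seq _ _ 1 5 _ _ _ _ _ _ r' m' t'); first by move=> k /=.
apply: (@steps_seq _ _ 1 3 _ _ _ _ _ _ r' m' t'); first by move=> k /=.
apply: (@steps_seq _ _ 1 1 _ _ _ _ _ _ r' m' t'); first by move=> k /=.
apply: hc => [|x /negbTE /=].
  rewrite /= y1 r2 ry (modn_small aU) (modn_small aSU) modn_small //.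
by move=> /= ->.
Qed.

(** By induction on the command, and for loops on the variant; the clock of the
    abstract state equals the number of machine steps exactly. *)
Lemma wp_sound c : forall Q a, wp c Q a -> forall r m t, rep r m t a ->
  exists T r' m' t' a', [/\ steps (compile c) T r m t r' m' t',
    ck a' = ck a + T, rep r' m' t' a' & Q a'].
Proof.
elim: c => [opr x y z|x v|x i y|i y z|x|c1 IH1 c2 IH2|x c1 IH1 c2 IH2|x c IH] Q a /=.
- move=> [x2 y2 z2 ok hQ] r m t R; have [h1 h2 h3 h4] := R.
  have [ry ryU] := h1 _ y2; have [rz rzU] := h1 _ z2.
  have [lt ev] := iev_lt ok ryU rzU.
  exists 1, [eta r with x |-> iev opr (rg a y) (rg a z)], m, t.
  exists (setr a x (iev opr (rg a y) (rg a z)) 1); split=> //.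
  + by move=> k /=; rewrite ry rz ev.
  + exact: rep_setr.
  + exact: hQ.
- move=> [x2 vU hQ] r m t R.
  exists 1, [eta r with x |-> v], m, t, (setr a x v 1); split=> //.
  + by move=> k /=; rewrite modn_small.
  + exact: rep_setr.
- move=> [x2 y2 yS iS hQ] r m t R; have [h1 h2 h3 h4] := R.
  have [ry ryU] := h1 _ y2; have [mE mU] := h3 i _ yS.
  pose r1 := fun z => if z == 1 then i * S + rg a y else r z.
  exists 7, [eta r1 with x |-> ar a i (rg a y)], m, t.
  exists (setr a x (ar a i (rg a y)) 7); split=> //; last exact: hQ.
  + apply: (steps_addr yS iS h2 ry y2) => r0 e0 e1 k.
    rewrite /= e0 mE; congr Config.
    apply/funext => z; rewrite /= /r1; case: eqP => // _.
    by case: eqP => [->//|/eqP]; exact: e1.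
  + apply: rep_setr => //; split=> //.
    * by move=> z z2; rewrite /r1; case: eqP z2 => [->//|_]; exact: h1.
- move=> [y2 z2 yS iS hQ] r m t R; have [h1 h2 h3 h4] := R.
  have [ry ryU] := h1 _ y2; have [rz rzU] := h1 _ z2.
  pose r1 := fun z => if z == 1 then i * S + rg a y else r z.
  exists 7, r1, [eta m with i * S + rg a y |-> rg a z], t.
  exists (seta a i (rg a y) (rg a z) 7); split=> //.
  + apply: (steps_addr yS iS h2 ry y2) => r0 e0 e1 k.
    rewrite /= e0 e1 ?rz; last by apply/eqP; lia.
    congr Config.
    by apply/funext => u; rewrite /r1; case: eqP => [->//|/eqP]; exact: e1.
  + split=> //.
    * by move=> u u2; rewrite /r1; case: eqP u2 => [->//|_]; exact: h1.
    * move=> i' j jS /=; rewrite loc_inj // eqnE.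
      have [->|_] /= := eqVneq i' i; last exact: h3.
      by rewrite updmE; have [_|_] // := eqVneq j (rg a y); exact: h3.
- move=> [x2 hQ] r m t R; have [h1 h2 h3 [h4 h5]] := R.
  have U1 : 0 < U by rewrite expn_gt0.
  have hv : head 0 t < U by case: (t) h5 => //= ? ? /andP [].
  have [g1 g2 g3 _] := rep_setr 1 x2 hv R.
  exists 1, [eta r with x |-> head 0 t], m, (behead t).
  exists (Ast (upd (rg a) x (head 0 t)) (ar a) (behead t) (ck a + 1)); split=> //.
  + split=> //; split=> //.
    by case: (t) h5 => //= ? ? /andP [].
  + by rewrite h4.
- move=> h r m t R.
  have [T1 [r1 [m1 [t1 [a1 [s1 k1 R1 h1]]]]]] := IH1 _ _ h _ _ _ R.
  have [T2 [r2 [m2 [t2 [a2 [s2 k2 R2 h2]]]]]] := IH2 _ _ h1 _ _ _ R1.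
  exists (1 + T1 + T2), r2, m2, t2, a2; split=> //; first exact: steps_seq s1 s2.
  by rewrite k2 k1 /=; lia.
- move=> [x2 h1 h2] r m t R; have [g1 _ _ _] := R; have [rx _] := g1 _ x2.
  have [rx0|rx0] := eqVneq (rg a x) 0.
    have [T1 [r1 [m1 [t1 [a1 [s1 k1 R1 q1]]]]]] := IH2 _ _ (h2 rx0) _ _ _ R.
    exists (T1.+1), r1, m1, t1, a1; split=> //; last by rewrite k1 /=; lia.
    by move=> k; rewrite iterSr /= rx rx0 s1.
  have [T1 [r1 [m1 [t1 [a1 [s1 k1 R1 q1]]]]]] := IH1 _ _ (h1 rx0) _ _ _ R.
  exists (T1.+1), r1, m1, t1, a1; split=> //; last by rewrite k1 /=; lia.
  by move=> k; rewrite iterSr /= rx rx0 s1.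
- move=> [x2 [I [f [Ia hb he]]]].
  have [j] := ubnP (f a); elim: j a Ia => // j IHj a Ia fa r m t R.
  have [g1 _ _ _] := R; have [rx _] := g1 _ x2.
  have [rx0|rx0] := eqVneq (rg a x) 0.
    exists 1, r, m, t, (tick a 1); split=> //; last exact: he.
    by move=> k /=; rewrite rx rx0.
  have [T1 [r1 [m1 [t1 [a1 [s1 k1 R1 [q1 q2]]]]]]] := IH _ _ (hb _ Ia rx0) _ _ _ R.
  have fa1 : f a1 < j by apply: leq_trans q2 _.
  have [T2 [r2 [m2 [t2 [a2 [s2 k2 R2 h2]]]]]] := IHj _ q1 fa1 _ _ _ R1.
  exists (1 + T1 + T2), r2, m2, t2, a2; split=> //; last by rewrite k2 k1 /=; lia.
  by move=> k; rewrite addnC iterD add1n iterSr /= rx rx0 s1 s2.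
Qed.

Lemma wp_mono c : forall Q Q' a, (forall b, Q b -> Q' b) -> wp c Q a -> wp c Q' a.
Proof.
elim: c => [opr x y z|x v|x i y|i y z|x|c1 IH1 c2 IH2|x c1 IH1 c2 IH2|x c IH] Q Q' a hQ /=.
- by move=> [? ? ? ? h]; split=> // v e; apply/hQ/h.
- by move=> [? ? h]; split=> //; apply/hQ.
- by move=> [? ? ? ? h]; split=> // v e; apply/hQ/h.
- by move=> [? ? ? ? h]; split=> //; apply/hQ.
- by move=> [? h]; split=> //; apply/hQ.
- by apply: IH1 => b; exact: IH2.
- by move=> [x2 h1 h2]; split=> // e; [apply: IH1 (h1 e)|apply: IH2 (h2 e)].
- by move=> [x2 [I [f [h1 h2 h3]]]]; split=> //; exists I, f; split=> // b Ib e; apply/hQ/h3.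
Qed.

(** x := if t then a else b for a register t holding 0 or 1, computed as
    (1 - t) * b + t * a: without a branch, the symbolic execution of a block does
    not split.  Registers 48 and 49 are scratch, and register 3 holds 1. *)
Definition ASel x t a b :=
  ASeq (AOp OSub 48 3 t) (ASeq (AOp OMul 48 48 b) (ASeq (AOp OMul 49 t a) (AOp OAdd x 48 49))).
Arguments ASel : simpl never.

Lemma wp_sel x t a b (c : bool) Q s :
  2 < x -> 2 < t < 48 -> 2 < a < 48 -> 2 < b < 48 -> rg s 3 = 1 -> rg s t = c ->
  rg s a < U -> rg s b < U ->
  Q (Ast (upd (upd (upd (rg s) 48 (if c then 0 else rg s b)) 49 (if c then rg s a else 0))
               x (if c then rg s a else rg s b)) (ar s) (tp s) (ck s + 7)) ->
  wp (ASel x t a b) Q s.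
Proof.
move=> x2 t2 a2 b2 s3 st sa sb hQ.
have e48 y : 2 < y < 48 -> (eqn y 48 = false) /\ (eqn y 49 = false).
  by move=> h; rewrite !eqnE; split; apply/eqP; lia.
have [t48 t49] := e48 _ t2; have [a48 a49] := e48 _ a2; have [b48 b49] := e48 _ b2.
have [t2' a2' b2'] : [/\ 2 < t, 2 < a & 2 < b] by split; lia.
have U0 : 0 < U by apply: leq_ltn_trans sa.
rewrite /ASel /= s3 st ?t48 ?t49 ?a48 ?a49 ?b48 ?b49 ?st; split=> //; first by case: c {st hQ}.
move=> v1 ->; split=> //; first by case: c {st hQ}; rewrite ?mul0n ?mul1n //=.
move=> v2 ->; split=> //; first by case: c {st hQ}; rewrite ?mul0n ?mul1n //=.
move=> v3 ->; split=> //; first by case: c {st hQ}; rewrite ?mul0n ?mul1n ?addn0 ?add0n //=.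
move=> v4 ->; move: hQ; congr Q; congr Ast; last by lia.
apply/funext => y /=; case: c {st} => /=; rewrite ?mul0n ?mul1n ?addn0 //=.
all: by case: (eqn y x) => //; case: (eqn y 49) => //; case: (eqn y 48).
Qed.

(** The counter [i] runs from its current value to the bound held by [e]; [x] is
    the register of the loop test, and register 3 holds 1. *)
Definition AFor x i e body :=
  ASeq (AOp OLt x i e)
       (AWhile x (ASeq body (ASeq (AOp OAdd i i 3) (AOp OLt x i e)))).

Arguments AFor : simpl never.

(** The state in which the loop body leaves the counter and the loop test
    updated: there the invariant of [wp_for] is required. *)
Definition forstep x i (v : nat) (t : bool) b :=
  Ast (upd (upd (rg b) i v) x (t : nat)) (ar b) (tp b) (ck b + 1 + 1 + 1).

Lemma wp_for x i e body (I : nat -> ast -> Prop) lo hi Q a :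
  2 < x -> 2 < i -> 2 < e -> uniq [:: x; i; e; 3] ->
  rg a i = lo -> rg a e = hi -> lo <= hi -> hi < U -> rg a 3 = 1 ->
  I lo (setr (tick a 1) x (lo < hi : nat) 1) ->
  (forall j b, lo <= j < hi -> I j b -> rg b i = j -> rg b e = hi -> rg b 3 = 1 ->
     wp body (fun b' => [/\ rg b' i = j, rg b' e = hi, rg b' 3 = 1 &
        I j.+1 (forstep x i j.+1 (j.+1 < hi) b')]) (tick (tick b 1) 1)) ->
  (forall b, I hi b -> rg b i = hi -> rg b e = hi -> rg b 3 = 1 -> Q (tick b 1)) ->
  wp (AFor x i e body) Q a.
Proof.
move=> x2 i2 e2 un ai ae lohi hiU a3 I0 Ib Ie.
have [xi xe x3] : [/\ eqn i x = false, eqn e x = false & eqn 3 x = false].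
  by move: un; rewrite !eqnE /= !inE !negb_or => /and4P [/and3P [h1 h2 h3] _ _ _]; split; apply/negbTE; rewrite eq_sym.
have [ie i3] : eqn e i = false /\ eqn 3 i = false.
  by move: un; rewrite !eqnE /= !inE !negb_or => /and4P [_ /andP [h2 h3] _ _]; split; apply/negbTE; rewrite eq_sym.
have eqnn z : eqn z z = true by rewrite eqnE eqxx.
rewrite /= ; split=> // v ->; split=> //.
exists (fun b => exists j, [/\ lo <= j <= hi, rg b i = j, rg b e = hi, rg b 3 = 1 & rg b x = (j < hi) /\ I j b]).
exists (fun b => hi - rg b i); split.
- exists lo; rewrite /= !eqnn xi xe x3 ai ae lohi leqnn; split=> //.
- move=> b [j [/andP [loj jhi] bi be b3 [bx Ij]]]; rewrite bx eqb0 negbK => jh.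
  have := Ib j b; rewrite loj jh => /(_ isT Ij bi be b3).
  apply: wp_mono => b' [bi' be' b3' Ij']; split=> //.
    by rewrite /= bi' b3'; lia.
  move=> v1 ->; split=> // v2 -> /=.
  rewrite /= !eqnn xi xe x3 ie i3 bi' be' b3' /= addn1; split; last by lia.
  exists j.+1; split=> //; first lia.
- move=> b [j [/andP [loj jhi] bi be b3 [bx Ij]]]; rewrite bx => /eqP; rewrite eqb0 -leqNgt => jh.
  have jE : j = hi by lia.
  by rewrite jE in Ij bi; apply: Ie.
Qed.
End Wp.

Notation "c1 ;; c2" := (ASeq c1 c2) (at level 91, right associativity).

Ltac side := first [by [] | lia].

(** Symbolic execution of straight-line code: discharges the side conditions of
    one instruction after the other. *)
Ltac ws := repeat (lazymatch goal with
  | |- and5 _ _ _ _ _ => apply: And5; [by []|by []|try side|try side|]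
  | |- and3 _ _ _ => apply: And3; [by []|try side|] end).

(** Frame conditions: the register in the goal differs from all updated ones. *)
Ltac fr := let x := fresh "x" in let hx := fresh "hx" in let hy := fresh "hy" in
  move=> x; rewrite /= ?inE ?eqnE ?negb_or => hx;
  repeat (case/andP: hx => /negbTE hy hx; rewrite ?hy; clear hy); rewrite ?(negbTE hx).

Ltac nin hx := move: hx; rewrite !inE !negb_or; let h1 := fresh "h" in move=> h1;
  repeat (let h2 := fresh "h" in case/andP: h1 => h2 h1); repeat (apply/andP; split); by [].
End WordRam.

(** * Phrases and the trie that stores them *)

Module Phrases.
Import WordRam.
Set Implicit Arguments.
Unset Strict Implicit.
Unset Printing Implicit Defensive.
Local Open Scope nat_scope.

Section Parse.
Variables (B X M : nat).

(** A phrase starting at p may be extended by u if it stays inside one block and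
    within span X, and if there are at most M sets of the new size inside the new
    interval from p to u.  The upper argument of the binomial coefficient is
    u - p + 1, in the form in which the table of binomials is indexed. *)
Definition ok (cu : seq nat) (u : nat) : bool :=
  let p := head 0 cu in
  [&& p %/ B == u %/ B, u - p < X &
      'C(u - p - size cu + (size cu).+1, (size cu).+1) <= M].

(** The closed phrases and the current one. *)
Definition pstate := (seq (seq nat) * seq nat)%type.

Definition pclose (st : pstate) : pstate := (rcons st.1 st.2, [::]).
Definition ppush (st : pstate) u : pstate := (st.1, rcons st.2 u).
Definition pstep (st : pstate) u := ppush (if ok st.2 u then st else pclose st) u.
(** The current phrase is empty at first and may be closed as such: the empty
    phrase is the root of the trie and is never output. *)
Definition parse := foldl pstep ([::], [::]).
Definition phrases l := rcons (parse l).1 (parse l).2.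
Definition pflat (st : pstate) := flatten st.1 ++ st.2.

Lemma pflat_close st : pflat (pclose st) = pflat st.
Proof. by rewrite /pflat /pclose /= flatten_rcons cats0. Qed.

Lemma pflat_push st u : pflat (ppush st u) = rcons (pflat st) u.
Proof. by rewrite /pflat /ppush /= rcons_cat. Qed.

Lemma pflat_parse l : pflat (parse l) = l.
Proof.
elim/last_ind: l => // l u IH.
rewrite /parse -cats1 foldl_cat /= -/(parse l) /pstep pflat_push cats1.
by case: ifP => _; rewrite ?pflat_close IH.
Qed.

Lemma flatten_phrases l : flatten (phrases l) = l.
Proof. by rewrite /phrases flatten_rcons -[LHS]/(pflat (parse l)) pflat_parse. Qed.

Lemma parse_rcons l u : parse (rcons l u) = pstep (parse l) u.
Proof. by rewrite /parse -cats1 foldl_cat. Qed.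

Lemma phrases_uniq l : uniq l -> uniq (phrases l).
Proof.
elim/last_ind: l => // l u IH; rewrite rcons_uniq => /andP [ul /IH].
rewrite /phrases parse_rcons /pstep !rcons_uniq => /andP [n1 u1].
case: ifP => _ /=.
  rewrite u1 andbT; apply/negP => h.
  move: ul; rewrite -{1}[l]flatten_phrases; case/negP; apply/flattenP.
  by exists (rcons (parse l).2 u); rewrite ?mem_rcons ?inE ?h ?orbT ?eqxx.
rewrite rcons_uniq n1 u1 !andbT; apply/negP => h.
move: ul; rewrite -{1}[l]flatten_phrases; case/negP; apply/flattenP.
by exists [:: u]; rewrite ?inE //.
Qed.

Lemma cu_suffix l : exists l', l = l' ++ (parse l).2.
Proof. by exists (flatten (parse l).1); rewrite -[LHS]pflat_parse. Qed.

Lemma sorted_span (l : seq nat) u : sorted ltn l -> all (fun x => x < u) l ->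
  size l <= u - head 0 l.
Proof.
case: l => [|p l] //= hp /andP [pu hl].
suff H : forall q, path ltn q l -> q < u -> size l < u - q by apply: H.
elim: l hl {p pu hp} => [|p l IH] /= => [_ q _|/andP [pu hl] q /andP [qp hp] qu]; first by rewrite subn_gt0.
have := IH hl _ hp pu; lia.
Qed.

(** Because of this inequality the truncated subtraction in [ok] is exact. *)
Lemma cu_span l u : sorted ltn l -> all (fun x => x < u) l ->
  size (parse l).2 <= u - head 0 (parse l).2.
Proof.
have [l' e] := cu_suffix l.
rewrite {1 2}e => s a; apply: sorted_span.
  by move: s; rewrite !(sorted_pairwise ltn_trans) pairwise_cat => /and3P [].
by move: a; rewrite all_cat => /andP [].
Qed.
End Parse.

Section Mem.
Variables (n N : nat).
Hypothesis Nn : N <= n.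

Definition updp (ph : nat -> pstate) (v : nat) (st : pstate) : nat -> pstate :=
  fun x => if x == v then st else ph x.

Definition members (Z : seq (seq nat * nat)) (s : seq nat) : seq nat :=
  [seq z.2 | z <- Z & z.1 == s].

(** The phrase structure in memory.  [ROW] has n cells per vertex and holds the
    rows, [RL] their lengths, [OFF] the positions where the current phrases
    start, [CUR] their nodes in the trie.  [nds] lists the words of the trie by
    node number; node 0 is the empty word, and the root is nobody's child, so
    that [CHILD] may use 0 for an absent child and needs no initialization.  [Z]
    lists the closed phrases together with their vertices: [CNT] and [MEMB] give
    for every node the vertices that closed this phrase, and [REPV], [REPO] and
    [DEP] locate one occurrence of it in some row. *)
Record Mem (ROW RL OFF CUR CHILD CNT MEMB REPV REPO DEP : nat -> nat)
    (ph : nat -> pstate) (nds : seq (seq nat)) (Z : seq (seq nat * nat)) : Prop := MkMem {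
  m1 : forall v, v < N -> RL v = size (pflat (ph v));
  m2 : forall v j, v < N -> j < n -> ROW (v * n + j) = nth 0 (pflat (ph v)) j;
  m3 : forall v, v < N -> OFF v = size (flatten (ph v).1);
  m4 : forall v, v < N -> CUR v < size nds /\ nth [::] nds (CUR v) = (ph v).2;
  m5 : [/\ uniq nds, exists nds', nds = [::] :: nds' &
         forall s y, rcons s y \in nds -> s \in nds];
  m6 : forall i u, i < size nds -> u < n -> CHILD (i * n + u) =
         if rcons (nth [::] nds i) u \in nds then index (rcons (nth [::] nds i) u) nds else 0;
  m6' : forall i u, size nds <= i -> u < n -> CHILD (i * n + u) = 0;
  m7 : forall i, CNT i = if i < size nds then size (members Z (nth [::] nds i)) else 0;
  m8 : forall i j, i < size nds -> j < CNT i ->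
         MEMB (i * n + j) = nth 0 (members Z (nth [::] nds i)) j;
  m9 : forall i, i < size nds -> 0 < CNT i ->
         [/\ REPV i < N, DEP i = size (nth [::] nds i),
             REPO i + DEP i <= size (pflat (ph (REPV i))) &
             forall j, j < DEP i -> nth 0 (pflat (ph (REPV i))) (REPO i + j) =
                                    nth 0 (nth [::] nds i) j];
  m10 : forall v, v < N -> [seq z.1 | z <- Z & z.2 == v] = (ph v).1;
  m11 : [/\ uniq Z, all (fun z => z.2 < N) Z & forall z, z \in Z -> z.1 \in nds]
}.

Lemma idx_inj i i' j j' : j < n -> j' < n -> (i * n + j == i' * n + j') = (i == i') && (j == j').
Proof. exact: loc_inj. Qed.

Lemma members_lt Z s v : uniq Z -> all (fun z => z.2 < N) Z -> v < N -> (s, v) \notin Z ->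
  size (members Z s) < N.
Proof.
move=> uZ aZ vN nZ.
have um : uniq (v :: members Z s).
  rewrite /= map_inj_in_uniq ?filter_uniq // => [|[a b] [c d]].
    rewrite andbT; apply/negP => /mapP [[a b]]; rewrite mem_filter /= => /andP [/eqP -> h] e.
    by move: nZ; rewrite e h.
  by rewrite !mem_filter /= => /andP [/eqP -> _] /andP [/eqP -> _] ->.
have : {subset v :: members Z s <= iota 0 N}.
  move=> x; rewrite inE mem_iota /= => /orP [/eqP ->|/mapP [z]] //.
  by rewrite mem_filter => /andP [_ /(allP aZ) h] ->.
by move/(uniq_leq_size um); rewrite /= size_iota.
Qed.

Lemma nth_inj_uniq (nds : seq (seq nat)) i j : uniq nds -> i < size nds -> j < size nds ->
  (nth [::] nds i == nth [::] nds j) = (i == j).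
Proof. by move=> u hi hj; rewrite nth_uniq. Qed.

(** The bound on [CNT] keeps the new entry inside the part of [MEMB] that belongs
    to its node: the vertex is not yet among the members of this phrase. *)
Lemma Mem_close ROW RL OFF CUR CHILD CNT MEMB REPV REPO DEP ph nds Z v :
  Mem ROW RL OFF CUR CHILD CNT MEMB REPV REPO DEP ph nds Z ->
  v < N -> (ph v).2 \notin (ph v).1 ->
  let i := CUR v in
  CNT i < n /\
  Mem ROW RL (updm OFF v (RL v)) (updm CUR v 0) CHILD (updm CNT i (CNT i + 1))
    (updm MEMB (i * n + CNT i) v) (updm REPV i v) (updm REPO i (OFF v))
    (updm DEP i (RL v - OFF v)) (updp ph v (pclose (ph v))) nds (rcons Z ((ph v).2, v)).
Proof.
move=> [h1 h2 h3 h4 [h5 [nds' h5'] h5p] h6 h6' h7 h8 h9 h10 [h11 h12 h13]] vN nin i.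
have [iv ei] := h4 _ vN; rewrite -/i in iv ei.
have nZ : ((ph v).2, v) \notin Z.
  apply/negP => h; case/negP: nin; rewrite -h10 //; apply/mapP.
  by exists ((ph v).2, v); rewrite // mem_filter /= eqxx.
have lt : CNT i < n by rewrite h7 iv ei; apply: leq_trans (members_lt h11 h12 vN nZ) Nn.
have fl x : pflat (updp ph v (pclose (ph v)) x) = pflat (ph x).
  by rewrite /updp; case: eqP => // ->; rewrite pflat_close.
have memE i' : i' < size nds -> members (rcons Z ((ph v).2, v)) (nth [::] nds i') =
    if i' == i then rcons (members Z (nth [::] nds i)) v else members Z (nth [::] nds i').
  move=> hi'; rewrite /members filter_rcons /= -ei nth_inj_uniq // eq_sym.
  by case: eqP => [->|//]; rewrite map_rcons.
split=> //; split=> //.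
- by move=> x xN; rewrite fl h1.
- by move=> x j xN jn; rewrite fl h2.
- move=> x xN; rewrite updmE /updp; case: eqP => [_|_]; last exact: h3.
  by rewrite /pclose /= flatten_rcons h1.
- move=> x xN; rewrite updmE /updp; case: eqP => [_|_]; last exact: h4.
  by rewrite h5'.
- by split=> //; exists nds'.
- move=> i'; rewrite updmE h7 (h7 i'); case: eqP => [->|ne].
    by rewrite iv memE // eqxx size_rcons addn1.
  by case: ifP => // hi'; rewrite memE //; case: eqP ne.
- move=> i' j hi'; rewrite !updmE memE //.
  have [-> hj|ne hj] := eqVneq i' i.
    rewrite idx_inj ?eqxx /=; [|lia|lia].
    rewrite nth_rcons -[size (members _ _)]/(size (members Z (nth [::] nds i))).
    have eC : CNT i = size (members Z (nth [::] nds i)) by rewrite h7 iv.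
    rewrite -eC; case: (ltngtP j (CNT i)) => [hj'|hj'|//]; last by lia.
    by rewrite h8.
  have jn : j < n.
    apply: leq_trans hj _; rewrite h7 hi' -(size_map id) map_id.
    have : {subset members Z (nth [::] nds i') <= iota 0 N}.
      by move=> x /mapP [z]; rewrite mem_filter mem_iota => /andP [_ /(allP h12) ?] ->.
    move/uniq_leq_size; rewrite size_iota => H; apply: leq_trans Nn; apply: H.
    rewrite map_inj_in_uniq ?filter_uniq // => -[a b] [c d].
    by rewrite !mem_filter /= => /andP [/eqP -> _] /andP [/eqP -> _] ->.
  by rewrite idx_inj // (negbTE ne) /= h8.
- move=> i' hi'; rewrite !updmE; have [-> _|ne hc] := eqVneq i' i.
    rewrite fl h1 // h3 // ei; split=> //.
    + by rewrite /pflat size_cat; lia.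
    + by rewrite /pflat size_cat; lia.
    + move=> j hj; rewrite /pflat nth_cat ifF; last lia.
      by congr nth; lia.
  by rewrite !fl; apply: h9.
- move=> x xN; rewrite filter_rcons /= /updp [v == x]eq_sym; case: eqP => [->|_]; last exact: h10.
  by rewrite map_rcons /= h10.
- split; first by rewrite rcons_uniq nZ.
    by rewrite all_rcons /= vN.
  by move=> z; rewrite mem_rcons inE => /orP [/eqP ->|/h13 //]; rewrite -ei mem_nth.
Qed.

(** Appending u to the current phrase moves to a child in the trie, which is
    created under the next free number if it is absent. *)
Lemma Mem_push ROW RL OFF CUR CHILD CNT MEMB REPV REPO DEP ph nds Z v u :
  Mem ROW RL OFF CUR CHILD CNT MEMB REPV REPO DEP ph nds Z ->
  v < N -> u < n -> size (pflat (ph v)) < n ->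
  let a := CUR v * n + u in
  let new := CHILD a == 0 in
  let i := if new then size nds else CHILD a in
  Mem (updm ROW (v * n + RL v) u) (updm RL v (RL v + 1)) OFF (updm CUR v i)
    (if new then updm CHILD a i else CHILD) CNT MEMB REPV REPO DEP
    (updp ph v (ppush (ph v) u))
    (if new then rcons nds (rcons (ph v).2 u) else nds) Z.
Proof.
move=> [h1 h2 h3 h4 [h5 [nds' h5'] h5p] h6 h6' h7 h8 h9 h10 [h11 h12 h13]] vN un sn a new i.
have [iv ei] := h4 _ vN.
have aE : CHILD a = if rcons (ph v).2 u \in nds then index (rcons (ph v).2 u) nds else 0.
  by rewrite /a h6 // ei.
have newE : new = (rcons (ph v).2 u \notin nds).
  rewrite /new aE; case: ifP => //= h; apply/negbTE.
  by rewrite h5' /= (_ : ([::] == rcons (ph v).2 u) = false) //; case: (ph v).2.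
have fl x : pflat (updp ph v (ppush (ph v) u) x) =
    if x == v then rcons (pflat (ph v)) u else pflat (ph x).
  by rewrite /updp; case: eqP => // _; rewrite pflat_push.
pose nds1 := if new then rcons nds (rcons (ph v).2 u) else nds.
have snds : size nds <= size nds1 by rewrite /nds1; case: ifP => //; rewrite size_rcons.
have nth1 j : j < size nds -> nth [::] nds1 j = nth [::] nds j.
  by move=> hj; rewrite /nds1; case: ifP => // _; rewrite nth_rcons hj.
have u1 : uniq nds1 by rewrite /nds1; case: ifP => //; rewrite rcons_uniq h5 newE => ->.
have hi1 : i < size nds1 /\ nth [::] nds1 i = rcons (ph v).2 u.
  rewrite /i /nds1; case: ifP.
    by rewrite size_rcons nth_rcons ltnn eqxx.
  by rewrite newE => /negbFE h; rewrite aE h index_mem nth_index.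
rewrite -/nds1; split.
- by move=> x xN; rewrite fl updmE; case: eqP => [_|_]; rewrite ?size_rcons ?h1 // addn1.
- move=> x j xN jn; rewrite updmE fl idx_inj // ?h1 //.
  have [->|_] /= := eqVneq x v; last by rewrite h2.
  by rewrite nth_rcons; case: (ltngtP j) => hj; rewrite ?h2 // nth_default // ltnW.
- move=> x xN; rewrite /updp; case: eqP => [->|_]; rewrite h3 //.
- move=> x xN; rewrite updmE /updp; case: eqP => // _.
  by have [q1 q2] := h4 _ xN; rewrite (leq_trans q1) ?nth1.
- split=> //.
    by rewrite /nds1 h5'; case: ifP => _; [rewrite rcons_cons; eexists|exists nds'].
  move=> t y; rewrite /nds1; case: ifP => // _; last exact: h5p.
  rewrite !mem_rcons !inE => /orP [|/h5p ->]; last by rewrite orbT.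
  by rewrite eqseq_rcons => /andP [/eqP -> _]; rewrite -ei mem_nth // orbT.
- move=> j y hj yn.
  have cE : (if new then updm CHILD a i else CHILD) (j * n + y) =
     if new && ((j == CUR v) && (y == u)) then i else CHILD (j * n + y).
    by case: ifP => //= _; rewrite updmE idx_inj.
  rewrite cE; have [hj'|hj'] := ltnP j (size nds).
    rewrite nth1 //; have [/andP [jE /eqP yE]|ne] := boolP ((j == CUR v) && (y == u)).
      rewrite andbT (eqP jE) yE ei; have [q1 q2] := hi1.
      rewrite -q2 mem_nth // index_uniq //; case: ifP => // nw.
      by rewrite /i nw.
    rewrite h6 // /nds1; case: (boolP new) => // nw; rewrite ?(negbTE ne) /=.
    rewrite mem_rcons inE.
    have -> : (rcons (nth [::] nds j) y == rcons (ph v).2 u) = false.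
      apply: contraNF ne; rewrite eqseq_rcons -ei => /andP [e1 ->].
      by rewrite -(nth_inj_uniq h5) // e1.
    by case: ifP => //= h; rewrite -[rcons nds _]cats1 index_cat h.
  have nw : new by move: hj; rewrite /nds1; case: ifP => // _; rewrite ltnNge hj'.
  have jE : j = size nds by move: hj; rewrite /nds1 nw size_rcons; lia.
  have -> : (j == CUR v) = false by apply/eqP; lia.
  rewrite andbF h6' //.
  have e1 : nth [::] nds1 j = rcons (ph v).2 u by rewrite /nds1 nw nth_rcons jE ltnn eqxx.
  have -> // : (rcons (nth [::] nds1 j) y \in nds1) = false.
  rewrite e1 /nds1 nw mem_rcons inE; apply/negbTE; rewrite negb_or; apply/andP; split.
    by apply/eqP => /(congr1 size); rewrite !size_rcons; lia.
  by apply/negP => /h5p; apply/negP; rewrite -newE.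
- move=> j y hj yn.
  have cE : (if new then updm CHILD a i else CHILD) (j * n + y) = CHILD (j * n + y).
    by case: ifP => //= _; rewrite updmE idx_inj // ifF //; apply/negP => /andP [/eqP]; lia.
  by rewrite cE h6' //; lia.
- move=> j; rewrite h7; case: (ltnP j (size nds)) => hj.
    by rewrite (leq_trans hj) // nth1.
  case: ifP => // hj'.
  have nw : new by move: hj'; rewrite /nds1; case: ifP => // _; rewrite ltnNge hj.
  have jE : j = size nds by move: hj'; rewrite /nds1 nw size_rcons; lia.
  have e1 : nth [::] nds1 j = rcons (ph v).2 u by rewrite /nds1 nw nth_rcons jE ltnn eqxx.
  rewrite e1 /members (_ : [seq z <- Z | _] = [::]) //.
  apply/eqP; rewrite -[_ == _]negbK -has_filter; apply/negP => /hasP [z zZ /eqP ez].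
  by move: nw; rewrite newE -ez => /negP; apply; apply: h13.
- move=> j y hj hy.
  have hj' : j < size nds by move: hy; rewrite h7; case: (j < size nds).
  by rewrite nth1 // h8.
- move=> j hj hc.
  have hj' : j < size nds by move: hc; rewrite h7; case: (j < size nds).
  have [q1 q2 q3 q4] := h9 _ hj' hc.
  rewrite nth1 // fl; case: eqP => [e|_]; last by split.
  rewrite -e size_rcons; split=> //; first by lia.
  by move=> y hy; rewrite nth_rcons ifT ?q4 //; lia.
- by move=> x xN; rewrite /updp; case: eqP => [->|_]; rewrite h10.
- split=> // z zZ; have := h13 _ zZ; rewrite /nds1; case: ifP => // _.
  by rewrite mem_rcons inE orbC => ->.
Qed.

Lemma Mem0 : Mem (fun=> 0) (fun=> 0) (fun=> 0) (fun=> 0) (fun=> 0) (fun=> 0) (fun=> 0)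
  (fun=> 0) (fun=> 0) (fun=> 0) (fun=> ([::], [::])) [:: [::]] [::].
Proof.
split=> //.
- by move=> v j _ _; rewrite nth_nil.
- split=> //; first by exists [::].
  by move=> s y; rewrite inE => /eqP /(congr1 size); rewrite size_rcons.
- move=> [|i] u //= _ _; case: ifP => //; rewrite inE => /eqP //.
- by move=> i; case: ifP.
Qed.
End Mem.
End Phrases.

(** * Program: renumbering the vertices *)

Module Prepass.
Import WordRam Phrases.
Set Implicit Arguments.
Unset Strict Implicit.
Unset Printing Implicit Defensive.
Local Open Scope nat_scope.

Opaque ASel AFor.

(** One pass over the records of the input: array 2 receives the names of the
    listed vertices, array 1 the inverse numbering, register 14 the maximum D of
    min (degree, N - 1 - degree). *)
Definition prepass_body :=
  ARd 20 0 11;; AOp OAdd 11 11 3;; ARd 21 0 11;;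
  AWr 1 20 12;; AWr 2 12 20;;
  AOp OSub 22 5 21;; AOp OSub 22 22 3;;
  AOp OLt 23 21 22;; ASel 22 23 21 22;;
  AOp OLt 23 14 22;; ASel 14 23 22 14;;
  AOp OAdd 11 11 21;; AOp OAdd 11 11 3.

Definition prepass :=
  AConst 3 1;; AConst 17 2;; AConst 16 0;; ARd 5 0 3;; AConst 11 2;; AConst 12 0;; AConst 14 0;;
  AFor 19 12 5 prepass_body.

Section Verif.
Variables (w n N S : nat) (nm : nat -> nat) (adj : nat -> seq nat) (inp : nat -> nat).
Hypothesis w0 : 0 < w.
Hypothesis n20 : 20 <= n.
Hypothesis Nn : N <= n.
Hypothesis SU : 20 * S <= 2 ^ w.
Hypothesis nnS : n * n * n + 100 * n * n < S.

(** The address of the record of the u-th listed vertex in the input. *)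
Fixpoint st (u : nat) := if u is u'.+1 then st u' + 2 + size (adj u') else 2.

Hypothesis inp0 : inp 0 = n.
Hypothesis inp1 : inp 1 = N.
Hypothesis inp_nm : forall u, u < N -> inp (st u) = nm u.
Hypothesis inp_dg : forall u, u < N -> inp (st u + 1) = size (adj u).
Hypothesis inp_nb : forall u j, u < N -> j < size (adj u) ->
  inp (st u + 2 + j) = nm (nth 0 (adj u) j).
Hypothesis nm_lt : forall u, u < N -> nm u < n.
Hypothesis nm_inj : forall u v, u < N -> v < N -> nm u = nm v -> u = v.
Hypothesis adj_lt : forall u v, u < N -> v \in adj u -> v < N.
Hypothesis adj_size : forall u, u < N -> size (adj u) < N.
Hypothesis adj_uniq : forall u, u < N -> uniq (adj u).

Lemma st_le u : u <= N -> st u <= 2 + u * (n + 1).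
Proof.
elim: u => // u IH uN /=; move: (IH (ltnW uN)) (adj_size uN) Nn (uN); clear; nia.
Qed.

Lemma st_S u : u <= N -> st u < n * n + 2 * n + 3.
Proof. by move=> uN; move: (st_le uN) (uN) Nn; clear; nia. Qed.

(** The quantity D on which the parameters depend: every listed vertex has at
    most D neighbours or at most D listed non-neighbours. *)
Definition maxmin u := \max_(i < u) minn (size (adj i)) (N - 1 - size (adj i)).

Definition pos_ok (POS NAM : nat -> nat) u :=
  forall i, i < u -> POS (nm i) = i /\ NAM i = nm i.

Record Base (b : ast) : Prop := {
  b3 : rg b 3 = 1; b4 : rg b 4 = n; b5 : rg b 5 = N; b16 : rg b 16 = 0; b17 : rg b 17 = 2;
  bI : ar b 0 = inp }.

(** Arrays from number 3 on are still zero: the later phases rely on it. *)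
Definition I1 (t : seq nat) c0 (u : nat) (b : ast) : Prop :=
  [/\ Base b, rg b 12 = u /\ rg b 11 = st u, rg b 14 = maxmin u, pos_ok (ar b 1) (ar b 2) u &
   [/\ forall a, 2 < a -> ar b a = fun=> 0, tp b = t & ck b <= c0 + 80 * u]].

Lemma maxminS u : maxmin u.+1 = maxn (maxmin u) (minn (size (adj u)) (N - 1 - size (adj u))).
Proof. by rewrite /maxmin big_ord_recr. Qed.

Lemma maxmin_le u : u <= N -> maxmin u <= N.
Proof.
move=> uN; apply/bigmax_leqP => i _; apply: leq_trans (geq_minl _ _) _.
by apply/ltnW/adj_size; apply: leq_trans uN.
Qed.

Lemma prepass_bodyP t c0 u b : u < N -> I1 t c0 u b ->
  wp w S prepass_body
  (fun b' => [/\ rg b' 12 = u, rg b' 5 = N, rg b' 3 = 1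
    & I1 t c0 u.+1 (forstep 19 12 u.+1 (u.+1 < N) b')]) (tick (tick b 1) 1).
Proof.
move=> uN [[b3 b4 b5 b16 b17 bI] [b12 b11] b14 hp [b0 bt bk]].
have h1 := nnS; have h2 := SU; have h3 := n20; have h4 := Nn.
have h5 := st_S uN; have h6 := st_S (ltnW uN); have h7 := adj_size uN.
have h8 := nm_lt uN; have h9 := maxmin_le (ltnW uN); have h10 := maxmin_le uN.
rewrite /prepass_body /= ?b3 ?b4 ?b5 ?b11 ?b12 ?b14 ?bI.
have hN : N < S by nia.
have hnS : n < S by nia.
have hU1 : S < 2 ^ w by lia.
have hst : st u + 1 < S by nia.
have hst' : st u.+1 + 1 < S by nia.
ws; move=> _ ->; ws; move=> _ ->; ws; move=> _ ->; rewrite inp_dg // inp_nm //; ws.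
move=> _ ->; ws; move=> _ ->; ws; move=> v Ev; ws.
apply: (@wp_sel w S w0 22 23 21 22 (size (adj u) < N - size (adj u) - 1)); rewrite //=; try lia.
ws; move=> _ ->; ws.
set e := (if _ then size (adj u) else N - _ - _).
have eE : e = minn (size (adj u)) (N - 1 - size (adj u)).
  by rewrite /e (_ : N - 1 - size (adj u) = N - size (adj u) - 1) //; lia.
apply: (@wp_sel w S w0 14 23 22 14 (maxmin u < e)); rewrite //= ?b14; try lia.
ws; move=> _ ->; ws; move=> _ ->; rewrite b3 b5 b12; split=> //.
split=> //=.
- by split=> //; lia.
- by rewrite maxminS -eE /maxn.
- move=> i; rewrite ltnS leq_eqVlt => /orP [/eqP ->|iu].
    by rewrite !updmE !eqxx.
  rewrite !updmE; have -> : (nm i == nm u) = false.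
    by apply/eqP => /nm_inj e1; move: (e1 ltac:(lia) uN); lia.
  by rewrite ifF; [exact: hp|apply/eqP; lia].
- split=> //; last by lia.
  by move=> [|[|[|a]]] //= _; apply: b0.
Qed.

Lemma prepassP a (Q : ast -> Prop) t :
  rg a 4 = n -> ar a 0 = inp -> (forall i, 0 < i -> ar a i = fun=> 0) -> tp a = t ->
  (forall b, I1 t (ck a + 100) N b -> Q b) -> wp w S prepass Q a.
Proof.
move=> a4 aI a0 at0 hQ.
have h1 := nnS; have h2 := SU; have h3 := n20; have h4 := Nn.
have hN : N < S by nia.
have hnS : n < S by nia.
have hU1 : S < 2 ^ w by lia.
have S5 : 5 < S by nia.
rewrite /prepass /=; ws; move=> _ ->; ws; rewrite aI inp1.
apply: (@wp_for w S w0 19 12 5 prepass_body (I1 t (ck a + 50)) 0 N) => //; first by lia.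
- split=> //; first by rewrite /maxmin big_ord0.
  split=> //=; last by lia.
  by move=> i i2; apply: a0; lia.
- by move=> j b hj Ij _ _ _; apply: prepass_bodyP.
- move=> b [hb h12 h14 hp [hz ht hk]] _ _ _; apply: hQ.
  by split=> //=; [case: hb; split|split=> //; lia].
Qed.
End Verif.
End Prepass.

(** * Program: parameters, coins and binomial coefficients *)

Module Tables.
Import WordRam Phrases Prepass.
Set Implicit Arguments.
Unset Strict Implicit.
Unset Printing Implicit Defensive.
Local Open Scope nat_scope.
Opaque ASel AFor.

Lemma kf_ex N : exists k, N < k ^ 8.
Proof. by exists N.+1; rewrite -{1}[N.+1]expn1 leq_pexp2l. Qed.
(** The number of blocks, about N^(1/8), found by trying all values in turn. *)
Definition kf N := ex_minn (kf_ex N).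

Lemma ellf_ex N : exists l, N < 2 ^ l.
Proof. by exists N; apply: ltn_expl. Qed.
(** The number of binary digits of N, which replaces lg N in the program. *)
Definition ellf N := ex_minn (ellf_ex N).

Lemma kf_unique N k : N < k ^ 8 -> (forall j, j < k -> j ^ 8 <= N) -> kf N = k.
Proof.
move=> h1 h2; rewrite /kf; case: ex_minnP => m m1 m2.
have := m2 _ h1; have [mk|//] := ltnP m k; last by lia.
by have := h2 _ mk; lia.
Qed.

Lemma ellf_unique N k : N < 2 ^ k -> (forall j, j < k -> 2 ^ j <= N) -> ellf N = k.
Proof.
move=> h1 h2; rewrite /ellf; case: ex_minnP => m m1 m2.
have := m2 _ h1; have [mk|//] := ltnP m k; last by lia.
by have := h2 _ mk; lia.
Qed.

Lemma kf_gt0 N : 0 < kf N.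
Proof. by rewrite /kf; case: ex_minnP => -[]. Qed.

Lemma ltn_kf N : N < kf N ^ 8.
Proof. by rewrite /kf; case: ex_minnP. Qed.

Lemma kf_leq N : (kf N).-1 ^ 8 <= N.
Proof.
rewrite /kf; case: ex_minnP => -[|m] m1 m2 //=.
by rewrite leqNgt; apply/negP => /m2; rewrite ltnn.
Qed.

Lemma ltn_ellf N : N < 2 ^ ellf N.
Proof. by rewrite /ellf; case: ex_minnP. Qed.

Lemma ellf_leq N : ellf N <= N.
Proof. by rewrite /ellf; case: ex_minnP => m _; apply; apply: ltn_expl. Qed.

Lemma kf_le4 N : kf N ^ 2 <= 4 * N + 1.
Proof.
have := kf_leq N; have := kf_gt0 N; case: (kf N) => // -[|k] _ /=; first by rewrite addn1.
move=> h; have : k.+1 ^ 2 <= k.+1 ^ 8 by rewrite leq_pexp2l.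
rewrite !expnS !expn0; nia.
Qed.

Lemma pow8_le k N : k ^ 8 <= N -> k.+1 ^ 8 <= 256 * N + 1.
Proof.
case: k => [|k] h; first by rewrite exp1n addn1.
apply: leq_trans (leq_addr _ _).
have -> : 256 = 2 ^ 8 by [].
apply: leq_trans (leq_mul (leqnn _) h); rewrite -(expnMn 2 k.+1 8).
by rewrite leq_exp2r //; lia.
Qed.

Lemma kf8 N : kf N ^ 8 <= 256 * N + 1.
Proof. by have := pow8_le (kf_leq N); rewrite prednK // kf_gt0. Qed.

Lemma pow8_ge4 k : k ^ 4 <= k ^ 8.
Proof. by case: k => [|k] //; rewrite leq_pexp2l. Qed.

(** Block length, bound on the span, and bound on the number of patterns.  The
    span bound is more than N (lg N)^2 / (D + 1) or equal to the number of blocks,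
    so that one phrase per X vertices is negligible; with M = N / X^4, so is X^3 M.
    It stays n^o(1) unless D is very small. *)
Definition Bf N := N %/ kf N + 1.
Definition Xf N D := minn (N * ellf N ^ 2 %/ (D + 1) + 1) (kf N).
Definition Mf N D := N %/ Xf N D ^ 4.

Lemma Xf_gt0 N D : 0 < Xf N D.
Proof. by rewrite /Xf leq_min kf_gt0 addn1. Qed.

Definition kcalc :=
  AOp OMul 20 6 6;; AOp OMul 20 20 20;; AOp OMul 20 20 20;; AOp OLt 21 5 20;; AOp OEq 21 21 16.

Definition kloop := AConst 6 1;; kcalc;; AWhile 21 (AOp OAdd 6 6 3;; kcalc).

Definition elloop := AConst 15 0;; AOp OShr 20 5 15;;
  AWhile 20 (AOp OAdd 15 15 3;; AOp OShr 20 5 15).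

Definition params :=
  AOp OMul 20 15 15;; AOp OMul 20 5 20;; AOp OAdd 21 14 3;; AOp ODiv 20 20 21;; AOp OAdd 20 20 3;;
  AOp OLt 21 20 6;; ASel 8 21 20 6;;
  AOp OMul 20 8 8;; AOp OMul 20 20 20;; AOp ODiv 9 5 20;; AOp OAdd 10 8 3;;
  AOp ODiv 7 5 6;; AOp OAdd 7 7 3.

(** Random word number e = i * k + j is written at (i, j) and at (j, i).  A pair
    is written twice, and the later word, that with i >= j, remains: this is what
    [coin] says. *)
Definition coins_body :=
  AOp ODiv 20 12 6;; AOp OMod 21 12 6;; ARnd 23;; AOp OMod 23 23 17;; AWr 3 12 23;;
  AOp OMul 24 21 6;; AOp OAdd 24 24 20;; AWr 3 24 23.

Definition coins := AOp OMul 22 6 6;; AConst 12 0;; AFor 19 12 22 coins_body.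

(** The common continuation of both branches of the test below; it is opaque so
    that it is verified once. *)
Definition pascal_tail := AOp OLt 25 9 24;; AOp OAdd 26 9 3;; ASel 24 25 26 24;; AWr 4 12 24.
Lemma pascal_tailE :
  pascal_tail = (AOp OLt 25 9 24;; AOp OAdd 26 9 3;; ASel 24 25 26 24;; AWr 4 12 24).
Proof. by []. Qed.
Opaque pascal_tail.

(** The table is capped at M + 1: this preserves comparisons with M and avoids
    overflow. *)
Definition pascal_body :=
  AOp OMod 20 12 10;; AOp OLt 21 12 10;; AOp OEq 23 20 16;; AOp OAdd 21 21 23;;
  AIf 21 (AConst 24 1)
    (AOp OSub 25 12 3;; ARd 24 4 25;; AOp OSub 25 12 10;; ARd 25 4 25;; AOp OAdd 24 24 25);;
  pascal_tail.

Definition pascal := AOp OMul 22 10 10;; AConst 12 0;; AFor 19 12 22 pascal_body.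

Section Verif.
Variables (w n N S : nat) (inp : nat -> nat).
Hypothesis w0 : 0 < w.
Hypothesis n20 : 20 <= n.
Hypothesis Nn : N <= n.
Hypothesis SU : 20 * S <= 2 ^ w.
Hypothesis nnS : n * n * n + 100 * n * n < S.

Local Notation Base := (Base n N inp).

Lemma kloopP a (Q : ast -> Prop) : Base a ->
  (forall b, Base b -> ar b = ar a -> tp b = tp a -> ck b <= ck a + 100 * (N + 2) ->
     rg b 6 = kf N -> rg b 14 = rg a 14 -> Q b) ->
  wp w S kloop Q a.
Proof.
move=> [a3 a4 a5 a16 a17 aI] hQ.
have h1 := nnS; have h2 := SU; have h3 := n20; have h4 := Nn.
have hb : 256 * N + 1 < 2 ^ w by nia.
have step k : k ^ 8 <= 256 * N + 1 -> k * k < 2 ^ w /\ k * k * (k * k) < 2 ^ w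
    /\ k * k * (k * k) * (k * k * (k * k)) = k ^ 8.
  have e8 : k * k * (k * k) * (k * k * (k * k)) = k ^ 8 by rewrite !expnS expn0; lia.
  have sq x : x <= x * x by case: (x) => // y; rewrite leq_pmulr.
  have := sq (k * k); have := sq (k * k * (k * k)); rewrite e8 => q1 q2 hk.
  by split; [|split] => //; lia.
have [s1 [s2 s3]] : 1 * 1 < 2 ^ w /\ 1 * 1 * (1 * 1) < 2 ^ w /\ 1 * 1 * (1 * 1) * (1 * 1 * (1 * 1)) = 1 ^ 8.
  by apply: step; rewrite exp1n addn1.
rewrite /kloop /=; ws.
rewrite ?a3 ?a5 ?a16.
ws; move=> _ ->; ws; move=> _ ->; ws; move=> _ ->; ws; move=> _ ->; ws; move=> _ ->.
split=> //.
exists (fun b => exists k, [/\ Base b, ar b = ar a, tp b = tp a, ck b <= ck a + 50 * k &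
   [/\ rg b 6 = k, 0 < k, rg b 21 = (k ^ 8 <= N), (forall j, j < k -> j ^ 8 <= N) &
     rg b 14 = rg a 14]]).
exists (fun b => N.+2 - rg b 6); split.
- exists 1; split=> //=; first by lia.
  by split=> //; [case: (N)|case].
- move=> b [k [[b3 b4 b5 b16 b17 bI] b1 b2 bk [b6 k0 b21 hj b14]]].
  rewrite b21 b6 eqb0 negbK => kN.
  have kN' : k <= N by apply: leq_trans kN; rewrite -{1}[k]expn1 leq_pexp2l.
  have [t1 [t2 t3]] : k.+1 * k.+1 < 2 ^ w /\ k.+1 * k.+1 * (k.+1 * k.+1) < 2 ^ w
    /\ k.+1 * k.+1 * (k.+1 * k.+1) * (k.+1 * k.+1 * (k.+1 * k.+1)) = k.+1 ^ 8.
    by apply: step; exact: pow8_le.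
  have t4 : k.+1 ^ 8 < 2 ^ w by apply: leq_ltn_trans hb; exact: pow8_le.
  rewrite b3 ?b5 ?b16; ws.
  move=> _ ->; rewrite addn1; ws; move=> _ ->; ws; move=> _ ->; ws; rewrite ?t3 //; move=> _ ->; ws; move=> _ ->; ws; move=> _ ->.
  split=> /=; last by lia.
  exists k.+1; split=> //=; first by lia.
  split=> //.
    by case: leqP.
  by move=> j; rewrite ltnS leq_eqVlt => /orP [/eqP ->|/hj].
- move=> b [k [[b3 b4 b5 b16 b17 bI] b1 b2 bk [b6 k0 b21 hj b14]]].
  rewrite b21 => /eqP; rewrite eqb0 -ltnNge => kN.
  have kE : kf N = k by apply: kf_unique.
  have kN' : k.-1 <= N.
    apply: leq_trans (hj k.-1 _); last by lia.
    by case: (k) => // -[|q] //=; rewrite -{1}[q.+1]expn1 leq_pexp2l.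
  by apply: hQ => //=; [lia|rewrite b6].
Qed.

Lemma elloopP a (Q : ast -> Prop) : Base a ->
  (forall b, Base b -> ar b = ar a -> tp b = tp a -> ck b <= ck a + 20 * (N + 2) ->
     rg b 15 = ellf N -> rg b 6 = rg a 6 -> rg b 14 = rg a 14 -> Q b) ->
  wp w S elloop Q a.
Proof.
move=> [a3 a4 a5 a16 a17 aI] hQ.
have h1 := nnS; have h2 := SU; have h3 := n20; have h4 := Nn.
have hb : N + 2 < 2 ^ w by nia.
rewrite /elloop /=; ws; rewrite a5; ws; move=> _ ->; split=> //.
exists (fun b => exists k, [/\ Base b, ar b = ar a, tp b = tp a, ck b <= ck a + 10 * (k + 1) &
   [/\ rg b 15 = k, rg b 20 = N %/ 2 ^ k, (forall j, j < k -> 2 ^ j <= N) &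
     rg b 6 = rg a 6 /\ rg b 14 = rg a 14]]).
exists (fun b => N.+2 - rg b 15); split.
- exists 0; split=> //=; first by lia.
- move=> b [k [[b3 b4 b5 b16 b17 bI] b1 b2 bk [b15 b20 hj [b6 b14]]]].
  rewrite b20 b15 -lt0n divn_gt0 ?expn_gt0 // => kN.
  have kN' : k <= N by apply: leq_trans kN; apply/ltnW/ltn_expl.
  rewrite b3 ?b5; ws; move=> _ ->; ws; move=> _ ->.
  split=> /=; last by lia.
  exists k.+1; split=> //=; first by lia.
  split=> //; first by lia.
    by rewrite addn1.
  by move=> j; rewrite ltnS leq_eqVlt => /orP [/eqP ->|/hj].
- move=> b [k [[b3 b4 b5 b16 b17 bI] b1 b2 bk [b15 b20 hj [b6 b14]]]].
  rewrite b20 => /eqP; rewrite -leqn0 leqNgt divn_gt0 ?expn_gt0 // -ltnNge => kN.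
  have kE : ellf N = k by apply: ellf_unique.
  have := ellf_leq N; rewrite kE => kN'.
  by apply: hQ => //=; [lia|rewrite b15].
Qed.

Record Env D (b : ast) : Prop := {
  eB : Base b; e6 : rg b 6 = kf N; e7 : rg b 7 = Bf N; e8 : rg b 8 = Xf N D;
  e9 : rg b 9 = Mf N D; e10 : rg b 10 = Xf N D + 1 }.

Lemma kf_small : kf N <= N + 1.
Proof.
have := kf_leq N; have := kf_gt0 N; case: (kf N) => // -[|k] _ /= h; first by rewrite addn1.
by rewrite addn1 ltnS; apply: leq_trans h; rewrite -{1}[k.+1]expn1 leq_pexp2l.
Qed.

Lemma paramsP a D (Q : ast -> Prop) : Base a -> D <= N -> rg a 14 = D -> rg a 6 = kf N ->
  rg a 15 = ellf N ->
  (forall b, Env D b -> ar b = ar a -> tp b = tp a -> ck b <= ck a + 50 -> Q b) ->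
  wp w S params Q a.
Proof.
move=> [a3 a4 a5 a16 a17 aI] DN a14 a6 a15 hQ.
have h1 := nnS; have h2 := SU; have h3 := n20; have h4 := Nn.
have hb : n * n * n + 100 * n * n < 2 ^ w by lia.
have hl := ellf_leq N; have hk := kf_small; have k0 := kf_gt0 N.
have l1 : ellf N * ellf N <= n * n by nia.
have l2 : N * (ellf N * ellf N) <= n * n * n by nia.
have hb3 : 256 * n + 100 < 2 ^ w by nia.
have q1 := leq_div (N * (ellf N * ellf N)) (D + 1).
rewrite /params /= ?a3 ?a5 ?a6 ?a14 ?a15; ws.
move=> _ ->; ws.
move=> _ ->; ws; move=> _ ->; ws; move=> _ ->; ws.
move=> _ ->; ws; move=> _ ->.
have eX : (if N * (ellf N * ellf N) %/ (D + 1) + 1 < kf N then N * (ellf N * ellf N) %/ (D + 1) + 1 else kf N) = Xf N D.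
  by rewrite /Xf /minn !expnS expn0 muln1.
apply: (@wp_sel w S w0 8 21 20 6 (N * (ellf N * ellf N) %/ (D + 1) + 1 < kf N)); rewrite //= ?a6; try lia.
rewrite ?eX.
have x1 : Xf N D <= kf N by rewrite /Xf geq_minr.
have x2 : Xf N D ^ 4 <= 256 * N + 1.
  apply: leq_trans (kf8 N); apply: leq_trans (pow8_ge4 _).
  by rewrite leq_exp2r.
have x4 : Xf N D * Xf N D * (Xf N D * Xf N D) = Xf N D ^ 4 by rewrite !expnS expn0; lia.
have x3 : Xf N D * Xf N D < 2 ^ w by nia.
have x5 : 256 * N + 1 < 2 ^ w by nia.
have nk : N %/ kf N <= N by apply: leq_div.
ws; move=> _ ->; ws; rewrite ?x4.
move=> _ ->; ws; rewrite ?a5; move=> _ ->; rewrite ?a3; ws; move=> _ ->; ws; rewrite ?a5 ?a6.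
move=> _ ->; ws; rewrite ?a3.
move=> _ ->; apply: hQ => //=; last by lia.
Qed.

Definition coin (t : seq nat) (i j : nat) := nth 0 t (maxn i j * kf N + minn i j) %% 2.

Lemma idx_lt a b k : a < k -> b < k -> a * k + b < k * k.
Proof. by move=> ak bk; apply: (@leq_trans (a.+1 * k)); [rewrite mulSn addnC ltn_add2r|rewrite leq_mul2r ak orbT]. Qed.

Lemma coinsP a D t (Q : ast -> Prop) : Env D a -> tp a = t ->
  (forall b, Env D b -> (forall i, i != 3 -> ar b i = ar a i) ->
     (forall i j, i < kf N -> j < kf N -> ar b 3 (i * kf N + j) = coin t i j) ->
     ck b <= ck a + 50 * (kf N * kf N + 2) -> Q b) ->
  wp w S coins Q a.
Proof.
move=> [[a3 a4 a5 a16 a17 aI] a6 a7 a8 a9 a10] at0 hQ.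
have h1 := nnS; have h2 := SU; have h3 := n20; have h4 := Nn.
have hb : n * n * n + 100 * n * n < 2 ^ w by lia.
have hk := kf_small; have k0 := kf_gt0 N.
have kk : kf N * kf N <= 4 * n + 1 by have := kf_le4 N; rewrite expnS expn1; move: h4; clear; lia.
have kS : kf N * kf N < S by nia.
have nS : n < S by nia.
rewrite /coins /=; ws; rewrite ?a6; try by lia.
move=> _ ->; rewrite ?a6; ws.
pose I e b := [/\ Env D b, (forall i, i != 3 -> ar b i = ar a i),
  (forall i j, i < kf N -> j < kf N -> maxn i j * kf N + minn i j < e ->
     ar b 3 (i * kf N + j) = coin t i j), tp b = drop e t & ck b <= ck a + 30 + 50 * e].
apply: (@wp_for w S w0 19 12 22 coins_body I 0 (kf N * kf N)) => //; first by lia.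
- split=> //=; last by lia.
    by rewrite drop0.
- move=> e b /andP [_ ekk] [[[b3 b4 b5 b16 b17 bI] b6 b7 b8 b9 b10] bz bc bt bk] b12 b22 _.
  have ek : e %/ kf N < kf N by rewrite ltn_divLR.
  have em : e %% kf N < kf N by rewrite ltn_mod.
  have ee := divn_eq e (kf N).
  rewrite /coins_body /= b12 b6; ws; move=> _ ->; ws; move=> _ ->; split=> //; rewrite b17; ws; move=> _ ->.
  move: (e %/ kf N) (e %% kf N) ek em ee => i0 j0 ek em eE.
  have sq2 := idx_lt em ek.
  ws; move=> _ ->; ws; move=> _ ->; ws.
  rewrite ?b12 ?b22 ?b3; split=> //; split=> //=.
  + by move=> i /negbTE i3; rewrite eqnE i3 bz ?i3.
  + move=> i j ik jk lt; rewrite !updmE.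
    rewrite (loc_inj i j0 jk ek).
    have -> : (i * kf N + j == e) = (i == i0) && (j == j0) by rewrite eE loc_inj.
    (* The word e is the one read for the pair {i, j} only if i0 >= j0: otherwise
       the larger index maxn i j * k + minn i j is not reached yet. *)
    have cE : (i == j0) && (j == i0) || (i == i0) && (j == j0) -> head 0 (tp b) %% 2 = coin t i j.
      move=> h; rewrite bt -nth0 nth_drop addn0 /coin; congr (nth _ _ _ %% _).
      have ij : j0 <= i0.
        rewrite leqNgt; apply/negP => ij; move: lt; rewrite ltnS leqNgt eE => /negP; apply.
        have -> : maxn i j * kf N + minn i j = j0 * kf N + i0.
          by case/orP: h => /andP [/eqP -> /eqP ->]; move: ij; clear; case: (leqP j0 i0); case: (leqP i0 j0); lia.
        move: ij em; clear; nia.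
      by rewrite eE; case/orP: h => /andP [/eqP -> /eqP ->]; move: ij; clear; case: (leqP j0 i0); case: (leqP i0 j0) => *; congr (_ * _ + _); lia.
    have [h1'|n1] := boolP ((i == j0) && (j == i0)); first by apply: cE; rewrite h1'.
    have [h2'|n2] := boolP ((i == i0) && (j == j0)); first by apply: cE; rewrite h2' orbT.
    apply: bc => //; rewrite ltn_neqAle -ltnS lt andbT.
    have mk : minn i j < kf N by rewrite gtn_min ik.
    apply/negP; rewrite eE (loc_inj _ _ mk em) => /andP [/eqP x1 /eqP x2].
    by move: n1 n2; rewrite -x1 -x2; case: (leqP i j) => _; rewrite !eqxx.
  + by rewrite bt -drop1 drop_drop.
  + by lia.
- move=> b [hb' hz hc ht hk'] _ _ _; apply: hQ => //=.
  + by case: hb' => -[*]; split=> //; split.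
  + move=> i j ik jk; apply: hc => //.
    by apply: idx_lt; [rewrite gtn_max ik|rewrite gtn_min ik].
  + by lia.
Qed.

Lemma binD1 x y : 'C(x.+1 + y.+1, y.+1) = 'C(x + y.+1, y.+1) + 'C(x.+1 + y, y).
Proof. by rewrite addSn binS [x.+1 + y]addSnnS. Qed.

Lemma pascalP a D (Q : ast -> Prop) : Env D a ->
  let X := Xf N D in let M := Mf N D in
  (forall b, Env D b -> (forall i, i != 4 -> ar b i = ar a i) ->
     (forall i j, i <= X -> j <= X ->
        ar b 4 (i * (X + 1) + j) = minn 'C(i + j, j) (M + 1)) ->
     ck b <= ck a + 100 * ((X + 1) * (X + 1) + 2) -> Q b) ->
  wp w S pascal Q a.
Proof.
move=> [[a3 a4 a5 a16 a17 aI] a6 a7 a8 a9 a10] X M hQ.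
have h1 := nnS; have h2 := SU; have h3 := n20; have h4 := Nn.
have hb : n * n * n + 100 * n * n < 2 ^ w by lia.
have hk := kf_small; have X0 := Xf_gt0 N D.
have Xk : X <= kf N by rewrite /X /Xf geq_minr.
have MN : M <= N by apply: leq_div.
pose Y := X + 1; have Y0 : 0 < Y by rewrite /Y addn1.
have YY : Y * Y <= (n + 2) * (n + 2) by rewrite /Y; nia.
have YS : Y * Y < S by nia.
have nS : 2 * n + 10 < S by nia.
rewrite /pascal /=; ws; try by rewrite a10 -/X -/Y; lia.
move=> _ ->; rewrite ?a10 -?/X -?/Y; ws.
pose I e b := [/\ Env D b, (forall i, i != 4 -> ar b i = ar a i),
  (forall e', e' < e -> ar b 4 e' = minn 'C(e' %/ Y + e' %% Y, e' %% Y) (M + 1)) &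
   ck b <= ck a + 30 + 100 * e].
apply: (@wp_for w S w0 19 12 22 pascal_body I 0 (Y * Y)) => //; first by lia.
- by split=> //=; lia.
- move=> e b /andP [_ eYY] [[[b3 b4 b5 b16 b17 bI] b6 b7 b8 b9 b10] bz bc bk] b12 b22 _.
  have ek : e %/ Y < Y by rewrite ltn_divLR.
  have em : e %% Y < Y by rewrite ltn_mod.
  have ee := divn_eq e Y.
  rewrite /pascal_body /= b12 b10 -/X -/Y; ws; move=> _ ->; ws; move=> _ ->; rewrite b16; ws; move=> _ ->; ws.
  move=> _ ->.
  have fin c v : v <= 2 * (M + 1) -> minn v (M + 1) = minn 'C(e %/ Y + e %% Y, e %% Y) (M + 1) ->
    [/\ Env D c, (forall i, i != 4 -> ar c i = ar a i),
  (forall e', e' < e -> ar c 4 e' = minn 'C(e' %/ Y + e' %% Y, e' %% Y) (M + 1)),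
   ck c <= ck b + 50 & [/\ rg c 12 = e, rg c 22 = Y * Y & rg c 24 = v]] ->
    wp w S pascal_tail
     (fun b' => [/\ rg b' 12 = e, rg b' 22 = Y * Y, rg b' 3 = 1
        & I e.+1 (forstep 19 12 e.+1 (e.+1 < Y * Y) b')]) c.
    move=> vM vE [[[c3 c4 c5 c16 c17 cI] c6 c7 c8 c9 c10] cz cc ck1 [c12 c22 c24]].
    rewrite pascal_tailE /=; ws; move=> _ ->; rewrite c9 -/M c24 c3; ws; move=> _ ->.
    apply: (@wp_sel w S w0 24 25 26 24 (M < v)); rewrite //= ?c24; try lia.
    have -> : (if M < v then M + 1 else v) = minn v (M + 1).
      by rewrite /minn; case: ifP => h5; case: ifP => h6 //; lia.
    rewrite c12; ws; rewrite c3 c22; split=> //; split=> //=.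
    + by move=> i /negbTE i3; rewrite eqnE i3 cz ?i3.
    + move=> e'; rewrite ltnS leq_eqVlt updmE => /orP [/eqP ->|lt]; first by rewrite eqxx.
      by rewrite ifF ?cc //; apply/eqP; lia.
    + by lia.
  split=> //.
  + move=> h; ws; apply: (fin _ 1) => /=; first by lia.
      case: (ltnP e Y) h => [lt _|le]; first by rewrite divn_small // add0n modn_small // binn.
      by case: (eqVneq (e %% Y) 0) => [->|//]; rewrite bin0.
    by split=> //=; lia.
  + have [lt|le] := ltnP e Y => //=; have [//|m0 _] := eqVneq (e %% Y) 0.
    have e1 : (e - 1) %/ Y = e %/ Y /\ (e - 1) %% Y = (e %% Y) - 1.
      have -> : e - 1 = e %/ Y * Y + (e %% Y - 1) by lia.
      have e3 : e %% Y - 1 < Y by apply: leq_ltn_trans (leq_subr _ _) em.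
      by rewrite divnMDl // modnMDl (divn_small e3) (modn_small e3) addn0.
    have q0 : 0 < e %/ Y by rewrite divn_gt0.
    have e2 : (e - Y) %/ Y = (e %/ Y) - 1 /\ (e - Y) %% Y = (e %% Y).
      have -> : e - Y = (e %/ Y - 1) * Y + e %% Y.
        rewrite mulnBl mul1n {1}ee addnBAC // leq_pmull //.
      by rewrite divnMDl // modnMDl modn_mod (divn_small em) addn0.
    have e0 : 0 < e := leq_trans Y0 le.
    have eS : e < S := ltn_trans eYY YS.
    have eS1 : e - 1 < S := leq_ltn_trans (leq_subr _ _) eS.
    have eSY : e - Y < S := leq_ltn_trans (leq_subr _ _) eS.
    have S4 : 4 * S + S < 2 ^ w by move: h2 nS; clear; lia.
    rewrite ?b12 ?b3 ?b10 -/X -/Y; ws; move=> _ ->; ws; move=> _ ->; rewrite ?b12 ?b10 -/X -/Y; ws; move=> _ ->; ws; move=> _ ->.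
    rewrite !bc; [|by rewrite ltn_subrL Y0|by rewrite ltn_subrL e0].
    have [-> ->] := e1; have [-> ->] := e2.
    have m1 x : minn x (M + 1) <= M + 1 by apply: geq_minr.
    have hM2 : (M + 1) + (M + 1) < 2 ^ w by move: hb MN h4 h3; clear; nia.
    have hs := leq_ltn_trans (leq_add (m1 'C(e %/ Y + (e %% Y - 1), e %% Y - 1)) (m1 'C(e %/ Y - 1 + e %% Y, e %% Y))) hM2.
    apply: And5 => //.
    move=> v Ev; apply: (fin _ v); rewrite ?Ev /=.
    * by rewrite mul2n -addnn; apply: leq_add; apply: m1.
    * case: (e %/ Y) q0 => // q _; case: (e %% Y) m0 => // r _.
      by rewrite !subn1 /= binD1; move: 'C(q.+1 + r, r) 'C(q + r.+1, r.+1) (M + 1); clear; lia.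
    * by split=> //=; lia.
- move=> b [hb' hz hc hk'] _ _ _; apply: hQ => //.
  + by case: hb' => -[*]; split=> //; split.
  + move=> i j iX jX.
    have iY : i < Y by rewrite /Y; lia.
    have jY : j < Y by rewrite /Y; lia.
    rewrite /= hc; last by exact: idx_lt.
    by rewrite divnMDl // modnMDl (divn_small jY) (modn_small jY) addn0.
  + by rewrite /= -/Y; lia.
Qed.
End Verif.
End Tables.

(** * Program: updating one row *)

Module Updates.
Import WordRam Phrases Prepass Tables.
Set Implicit Arguments.
Unset Strict Implicit.
Unset Printing Implicit Defensive.
Local Open Scope nat_scope.
Opaque ASel AFor.

(** Arrays 5 to 14 are the tables of [Mem] in their order.  Registers: 11 the
    input position, 12 the vertex u being read, 13 the number of trie nodes, 21
    the neighbour v of u, 25 and 26 the end of row v and the start of its current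
    phrase, 27 the length of this phrase, 30 its node. *)
Definition close_code :=
  ARd 36 10 30;; AOp OMul 37 30 4;; AOp OAdd 37 37 36;; AWr 11 37 21;;
  AOp OAdd 36 36 3;; AWr 10 30 36;; AWr 12 30 21;; AWr 13 30 26;; AWr 14 30 27;;
  AWr 7 21 25;; AWr 8 21 16;; AOp OAdd 30 16 16.

Definition push_code :=
  AOp OMul 34 30 4;; AOp OAdd 34 34 12;; ARd 35 9 34;;
  AOp OEq 36 35 16;; AOp OMul 37 36 13;; AOp OAdd 35 35 37;; AWr 9 34 35;; AOp OAdd 13 13 36;;
  AWr 8 21 35;; AOp OMul 28 21 4;; AOp OAdd 28 28 25;; AWr 5 28 12;;
  AOp OAdd 36 25 3;; AWr 6 21 36.

(** The test [ok] is evaluated without branches into register 32. *)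
Definition proc_code :=
  ARd 25 6 21;; ARd 26 7 21;; AOp OSub 27 25 26;; AOp OMul 28 21 4;; AOp OAdd 29 28 26;;
  ARd 29 5 29;; ARd 30 8 21;; AOp OSub 31 12 29;; AOp ODiv 32 29 7;; AOp OEq 32 32 23;;
  AOp OLt 33 31 8;; AOp OMul 32 32 33;; AOp OSub 33 31 27;; AOp OMul 33 33 10;;
  AOp OAdd 33 33 27;; AOp OAdd 33 33 3;; ARd 33 4 33;; AOp OLt 34 9 33;; AOp OEq 34 34 16;;
  AOp OMul 32 32 34;; AIf 32 (AConst 31 0) close_code;; push_code.

(** Treats one neighbour v of u: appends u to row v if v is responsible for u. *)
Definition event_code :=
  ARd 20 0 11;; ARd 21 1 20;; AOp ODiv 22 21 7;; AOp ODiv 23 12 7;; AOp OMul 24 22 6;;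
  AOp OAdd 24 24 23;; ARd 24 3 24;; AOp OLt 25 21 12;; AOp OEq 24 24 25;;
  AIf 24 proc_code (AConst 31 0).

Definition vertex_code :=
  AOp OAdd 11 11 3;; ARd 18 0 11;; AOp OAdd 11 11 3;; AOp OAdd 18 18 11;;
  AFor 38 11 18 event_code.

Definition main_code := AConst 13 1;; AConst 11 2;; AConst 12 0;; AFor 19 12 5 vertex_code.

Definition finish_body :=
  ARd 25 6 21;; ARd 26 7 21;; AOp OSub 27 25 26;; ARd 30 8 21;; close_code.

Definition finish_code := AConst 21 0;; AFor 19 21 5 finish_body.

Lemma close_codeE : close_code = (
  ARd 36 10 30;; AOp OMul 37 30 4;; AOp OAdd 37 37 36;; AWr 11 37 21;;
  AOp OAdd 36 36 3;; AWr 10 30 36;; AWr 12 30 21;; AWr 13 30 26;; AWr 14 30 27;;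
  AWr 7 21 25;; AWr 8 21 16;; AOp OAdd 30 16 16).
Proof. by []. Qed.

Lemma push_codeE : push_code = (
  AOp OMul 34 30 4;; AOp OAdd 34 34 12;; ARd 35 9 34;;
  AOp OEq 36 35 16;; AOp OMul 37 36 13;; AOp OAdd 35 35 37;; AWr 9 34 35;; AOp OAdd 13 13 36;;
  AWr 8 21 35;; AOp OMul 28 21 4;; AOp OAdd 28 28 25;; AWr 5 28 12;;
  AOp OAdd 36 25 3;; AWr 6 21 36).
Proof. by []. Qed.

Lemma proc_codeE : proc_code = (
  ARd 25 6 21;; ARd 26 7 21;; AOp OSub 27 25 26;; AOp OMul 28 21 4;; AOp OAdd 29 28 26;;
  ARd 29 5 29;; ARd 30 8 21;; AOp OSub 31 12 29;; AOp ODiv 32 29 7;; AOp OEq 32 32 23;;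
  AOp OLt 33 31 8;; AOp OMul 32 32 33;; AOp OSub 33 31 27;; AOp OMul 33 33 10;;
  AOp OAdd 33 33 27;; AOp OAdd 33 33 3;; ARd 33 4 33;; AOp OLt 34 9 33;; AOp OEq 34 34 16;;
  AOp OMul 32 32 34;; AIf 32 (AConst 31 0) close_code;; push_code).
Proof. by []. Qed.

Opaque close_code push_code proc_code.

Section Verif.
Variables (w n N S : nat) (inp : nat -> nat).
Hypothesis w0 : 0 < w.
Hypothesis n20 : 20 <= n.
Hypothesis Nn : N <= n.
Hypothesis SU : 20 * S <= 2 ^ w.
Hypothesis nnS : n * n * n + 100 * n * n < S.

Local Notation Base := (Base n N inp).

Definition memof (b : ast) := Mem n N (ar b 5) (ar b 6) (ar b 7) (ar b 8) (ar b 9)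
  (ar b 10) (ar b 11) (ar b 12) (ar b 13) (ar b 14).

(** Besides the registers [rs], only the phrase structure may change. *)
Definition frame (rs : seq nat) (b b' : ast) :=
  [/\ forall x, x \notin rs -> rg b' x = rg b x,
      forall a, (a < 5) || (14 < a) -> ar b' a = ar b a & tp b' = tp b].

Lemma idxS i j : i <= n * n + 10 * n -> j < n -> i * n + j < S.
Proof. by move: nnS n20; clear; nia. Qed.

Lemma idxS2 i j : i < n -> j < n -> i * n + j < S.
Proof. by move=> h1 h2; apply: idxS => //; move: h1; clear; nia. Qed.

Lemma closeP b (Q : ast -> Prop) ph nds Z v :
  Base b -> memof b ph nds Z -> v < N -> rg b 21 = v -> rg b 25 = ar b 6 v -> rg b 26 = ar b 7 v ->
  rg b 27 = ar b 6 v - ar b 7 v -> rg b 30 = ar b 8 v -> (ph v).2 \notin (ph v).1 ->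
  size nds <= n * n + 10 * n ->
  (forall b', frame [:: 30; 36; 37] b b' -> rg b' 30 = 0 ->
     memof b' (updp ph v (pclose (ph v))) nds (rcons Z ((ph v).2, v)) ->
     ck b' <= ck b + 100 -> Q b') ->
  wp w S close_code Q b.
Proof.
move=> [b3 b4 b5 b16 b17 bI] hM vN b21 b25 b26 b27 b30 nin sz hQ.
have h1 := nnS; have h2 := SU; have h3 := n20; have h4 := Nn.
have nS : 2 * n < S by move: h1 h3; clear; nia.
have [c1 hM'] := Mem_close Nn hM vN nin.
have [iv _] := m4 hM vN.
have iS : ar b 8 v < S by move: iv sz h1 h3; clear; nia.
have s1 : ar b 8 v * n + ar b 10 (ar b 8 v) < S.
  by apply: idxS c1; exact: leq_trans (ltnW iv) sz.
rewrite close_codeE /= ?b3 ?b4 ?b16 ?b21 ?b25 ?b26 ?b27 ?b30.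
ws; move=> _ ->; ws; move=> _ ->; ws; move=> _ ->; ws; move=> _ ->; ws; move=> _ ->.
apply: hQ => //=; last by lia.
split=> //=.
- move=> x; rewrite !inE !eqnE => /norP [/negbTE -> /norP [/negbTE -> /negbTE ->]] //.
- by move=> x hx; rewrite !eqnE !ifF //; apply/eqP; lia.
Qed.

Lemma pushP b (Q : ast -> Prop) ph nds Z v u :
  Base b -> memof b ph nds Z -> v < N -> u < N -> rg b 21 = v -> rg b 12 = u ->
  rg b 25 = ar b 6 v -> rg b 30 = ar b 8 v -> rg b 13 = size nds -> size (pflat (ph v)) < n ->
  size nds <= n * n + 10 * n ->
  (forall b' nds', frame [:: 13; 28; 34; 35; 36; 37] b b' -> rg b' 13 = size nds' ->
     memof b' (updp ph v (ppush (ph v) u)) nds' Z -> size nds' <= size nds + 1 ->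
     ck b' <= ck b + 100 -> Q b') ->
  wp w S push_code Q b.
Proof.
move=> [b3 b4 b5 b16 b17 bI] hM vN uN b21 b12 b25 b30 b13 sf sz hQ.
have h1 := nnS; have h2 := SU; have h3 := n20; have h4 := Nn.
have nS : 2 * n < S by move: h1 h3; clear; nia.
have un : u < n by apply: leq_trans uN Nn.
have vn : v < n by apply: leq_trans vN Nn.
have hM' := Mem_push Nn hM vN un sf.
have [iv _] := m4 hM vN.
have rl : ar b 6 v < n by rewrite (m1 hM vN).
have sS : size nds + 1 < S by move: iv sz h1 h3; clear; nia.
have s1 : ar b 8 v * n + u < S by apply: idxS un; exact: leq_trans (ltnW iv) sz.
have s2 : v * n + ar b 6 v < S by apply: idxS2.
have cS : ar b 9 (ar b 8 v * n + u) <= size nds.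
  by rewrite (m6 hM iv un); case: ifP => // h; rewrite index_size.
rewrite push_codeE /= ?b3 ?b4 ?b16 ?b21 ?b25 ?b12 ?b30 ?b13.
set a := ar b 8 v * n + u in hM' s1 cS *.
ws; move=> _ ->; rewrite ?b12; ws; move=> _ ->; ws; move=> _ ->; rewrite ?b16; ws; move=> e ->; ws; try by (case: (_ == _); rewrite ?mul0n ?mul1n; lia).
have s3 : ar b 9 a + (ar b 9 a == 0) * size nds < 2 ^ w.
  by case: eqP => [->|_]; rewrite ?mul0n ?mul1n; lia.
move=> _ ->; ws; try exact: s3.
move=> i iE; ws; move=> _ ->; ws; move=> _ ->; ws; move=> _ ->; ws; move=> _ ->; ws.
have iE' : i = if ar b 9 a == 0 then size nds else ar b 9 a.
  by rewrite iE; case: eqP => [->|_] /=; rewrite ?mul0n ?mul1n ?addn0.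
(* The child is written back even if it exists, which changes nothing. *)
have cE : (if ar b 9 a == 0 then updm (ar b 9) a i else ar b 9) = updm (ar b 9) a i.
  rewrite iE'; case: eqP => // ne; apply/funext => x; rewrite updmE.
  by case: eqP => [->|].
apply: (hQ _ (if ar b 9 a == 0 then rcons nds (rcons (ph v).2 u) else nds)) => //=.
- split=> //=.
  + by move=> x; rewrite !inE !eqnE; do 5 (move=> /norP [/negbTE ->]); move=> /negbTE ->.
  + by move=> x hx; rewrite !eqnE !ifF //; apply/eqP; lia.
- by case: eqP => _; rewrite ?size_rcons /= ?addn1 ?addn0.
- by move: hM'; cbv zeta; rewrite -iE' cE.
- by case: eqP => _; rewrite ?size_rcons; lia.
- by lia.
Qed.

Variables (t : seq nat) (D : nat) (nm : nat -> nat).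
Local Notation k := (kf N).
Local Notation B := (Bf N).
Local Notation X := (Xf N D).
Local Notation M := (Mf N D).

Lemma blk_lt v : v < N -> v %/ B < k.
Proof.
move=> vN; rewrite ltn_divLR /Bf ?addn1 //.
by apply: (leq_trans vN); rewrite mulnC ltnW // ltn_ceil // kf_gt0.
Qed.

(** What the streaming phase only reads. *)
Record Static (b : ast) : Prop := {
  sE : Env n N inp D b;
  sP : pos_ok nm (ar b 1) (ar b 2) N;
  sC : forall i j, i < k -> j < k -> ar b 3 (i * k + j) = coin N t i j;
  sT : forall i j, i <= X -> j <= X -> ar b 4 (i * (X + 1) + j) = minn 'C(i + j, j) (M + 1) }.

Lemma Static_frame rs b b' : Static b -> frame rs b b' ->
  all (fun x => x \notin rs) [:: 3; 4; 5; 16; 17; 6; 7; 8; 9; 10] -> Static b'.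
Proof.
move=> [[[b3 b4 b5 b16 b17 bI] b6 b7 b8 b9 b10] hP hC hT] [f1 f2 f3] /=.
do 10 (case/andP => ?); move=> _.
split; rewrite ?f2 //.
by split; rewrite ?f1 //; split; rewrite ?f1 ?f2.
Qed.

Lemma procP b (Q : ast -> Prop) ph nds Z v u l :
  Static b -> memof b ph nds Z -> v < N -> u < N -> rg b 21 = v -> rg b 12 = u ->
  rg b 13 = size nds -> rg b 23 = u %/ B ->
  ph v = parse B X M l -> sorted ltn l -> all (fun x => x < u) l ->
  size nds <= n * n + 10 * n ->
  (forall b' nds' Z', frame [:: 13; 25; 26; 27; 28; 29; 30; 31; 32; 33; 34; 35; 36; 37] b b' ->
     rg b' 13 = size nds' ->
     memof b' (updp ph v (pstep B X M (ph v) u)) nds' Z' -> size nds' <= size nds + 1 ->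
     ck b' <= ck b + 400 -> Q b') ->
  wp w S proc_code Q b.
Proof.
move=> hS hM vN uN b21 b12 b13 b23 phv sl al sz hQ.
have [[[b3 b4 b5 b16 b17 bI] b6 b7 b8 b9 b10] hP hC hT] := hS.
have h1 := nnS; have h2 := SU; have h3 := n20; have h4 := Nn.
have un : u < n by apply: leq_trans uN Nn.
have vn : v < n by apply: leq_trans vN Nn.
have nS : 2 * n < S by move: h1 h3; clear; nia.
have szl : size l <= u.
  by have := sorted_span sl al; move: (head 0 l); clear; lia.
have fl : pflat (ph v) = l by rewrite phv pflat_parse.
have rlE : ar b 6 v = size l by rewrite (m1 hM vN) fl.
pose cl := (ph v).1; pose cu := (ph v).2.
have lE : l = flatten cl ++ cu by rewrite -fl.
have offE : ar b 7 v = size (flatten cl) by rewrite (m3 hM vN).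
have sE : size l = size (flatten cl) + size cu by rewrite lE size_cat.
have offn : size (flatten cl) < n by move: sE szl un; clear; lia.
pose p := head 0 cu.
have pE : ar b 5 (v * n + size (flatten cl)) = p.
  by rewrite (m2 hM vN offn) fl lE nth_cat ltnn subnn nth0.
have cuL : size cu <= u - p.
  by have := cu_span B X M sl al; rewrite -phv.
have pu : p <= u.
  rewrite /p; case E : cu => [|q cu'] //=; apply/ltnW.
  by move: al; rewrite lE all_cat E /= => /andP [_ /andP []].
have c27 : size l - size (flatten cl) = size cu by move: sE; clear; lia.
have [iv ci] := m4 hM vN.
have nin : cu \notin cl.
  have ul : uniq l by apply: sorted_uniq sl; [exact: ltn_trans|exact: ltnn].
  by have := phrases_uniq B X M ul; rewrite /phrases -phv rcons_uniq => /andP [].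
have XN : X <= n + 1.
  by apply: leq_trans (leq_trans (geq_minr _ _) (kf_small N)) _; rewrite leq_add2r.
have s1 : v * n < S by move: h1 vn; clear; nia.
have s2 : v * n + size (flatten cl) < S by apply: idxS2.
have s3 : (u - p - size cu) * (X + 1) < S /\ (u - p - size cu) * (X + 1) + size cu + 1 < S.
  have : (u - p - size cu) * (X + 1) <= n * (n + 2).
    by apply: leq_mul; [move: un; clear; lia|move: XN; clear; lia].
  by move: cuL un h1 h3; clear; move=> *; split; nia.
have [s3a s3b] := s3.
have hU : 20 * S <= 2 ^ w by [].
rewrite proc_codeE /= ?b3 ?b4 ?b6 ?b7 ?b8 ?b9 ?b10 ?b16 ?b21 ?b12 ?b23.
ws; move=> _ ->; rewrite rlE; ws; move=> _ ->; rewrite offE; ws; try by (move: sE; clear; lia).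
move=> _ ->; rewrite c27; ws; move=> _ ->; ws; move=> _ ->; ws; move=> _ ->; rewrite pE.
have bb (x y : bool) : x * y < 2 ^ w by case: x; case: y => /=; move: hU nS h3; clear; lia.
have bb3 (x y z : bool) : x * y * z < 2 ^ w by case: x; case: y; case: z => /=; move: hU nS h3; clear; lia.
ws; move=> c30 E30; ws; move=> _ ->; ws; move=> _ ->; ws; move=> _ ->; ws; move=> _ ->; ws; try exact: bb.
move=> _ ->; ws; move=> _ ->; ws; move=> _ ->; ws; move=> _ ->; ws; move=> _ ->; ws.
move=> T ET; ws; move=> _ ->; ws; move=> g Eg.
apply: And5; [by []|by []|by []|by rewrite Eg; exact: bb3|].
move=> o Eo.
(* The register just computed is the truth value of the extension test. *)
have oE : o = (ok B X M cu u : nat).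
  rewrite Eo Eg /ok -/p; case: (p %/ B == u %/ B) => //=; rewrite mul1n.
  case: ltnP => //= LX; rewrite mul1n ET.
  have -> : (u - p - size cu) * (X + 1) + size cu + 1 = (u - p - size cu) * (X + 1) + (size cu).+1 by clear; lia.
  rewrite hT; [|by move: LX; clear; lia|by move: LX cuL; clear; lia].
  have -> x : (M < minn x (M + 1)) = (M < x) by clear; lia.
  by rewrite eqb0 -leqNgt.
clear Eo Eg ET.
have fin c ph' Z' : Base c -> memof c ph' nds Z' ->
    frame [:: 13; 25; 26; 27; 28; 29; 30; 31; 32; 33; 34; 35; 36; 37] b c ->
    rg c 21 = v -> rg c 12 = u -> rg c 25 = ar c 6 v -> rg c 30 = ar c 8 v -> rg c 13 = size nds ->
    pflat (ph' v) = l -> ck c <= ck b + 200 ->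
    updp ph' v (ppush (ph' v) u) = updp ph v (pstep B X M (ph v) u) ->
    wp w S push_code Q c.
  move=> hB hc [f1 f2 f3] c21 c12 c25 c30' c13 fl' ckc phE.
  apply: (pushP hB hc vN uN c21 c12 c25 c30' c13) => //.
    by rewrite fl'; apply: leq_ltn_trans un.
  move=> b' nds' [g1 g2 g3] b13' hM' sz' ck'.
  apply: (hQ _ nds' Z') => //.
  - split; last by rewrite g3.
      by move=> x hx; rewrite g1 ?f1 //; move: hx; rewrite !inE !negb_or => hx; repeat (case/andP: hx => ? hx); apply/and5P; split=> //; apply/andP.
    by move=> x hx; rewrite g2 ?f2.
  - by rewrite -phE.
  - by move: ckc ck'; clear; lia.
apply: And3; first by [].
- rewrite oE => ok1; ws.
  apply: (fin _ ph Z) => //=.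
  + by split=> //; fr.
  + by clear; lia.
  + by rewrite /pstep -/cu; case: (ok _ _ _ _ _) ok1.
- rewrite oE => ok1.
  set c := Ast _ _ _ _.
  apply: (@closeP c _ ph nds Z v) => //=.
  + by rewrite rlE offE c27.
  move=> b' [g1 g2 g3] b30' hM' ck'.
  have f x : x \notin [:: 30; 36; 37] -> rg b' x = rg c x by apply: g1.
  apply: (fin _ (updp ph v (pclose (ph v))) (rcons Z ((ph v).2, v))) => //.
  + by split; rewrite ?f ?g2.
  + split; last by rewrite g3.
      move=> x hx; rewrite f; last first.
        by move: hx; rewrite !inE !negb_or => hx; repeat (case/andP: hx => ? hx); apply/and3P.
      by move: x hx; fr.
    by move=> x hx; rewrite g2.
  + by rewrite f.
  + by rewrite f.
  + by rewrite f //= (m1 hM' vN) /updp eqxx pflat_close fl.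
  + rewrite b30'; have [q1 q2] := m4 hM' vN; move: q2; rewrite /updp eqxx /= => q2.
    have [u1 [nds0 e1] _] := m5 hM'.
    move: q1 q2 u1; rewrite e1; case: (ar b' 8 v) => //= j jl jE /andP [nn _].
    by case/negP: nn; rewrite -jE mem_nth.
  + by rewrite f.
  + by rewrite /updp eqxx pflat_close fl.
  + by move: ck'; rewrite /c /=; clear; lia.
  + apply/funext => x; rewrite /updp; case: eqP => // _; rewrite eqxx /pstep -/cu.
    by case: (ok _ _ _ _ _) ok1.
Qed.
End Verif.
End Updates.

(** * Program: reading the edges *)

Module Stream.
Import WordRam Phrases Prepass Tables Updates.
Set Implicit Arguments.
Unset Strict Implicit.
Unset Printing Implicit Defensive.
Local Open Scope nat_scope.
Opaque ASel AFor close_code push_code proc_code.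

Section Verif.
Variables (w n N S : nat) (nm : nat -> nat) (adj : nat -> seq nat) (inp : nat -> nat).
Hypothesis w0 : 0 < w.
Hypothesis n20 : 20 <= n.
Hypothesis Nn : N <= n.
Hypothesis SU : 20 * S <= 2 ^ w.
Hypothesis nnS : n * n * n + 100 * n * n < S.
Local Notation st := (st adj).
Hypothesis inp_dg : forall u, u < N -> inp (st u + 1) = size (adj u).
Hypothesis inp_nb : forall u j, u < N -> j < size (adj u) ->
  inp (st u + 2 + j) = nm (nth 0 (adj u) j).
Hypothesis nm_lt : forall u, u < N -> nm u < n.
Hypothesis adj_lt : forall u v, u < N -> v \in adj u -> v < N.
Hypothesis adj_size : forall u, u < N -> size (adj u) < N.
Hypothesis adj_uniq : forall u, u < N -> uniq (adj u).
Variables (t : seq nat) (D : nat).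

Local Notation k := (kf N).
Local Notation B := (Bf N).
Local Notation X := (Xf N D).
Local Notation M := (Mf N D).
Local Notation Static := (Static n N inp t D nm).
Local Notation memof := (memof n N).

(** The coin of the two blocks tells whether the smaller or the larger of two
    vertices is responsible for the other; hence exactly one of them is. *)
Definition resp v u : bool := coin N t (v %/ B) (u %/ B) == (v < u) :> nat.
Definition row u v := [seq x <- iota 0 u | (v \in adj x) && resp v x].
(** The rows after the first j neighbours of u have been read. *)
Definition rowp u j v := row u v ++ (if (v \in take j (adj u)) && resp v u then [:: u] else [::]).

Lemma row_sorted u v : sorted ltn (row u v).
Proof. by apply: sorted_filter; [exact: ltn_trans|exact: iota_ltn_sorted]. Qed.

Lemma row_lt u v : all (fun x => x < u) (row u v).
Proof. by apply/allP => x; rewrite mem_filter mem_iota => /andP []. Qed.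

Lemma rowp0 u v : rowp u 0 v = row u v.
Proof. by rewrite /rowp take0 /= cats0. Qed.

Lemma rowp_size u v : rowp u (size (adj u)) v = row u.+1 v.
Proof. by rewrite /rowp take_size /row -addn1 iotaD filter_cat add0n /=; case: ifP. Qed.

Definition phs u j v := parse B X M (rowp u j v).

Lemma frame_tick b d : frame [::] b (tick b d).
Proof. by split. Qed.

Lemma frame_forstep x i v tt b : frame [:: x; i] b (forstep x i v tt b).
Proof. by split=> // y; rewrite /= !inE !eqnE => /norP [/negbTE -> /negbTE ->]. Qed.

(** Only the row of the neighbour just read changes, since neighbours are
    distinct. *)
Lemma rowpS u j : j < size (adj u) -> uniq (adj u) -> let v := nth 0 (adj u) j in
  rowp u j v = row u v /\
  forall x, rowp u j.+1 x = if (x == v) && resp v u then rcons (row u v) u else rowp u j x.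
Proof.
move=> js un v.
have vj : v \notin take j (adj u).
  move: un; rewrite -{1}(cat_take_drop j (adj u)) cat_uniq => /and3P [_ /hasPn h _].
  by apply: h; rewrite (drop_nth 0 js) inE eqxx.
have e0 : rowp u j v = row u v by rewrite /rowp (negbTE vj) /= cats0.
split=> // x; rewrite /rowp (take_nth 0 js) mem_rcons inE -/v.
case: (eqVneq x v) => [->|ne] /=; last by [].
by rewrite (negbTE vj) /=; case: (resp v u); rewrite ?cats1.
Qed.

Lemma eventP b (Q : ast -> Prop) nds Z u j :
  u < N -> j < size (adj u) -> Static b -> memof b (phs u j) nds Z ->
  rg b 12 = u -> rg b 11 < S -> inp (rg b 11) = nm (nth 0 (adj u) j) ->
  rg b 13 = size nds -> size nds <= n * n + 10 * n ->
  (forall b' nds' Z', frame (13 :: iota 20 18) b b' -> rg b' 13 = size nds' ->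
     memof b' (phs u j.+1) nds' Z' -> size nds' <= size nds + 1 ->
     ck b' <= ck b + 500 -> Q b') ->
  wp w S event_code Q b.
Proof.
move=> uN js hS hM b12 pS pE b13 sz hQ.
have [[[b3 b4 b5 b16 b17 bI] b6 b7 b8 b9 b10] hP hC hT] := hS.
have h1 := nnS; have h2 := SU; have h3 := n20; have h4 := Nn.
set v := nth 0 (adj u) j in pE.
have vN : v < N by apply: (adj_lt uN); rewrite mem_nth.
have [hPv _] := hP _ vN.
have nS : 2 * n < S by move: h1 h3; clear; nia.
have nv : nm v < S by have := nm_lt vN; move: nS; clear; lia.
have bv := blk_lt vN; have bu := blk_lt uN.
have i1 := idx_lt bv bu.
have kS : k * k < S by have := kf_le4 N; move: h1 h4 h3; rewrite expnS expn1; clear; nia.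
have i2 : v %/ B * k + u %/ B < S by apply: ltn_trans i1 kS.
have i3 : v %/ B * k < S by apply: leq_ltn_trans (leq_addr _ _) i2.
have [r0 r1] := rowpS js (adj_uniq uN); rewrite -/v in r0 r1.
rewrite /event_code /= ?b12 ?b6 ?b7 bI pE.
ws; move=> _ ->; ws; move=> _ ->; rewrite hPv; ws; move=> _ ->; ws; move=> _ ->.
move: i2 i3 (hC _ _ bv bu) => i2 i3 hCv.
ws; move=> _ ->; ws; move=> _ ->; ws; move=> _ ->; ws; move=> _ ->; ws; move=> _ ->.
rewrite hCv -/(resp v u).
apply: And3; [by []|move=> rt|move=> rf].
- have rs : resp v u by case: (resp v u) rt.
  set c := Ast _ _ _ _.
  have fc : frame (iota 20 18) b c.
    by split=> //; fr.
  apply: (@procP w n N S inp w0 n20 Nn SU nnS t D nm c _ (phs u j) nds Z v u (row u v)) => //=.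
  + by rewrite /phs r0.
  + exact: row_sorted.
  + exact: row_lt.
  move=> b' nds' Z' [f1 f2 f3] b13' hM' sz' ck'.
  apply: (hQ _ nds' Z') => //.
  + split; last by rewrite f3.
      move=> x hx; rewrite f1; last first.
        by move: hx; rewrite /= !inE !negb_or => hx; repeat (case/andP: hx => ? hx); repeat (apply/andP; split=> //).
      by case: fc => -> //; move: hx; rewrite inE negb_or => /andP [].
    by move=> x hx; rewrite f2.
  + move: hM'; rewrite /updp (_ : (fun x => _) = phs u j.+1) //.
    apply/funext => x; rewrite /phs r1 rs andbT; case: eqP => // _.
    by rewrite r0 parse_rcons.
  + by move: ck'; rewrite /c /=; clear; lia.
- have rs : resp v u = false by case: (resp v u) rf.
  apply: And3 => //; first by (move: h2 nS h3; clear; lia).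
  apply: (hQ _ nds Z) => //=.
  + by split=> //; fr.
  + by rewrite (_ : phs u j.+1 = phs u j) //; apply/funext => x; rewrite /phs r1 rs andbF.
  + by clear; lia.
  + by clear; lia.
Qed.

(** Every cell of the input adds at most one node to the trie; this bounds the
    number of nodes, hence all addresses, and the clock. *)
Definition Iout c0 u b := exists nds Z, [/\ Static b, memof b (fun v => parse B X M (row u v)) nds Z,
  rg b 13 = size nds, size nds <= st u &
  [/\ rg b 11 = st u, rg b 12 = u & ck b <= c0 + 700 * st u]].

Lemma stS u : u <= N -> st u < n * n + 2 * n + 3.
Proof. exact: (st_S Nn adj_size). Qed.

Lemma vertexP c0 u b : u < N -> Iout c0 u b ->
  wp w S vertex_code (fun b' => [/\ rg b' 12 = u, rg b' 5 = N, rg b' 3 = 1 &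
    Iout c0 u.+1 (forstep 19 12 u.+1 (u.+1 < N) b')]) (tick (tick b 1) 1).
Proof.
move=> uN [nds [Z [hS hM b13 sz [b11 b12 bk]]]].
have h1 := nnS; have h2 := SU; have h3 := n20; have h4 := Nn.
have [[[b3 b4 b5 b16 b17 bI] _ _ _ _ _] _ _ _] := hS.
have s1 : st u.+1 < n * n + 2 * n + 3 := stS uN.
have s1' : st u.+1 = st u + 2 + size (adj u) by [].
have s2 : n * n + 10 * n < S by move: h1 h3; clear; nia.
have s3 : st u + 1 < S by move: s1 s2 h3; rewrite s1'; clear; lia.
have s4 : st u + 1 + 1 + size (adj u) < S by move: s1 s2 h3; rewrite s1'; clear; lia.
rewrite /vertex_code /= ?b3 ?b11.
ws; move=> _ ->; rewrite bI inp_dg //; ws; move=> _ ->; ws; move=> _ ->; ws.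
move=> _ ->; set c := Ast _ _ _ _.
have fc : frame [:: 11; 18] b c.
  by split=> //; fr.
pose I p a := exists nds Z, [/\ Static a, memof a (phs u (p - (st u + 2))) nds Z,
  rg a 13 = size nds, size nds <= p & [/\ rg a 12 = u & ck a + 100 <= c0 + 700 * p]].
apply: (@wp_for w S w0 38 11 18 event_code I (st u + 2) (st u.+1));
  [by []|by []|by []|by []| | | | |exact: b3| | |].
- by rewrite /=; clear; lia.
- by rewrite /=; clear; lia.
- by rewrite s1'; clear; lia.
- by move: s4 h2; rewrite s1'; clear; lia.
- exists nds, Z; split=> /=.
  + by apply: (Static_frame hS (rs := [:: 11; 18; 38])) => //; split=> //; fr.
  + rewrite subnn (_ : phs u 0 = fun v => parse B X M (row u v)) //.
    by apply/funext => x; rewrite /phs rowp0.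
  + by [].
  + by move: sz; clear; lia.
  + by split=> //; move: bk; clear; lia.
- rewrite {1}s1' => p a /andP [p1 p2] [nds1 [Z1 [aS aM a13 asz [a12 ak]]]] a11 a18 a3.
  have [[[_ _ a5 _ _ _] _ _ _ _ _] _ _ _] := aS.
  set j := p - (st u + 2) in aM.
  have js : j < size (adj u) by rewrite /j; move: p1 p2; clear; lia.
  have pj : p = st u + 2 + j by rewrite /j; move: p1; clear; lia.
  have aT : frame [::] a (tick (tick a 1) 1) by split.
  apply: (@eventP _ _ nds1 Z1 u j) => //=.
  + exact: Static_frame aS aT isT.
  + by rewrite a11; move: p2 s4; clear; lia.
  + by rewrite a11 pj inp_nb.
  + by move: asz p2 s1 h3; rewrite s1'; clear; lia.
  move=> b' nds' Z' fb b13' hM' sz' ck'; have [f1 f2 f3] := fb.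
  rewrite !f1 //=; split=> //.
  exists nds', Z'; split=> /=.
  + apply: Static_frame (frame_forstep 38 11 p.+1 (p.+1 < st u.+1) b') isT.
    by apply: Static_frame fb isT; apply: Static_frame aT isT.
  + by rewrite subSn.
  + by [].
  + by move: sz' asz; clear; lia.
  + rewrite f1 //; split=> //; move: ck' ak => /=; clear; lia.
- move=> b' [nds1 [Z1 [aS aM a13 asz [a12 ak]]]] a11 a18 a3.
  have [[[_ _ a5 _ _ _] _ _ _ _ _] _ _ _] := aS.
  split=> //; exists nds1, Z1; split=> //=.
  + apply: Static_frame (frame_forstep 19 12 u.+1 (u.+1 < N) (tick b' 1)) isT.
    by apply: Static_frame (frame_tick b' 1) isT.
  + move: aM; rewrite s1' addKn (_ : phs u _ = fun v => parse B X M (row u.+1 v)) //.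
    by apply/funext => x; rewrite /phs rowp_size.
  + by split=> //; move: ak; rewrite s1'; clear; lia.
Qed.

Lemma mainP b (Q : ast -> Prop) : Static b -> (forall a, 5 <= a <= 14 -> ar b a = fun=> 0) ->
  (forall b' nds Z, Static b' -> memof b' (fun v => parse B X M (row N v)) nds Z ->
     rg b' 13 = size nds -> size nds <= st N ->
     ck b' <= ck b + 100 + 700 * st N -> Q b') ->
  wp w S main_code Q b.
Proof.
move=> hS hz hQ.
have h1 := nnS; have h2 := SU; have h3 := n20; have h4 := Nn.
have nS : 2 * n < S by move: h1 h3; clear; nia.
have [[[b3 b4 b5 b16 b17 bI] _ _ _ _ _] _ _ _] := hS.
rewrite /main_code /=; ws.
apply: (@wp_for w S w0 19 12 5 vertex_code (Iout (ck b + 50)) 0 N);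
  [by []|by []|by []|by []|by []|exact: b5|by []| |exact: b3| | |].
- by move: nS h4 h2; clear; lia.
- exists [:: [::]], [::]; split=> //=; last by split=> //; clear; lia.
  + by apply: (Static_frame hS (rs := [:: 13; 11; 12; 19])) => //; split=> //; fr.
  + by rewrite /memof /= !hz //; exact: Mem0.
- by move=> u c /andP [_ uN] hI _ _ _; exact: vertexP.
- move=> c [nds [Z [cS cM c13 csz [c11 c12 ck1]]]] _ _ _.
  apply: (hQ _ nds Z) => //=.
  + by apply: Static_frame (frame_tick c 1) isT.
  + by move: ck1; clear; lia.
Qed.

(** The phrase structure when the last phrases of the first i rows have been
    closed. *)
Definition phfin i x := if x < i then pclose (parse B X M (row N x)) else parse B X M (row N x).

Lemma finishP b (Q : ast -> Prop) nds Z : Static b ->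
  memof b (fun v => parse B X M (row N v)) nds Z -> rg b 13 = size nds -> size nds <= st N ->
  (forall b' Z', Static b' -> memof b' (fun v => pclose (parse B X M (row N v))) nds Z' ->
     rg b' 13 = size nds -> ck b' <= ck b + 100 + 200 * N -> Q b') ->
  wp w S finish_code Q b.
Proof.
move=> hS hM b13 sz hQ.
have h1 := nnS; have h2 := SU; have h3 := n20; have h4 := Nn.
have nS : 2 * n < S by move: h1 h3; clear; nia.
have sN := stS (leqnn N).
have [[[b3 b4 b5 b16 b17 bI] _ _ _ _ _] _ _ _] := hS.
rewrite /finish_code /=; ws.
pose I v c := exists Z, [/\ Static c, memof c (phfin v) nds Z, rg c 13 = size nds &
  ck c <= ck b + 50 + 200 * v].
apply: (@wp_for w S w0 19 21 5 finish_body I 0 N);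
  [by []|by []|by []|by []|by []|exact: b5|by []| |exact: b3| | |].
- by move: nS h4 h2; clear; lia.
- exists Z; split=> //=; last by clear; lia.
  by apply: (Static_frame hS (rs := [:: 21; 19])) => //; split=> //; fr.
- move=> v c /andP [_ vN] [Z1 [cS cM c13 ckc]] c21 c5 c3.
  have phv : phfin v v = parse B X M (row N v) by rewrite /phfin ltnn.
  have vS : v < S by move: vN h4 nS; clear; lia.
  have [[[_ c4 _ c16 c17 cI] _ _ _ _ _] _ _ _] := cS.
  rewrite /finish_body /= c21; ws; move=> _ ->; ws; move=> _ ->; ws.
    by rewrite (m1 cM vN) (m3 cM vN) /pflat size_cat; apply: leq_addr.
  move=> _ ->; ws; move=> _ ->; set d := Ast _ _ _ _.
  have fd : frame [:: 25; 26; 27; 30] c d.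
    by split=> //; fr.
  apply: (@closeP w n N S inp w0 n20 Nn SU nnS d _ (phfin v) nds Z1 v) => //=.
  + rewrite phv; have ul : uniq (row N v) by apply: filter_uniq; apply: iota_uniq.
    by have := phrases_uniq B X M ul; rewrite /phrases rcons_uniq => /andP [].
  + by move: sz sN h3; clear; nia.
  move=> b' fb' b30 hM' ck'; have [f1 f2 f3] := fb'; have [g1 g2 g3] := fd.
  rewrite !f1 //= ?c21 ?c5 ?c3; split=> //.
  exists (rcons Z1 ((phfin v v).2, v)); split=> /=.
  + apply: Static_frame (frame_forstep 19 21 v.+1 (v.+1 < N) b') isT.
    by apply: Static_frame fb' isT; apply: Static_frame fd isT.
  + move: hM'; rewrite (_ : updp _ _ _ = phfin v.+1) //.
    apply/funext => x; rewrite /updp /phfin ltnn; case: eqP => [->|ne]; first by rewrite ltnS leqnn.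
    by have -> : (x < v.+1) = (x < v) by move: ne; clear; lia.
  + by rewrite f1.
  + by move: ck' ckc; rewrite /d /=; clear; lia.
- move=> c [Z1 [cS cM c13 ckc]] _ _ _.
  apply: (hQ _ Z1) => //=.
  + by apply: Static_frame (frame_tick c 1) isT.
  + case: cM => m1 m2 m3 m4 m5 m6 m6' m7 m8 m9 m10 m11.
    have e v : v < N -> phfin N v = pclose (parse B X M (row N v)) by move=> vN; rewrite /phfin vN.
    split=> //.
    * by move=> v vN; rewrite -e // m1.
    * by move=> v j vN; rewrite -e //; apply: m2.
    * by move=> v vN; rewrite -e // m3.
    * by move=> v vN; rewrite -e //; apply: m4.
    * by move=> i i1 i2; have [q1 q2 q3 q4] := m9 _ i1 i2; rewrite -e.
    * by move=> v vN; rewrite -e // m10.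
  + by move: ckc; clear; lia.
Qed.
End Verif.
End Stream.

(** * Program: writing the bicliques *)

Module Output.
Import WordRam Phrases Prepass Tables Updates Stream.
Set Implicit Arguments.
Unset Strict Implicit.
Unset Printing Implicit Defensive.
Local Open Scope nat_scope.
Opaque ASel AFor.

(** Copies the names of the vertices in a segment of array [a] to the output,
    which is array 15. *)
Definition copy_body a := ARd 24 a 22;; ARd 24 2 24;; AWr 15 39 24;; AOp OAdd 39 39 3.
Definition copy_code a := AFor 38 22 23 (copy_body a).

Lemma copy_codeE a : copy_code a = AFor 38 22 23 (copy_body a).
Proof. by []. Qed.
Opaque copy_code.

Definition emit_code :=
  AOp OAdd 40 40 3;; ARd 21 14 12;; AWr 15 39 21;; AOp OAdd 39 39 3;; AWr 15 39 20;;
  AOp OAdd 39 39 3;; ARd 22 12 12;; ARd 23 13 12;; AOp OMul 22 22 4;; AOp OAdd 22 22 23;;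
  AOp OAdd 23 22 21;; copy_code 5;;
  AOp OMul 22 12 4;; AOp OAdd 23 22 20;; copy_code 11.

Lemma emit_codeE : emit_code = (
  AOp OAdd 40 40 3;; ARd 21 14 12;; AWr 15 39 21;; AOp OAdd 39 39 3;; AWr 15 39 20;;
  AOp OAdd 39 39 3;; ARd 22 12 12;; ARd 23 13 12;; AOp OMul 22 22 4;; AOp OAdd 22 22 23;;
  AOp OAdd 23 22 21;; copy_code 5;;
  AOp OMul 22 12 4;; AOp OAdd 23 22 20;; copy_code 11).
Proof. by []. Qed.
Opaque emit_code.

Definition out_body := ARd 20 10 12;; AIf 20 emit_code (AConst 21 0).

Definition out_code := AConst 39 1;; AConst 40 0;; AConst 12 1;; AFor 19 12 13 out_body;;
  AConst 41 0;; AWr 15 41 40.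

Section Verif.
Variables (w n N S : nat) (nm : nat -> nat) (inp : nat -> nat).
Hypothesis w0 : 0 < w.
Hypothesis n20 : 20 <= n.
Hypothesis Nn : N <= n.
Hypothesis SU : 20 * S <= 2 ^ w.
Hypothesis nnS : 10 * n * n * n + 100 * n * n < S.
Variables (t : seq nat) (D : nat).
Local Notation Static := (Static n N inp t D nm).
Local Notation memof := (memof n N).

Definition oframe (rs : seq nat) (b b' : ast) :=
  (forall x, x \notin rs -> rg b' x = rg b x) /\ (forall a, a != 15 -> ar b' a = ar b a).

(** Cell 0 of the output is excluded: the number of bicliques is written there
    at the very end. *)
Definition outl (b : ast) (L : seq nat) :=
  rg b 39 = size L /\ forall i, 0 < i < size L -> ar b 15 i = nth 0 L i.

Lemma Static_oframe rs b b' : Static b -> oframe rs b b' ->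
  all (fun x => x \notin rs) [:: 3; 4; 5; 16; 17; 6; 7; 8; 9; 10] -> Static b'.
Proof.
move=> [[[b3 b4 b5 b16 b17 bI] b6 b7 b8 b9 b10] hP hC hT] [f1 f2] /=.
do 10 (case/andP => ?); move=> _.
split; rewrite ?f2 //.
by split; rewrite ?f1 //; split; rewrite ?f1 ?f2.
Qed.

Lemma outl_rcons r (A : nat -> nat -> nat) L x T c :
  (forall i, 0 < i < size L -> A 15 i = nth 0 L i) ->
  forall i, 0 < i < size (rcons L x) ->
  ar (Ast r (upd A 15 (updm (A 15) (size L) x)) T c) 15 i = nth 0 (rcons L x) i.
Proof.
move=> h i /andP [i0]; rewrite size_rcons /= updmE nth_rcons ltnS leq_eqVlt => /orP [/eqP ->|il].
  by rewrite eqxx ltnn.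
by rewrite il ifF ?h ?i0 //; apply/eqP => e; rewrite e ltnn in il.
Qed.

Lemma copyP a b (Q : ast -> Prop) lo xs L : a < 15 -> Static b -> rg b 22 = lo ->
  rg b 23 = lo + size xs -> lo + size xs < S -> size L + size xs < S -> 0 < size L ->
  (forall j, j < size xs -> ar b a (lo + j) = nth 0 xs j) -> all (fun x => x < N) xs ->
  outl b L ->
  (forall b', oframe [:: 22; 24; 38; 39] b b' -> outl b' (L ++ map nm xs) ->
     ck b' <= ck b + 40 * (size xs + 1) -> Q b') ->
  wp w S (copy_code a) Q b.
Proof.
move=> a15 hS b22 b23 loS LS L0 hx xN [b39 hL] hQ.
have h1 := nnS; have h2 := SU; have h3 := n20; have h4 := Nn.
have nS : 2 * n < S by move: h1 h3; clear; nia.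
have [[[b3 b4 b5 b16 b17 bI] _ _ _ _ _] _ _ _] := hS.
have aS : a * S + S < 2 ^ w by move: h2 a15 nS; clear; nia.
pose I i c := [/\ oframe [:: 22; 24; 38; 39] b c, outl c (L ++ map nm (take (i - lo) xs)) &
  ck c <= ck b + 2 + 40 * (i - lo)].
rewrite copy_codeE.
apply: (@wp_for w S w0 38 22 23 (copy_body a) I lo (lo + size xs));
  [by []|by []|by []|by []|exact: b22|exact: b23| | |exact: b3| | |].
- by clear; lia.
- by move: loS h2; clear; lia.
- split=> /=; last by clear; lia.
  + by split=> //; fr.
  + by rewrite subnn take0 /= cats0.
- move=> i c /andP [i1 i2] [[f1 f2] [c39 cL] ckc] c22 c23 c3.
  set j := i - lo in cL ckc *.
  have jx : j < size xs by move: i1 i2; rewrite /j; clear; lia.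
  have iE : i = lo + j by move: i1; rewrite /j; clear; lia.
  have iS : i < S by move: i2 loS; clear; lia.
  have sj : size (take j xs) = j by rewrite size_take jx.
  have xj : nth 0 xs j < N by apply: (allP xN); rewrite mem_nth.
  have xS : nth 0 xs j < S by move: xj h4 nS; clear; lia.
  have a15' : a != 15 by apply/eqP => e; rewrite e in a15.
  have [hP _] : pos_ok nm (ar b 1) (ar b 2) N /\ True by case: hS.
  have [_ hN] := hP _ xj.
  have [q1 q2] : size L + size (map nm (take j xs)) < S /\ size L + j + 1 < 2 ^ w.
    by rewrite size_map sj; split; move: LS jx h2; clear; lia.
  have aE : ar b a i = nth 0 xs j by rewrite iE hx.
  have jE : i.+1 - lo = j.+1 by move: i1; rewrite /j; clear; lia.
  rewrite /copy_body /= c22 c39 size_cat f2 //.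
  ws.
  move=> _ ->; rewrite aE f2 //; ws.
  move=> _ ->; rewrite hN ?c39 ?size_cat; ws; rewrite ?c3 ?size_map ?sj //.
  move=> _ ->; split=> //.
  split=> //=.
  + split=> /=.
      move=> x hx'; rewrite !eqnE; move: (hx'); rewrite !inE !negb_or => hx''.
      by repeat (case/andP: hx'' => /negbTE -> hx''); rewrite (negbTE hx'') f1.
    by move=> x hx'; rewrite eqnE (negbTE hx') f2.
  + have e : L ++ [seq nm x | x <- take (i.+1 - lo) xs] = rcons (L ++ [seq nm x | x <- take j xs]) (nm (nth 0 xs j)).
      by rewrite jE (take_nth 0 jx) map_rcons rcons_cat.
    have e' : size L + j = size (L ++ [seq nm x | x <- take j xs]) by rewrite size_cat size_map sj.
    split; rewrite e; first by rewrite /= size_rcons -e' addn1.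
    by rewrite e'; apply: outl_rcons.
  + by move: ckc; rewrite jE; clear; lia.
- move=> c [[f1 f2] [c39 cL] ckc] c22 c23 c3; apply: hQ => /=.
  + by split.
  + by move: c39 cL; rewrite addKn take_size.
  + by move: ckc; rewrite addKn; clear; lia.
Qed.

Variables (row : nat -> seq nat) (ph : nat -> pstate) (nds : seq (seq nat)) (Z : seq (seq nat * nat)).
Hypothesis rowE : forall v, v < N -> pflat (ph v) = row v.
Hypothesis row_lt : forall v, v < N -> all (fun x => x < N) (row v).
Hypothesis row_size : forall v, v < N -> size (row v) < n.
Hypothesis nds_size : size nds <= n * n + 2 * n + 3.

Definition enc i := [:: size (nth [::] nds i), size (members Z (nth [::] nds i)) &
  map nm (nth [::] nds i) ++ map nm (members Z (nth [::] nds i))].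
Definition used i := 0 < size (members Z (nth [::] nds i)).
(** Node 0, the empty phrase, is skipped. *)
Definition encs i := flatten [seq enc j | j <- iota 1 (i - 1) & used j].

Lemma encsS i : 0 < i -> encs i.+1 = encs i ++ (if used i then enc i else [::]).
Proof.
move=> i0; have e1 : i.+1 - 1 = (i - 1) + 1 by move: i0; clear; lia.
have e2 : 1 + (i - 1) = i by move: i0; clear; lia.
rewrite /encs e1 iotaD filter_cat map_cat flatten_cat e2 /=.
by case: ifP => _; rewrite /= ?cats0.
Qed.

(** A phrase that was closed occurs in some row, which bounds its length. *)
Lemma nds_lt b i : memof b ph nds Z -> i < size nds -> used i ->
  all (fun x => x < N) (nth [::] nds i) /\ size (nth [::] nds i) < n.
Proof.
move=> hM iN ui.
have c0 : 0 < ar b 10 i by rewrite (m7 hM) iN.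
have [q1 q2 q3 q4] := m9 hM iN c0; rewrite rowE // q2 in q3 q4.
have rs := row_size q1; split; last by move: q3 rs; clear; lia.
apply/(all_nthP 0) => j js; rewrite -q4 //.
by apply: (allP (row_lt q1)); rewrite mem_nth //; apply: leq_trans q3; rewrite ltn_add2l.
Qed.

Lemma mem_size b i : memof b ph nds Z -> size (members Z (nth [::] nds i)) <= N /\
  all (fun x => x < N) (members Z (nth [::] nds i)).
Proof.
move=> hM; have [h11 h12 _] := m11 hM.
have al : all (fun x => x < N) (members Z (nth [::] nds i)).
  by apply/allP => x /mapP [z]; rewrite mem_filter => /andP [_ /(allP h12) ?] ->.
split=> //.
have sub : {subset members Z (nth [::] nds i) <= iota 0 N}.
  by move=> x /(allP al) xN; rewrite mem_iota.
have := uniq_leq_size _ sub; rewrite size_iota; apply.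
rewrite map_inj_in_uniq ?filter_uniq // => -[a c] [d e].
by rewrite !mem_filter /= => /andP [/eqP -> _] /andP [/eqP -> _] ->.
Qed.

Lemma enc_size b i : memof b ph nds Z -> i < size nds -> used i -> size (enc i) <= 2 * n + 2.
Proof.
move=> hM iN ui; have [_ h1] := nds_lt hM iN ui; have [h2 _] := mem_size i hM.
rewrite /enc /= size_cat (size_map _ (nth _ _ _)) (size_map _ (members _ _)); move: h1 h2 Nn; clear; lia.
Qed.

Lemma encs_size b i : memof b ph nds Z -> 0 < i -> i <= size nds -> size (encs i) <= i * (2 * n + 2).
Proof.
move=> hM; elim: i => // -[_ _ _|i IH _ iN]; first by [].
rewrite encsS // size_cat mulSn addnC; apply: leq_add; last by apply: IH => //; apply: ltnW.
by case: ifP => // ui; apply: enc_size hM _ _.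
Qed.

Variable b : ast.
Hypothesis bS : Static b.
Hypothesis bM : memof b ph nds Z.
Hypothesis b13 : rg b 13 = size nds.

Definition nused i := size [seq j <- iota 1 (i - 1) | used j].

Lemma nusedS i : 0 < i -> nused i.+1 = nused i + used i.
Proof.
move=> i0; have e1 : i.+1 - 1 = (i - 1) + 1 by move: i0; clear; lia.
have e2 : 1 + (i - 1) = i by move: i0; clear; lia.
rewrite /nused e1 iotaD filter_cat size_cat e2 /=.
by case: (used i).
Qed.

Lemma encs_lt i : 0 < i -> i <= size nds -> size (encs i) + 1 < S.
Proof.
move=> i0 iN; have := encs_size bM i0 iN.
have : i * (2 * n + 2) <= (n * n + 2 * n + 3) * (2 * n + 2).
  by rewrite leq_mul2r; apply/orP; right; apply: leq_trans nds_size.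
by move: nnS n20; clear; nia.
Qed.

Definition Rout := [:: 12; 19; 20; 21; 22; 23; 24; 38; 39; 40].

(** The stored occurrence of the phrase gives one side of the biclique, and the
    list of its members the other one. *)
Lemma emitP c (Q : ast -> Prop) i : 0 < i -> i < size nds -> used i ->
  oframe Rout b c -> rg c 12 = i -> rg c 20 = size (members Z (nth [::] nds i)) ->
  outl c (0 :: encs i) -> rg c 40 = nused i ->
  (forall c', oframe Rout b c' -> oframe [:: 20; 21; 22; 23; 24; 38; 39; 40] c c' ->
     outl c' (0 :: encs i.+1) -> rg c' 40 = nused i.+1 ->
     ck c' <= ck c + 200 + 60 * (size (encs i.+1) - size (encs i)) -> Q c') ->
  wp w S emit_code Q c.
Proof.
move=> i0 iN ui [f1 f2] c12 c20 [c39 cL] c40 hQ.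
have h1 := nnS; have h2 := SU; have h3 := n20; have h4 := Nn.
have nS : 2 * n < S by move: h1 h3; clear; nia.
have cS : Static c by apply: Static_oframe bS (conj f1 f2) isT.
have [[[c3 c4 c5 c16 c17 cI] _ _ _ _ _] _ _ _] := cS.
have [al sl] := nds_lt bM iN ui; have [sm am] := mem_size i bM.
have c0 : 0 < ar b 10 i by rewrite (m7 bM) iN.
have [q1 q2 q3 q4] := m9 bM iN c0; rewrite rowE // q2 in q3 q4.
have rs := row_size q1.
have eS : size (encs i.+1) = size (encs i) + (2 + size (nth [::] nds i) + size (members Z (nth [::] nds i))).
  by rewrite encsS // ui size_cat /enc /= size_cat (size_map _ (nth _ _ _)) (size_map _ (members _ _)).
have lt1 : size (encs i.+1) + 1 < S by apply: encs_lt.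
have iS : i * n + n < S.
  have := nds_size; move: iN h1 h3; clear; move=> a1 a2 a3 a4.
  have : i <= n * n + 2 * n + 3 by apply: leq_trans (ltnW a1) a4.
  by move: a2 a3; clear; nia.
have iS1 : i < S by move: iS h3; clear; nia.
have repS : ar b 12 i * n + ar b 13 i + size (nth [::] nds i) < S.
  have a1 : ar b 12 i < n by apply: leq_trans q1 h4.
  have a2 : ar b 13 i + size (nth [::] nds i) < n by apply: leq_ltn_trans q3 rs.
  move: a1 a2 h1; rewrite -addnA; move: (ar b 13 i + _) (ar b 12 i) => x y; clear; nia.
have rep1 : ar b 12 i * n < S by apply: leq_ltn_trans repS; rewrite -addnA leq_addr.
have rep2 : ar b 12 i * n + ar b 13 i < S by apply: leq_ltn_trans repS; rewrite leq_addr.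
set cc := size (nth [::] nds i) in eS repS sl q2 q3 q4 *.
set qq := size (members Z (nth [::] nds i)) in eS sm c20 *.
rewrite eS in lt1.
have nuN : nused i <= n * n + 2 * n + 3.
  rewrite /nused; apply: leq_trans (leq_trans (ltnW iN) nds_size).
  by rewrite size_filter; apply: leq_trans (count_size _ _) _; rewrite size_iota leq_subr.
have nuS : nused i + 1 < 2 ^ w by move: nuN h1 h2 h3; clear; nia.
rewrite emit_codeE /= c3 c4 c12 c20 c39 c40 /= (f2 14 isT) (f2 12 isT) (f2 13 isT).
ws; move=> _ ->; ws; move=> _ ->; rewrite q2 -/cc /=; ws.
have sL1 : (size (encs i)).+1 + 1 = size (rcons (0 :: encs i) cc) by rewrite size_rcons /= addn1.
have sL2 : (size (encs i)).+1 + 1 + 1 = size (rcons (rcons (0 :: encs i) cc) qq) by rewrite !size_rcons /= !addn1.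
move=> _ ->; ws; move=> _ ->; ws; move=> _ ->; ws; move=> _ ->; ws; move=> _ ->; ws; move=> _ ->; ws; move=> _ ->.
set d := Ast _ _ _ _.
have dL : outl d (rcons (rcons (0 :: encs i) cc) qq).
  split; first by rewrite -sL2.
  rewrite /d sL1; apply: outl_rcons => /=.
  by apply: (@outl_rcons (fun _ => 0) (ar c) (0 :: encs i) cc [::] 0).
have fd : oframe [:: 20; 21; 22; 23; 24; 38; 39; 40] c d.
  split; first by fr.
  by move=> x hx; rewrite /d /= !eqnE (negbTE hx).
have dS : Static d by apply: Static_oframe cS fd isT.
apply: (@copyP 5 d _ (ar b 12 i * n + ar b 13 i) (nth [::] nds i) _ isT dS erefl erefl repS _ _ _ al dL).
- by rewrite !size_rcons /= -/cc; move: lt1; clear; lia.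
- by rewrite size_rcons.
- move=> j jc; rewrite -addnA (_ : ar d 5 = ar b 5); last by rewrite (fd.2 5 isT) f2.
  rewrite (m2 bM q1) ?rowE ?q4 //.
  by apply: leq_ltn_trans rs; apply: leq_trans q3; rewrite leq_add2l ltnW.
move=> e [g1 g2] eL ckE.
have [d1 d2] := fd.
have e12 : rg e 12 = i by rewrite g1.
have e4 : rg e 4 = n by rewrite g1.
have e20 : rg e 20 = qq by rewrite g1.
rewrite e12 e4; ws; try by (move: iS h2; clear; lia).
move=> _ ->; rewrite ?e20; ws; try by (move: sm h4 iS h2; clear; lia).
move=> _ ->; set g := Ast _ _ _ _.
have fg : oframe [:: 22; 23] e g by split=> //; fr.
have eS' : Static e by apply: (Static_oframe dS (conj g1 g2)).
have gS : Static g by apply: Static_oframe eS' fg isT.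
have gL : outl g (rcons (rcons (0 :: encs i) cc) qq ++ [seq nm x | x <- nth [::] nds i]).
  by case: eL => eL1 eL2; split.
apply: (@copyP 11 g _ (i * n) (members Z (nth [::] nds i)) _ isT gS erefl erefl _ _ _ _ am gL).
- by move: sm h4 iS; rewrite -/qq; clear; lia.
- by rewrite size_cat !size_rcons (size_map _ (nth _ _ _)) /= -/cc -/qq; move: lt1; clear; lia.
- by rewrite size_cat size_rcons.
- move=> j jq; have -> : ar g 11 = ar b 11 by rewrite /g /= g2 // d2 // f2.
  by rewrite (m8 bM iN) // (m7 bM) iN.
move=> c' [k1 k2] kL ck'.
have fr1 : oframe [:: 20; 21; 22; 23; 24; 38; 39; 40] c c'.
  split; last by move=> x hx; rewrite k2 // /g /= g2 // d2.
  move=> x hx; rewrite k1; last by nin hx.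
  have hx1 : x \notin [:: 22; 23] by nin hx.
  rewrite fg.1 // g1; last by nin hx.
  by rewrite d1.
have k40 : rg c' 40 = nused i.+1 by rewrite nusedS // ui k1 //= g1.
apply: hQ => //.
- split; last by move=> x hx; rewrite fr1.2 // f2.
  move=> x hx; rewrite fr1.1; first by rewrite f1.
  by nin hx.
- move: kL; congr outl; rewrite encsS // ui /enc /= -/cc -/qq.
  by rewrite -!cats1 -?catA /= -?catA /=.
- rewrite eS; move: ck' ckE; rewrite /g /d /=; clear -cc qq; rewrite -/cc -/qq; lia.
Qed.

Lemma outP (Q : ast -> Prop) : 0 < size nds ->
  (forall c, oframe (41 :: Rout) b c ->
     (forall i, i < (size (encs (size nds))).+1 ->
        ar c 15 i = nth 0 (nused (size nds) :: encs (size nds)) i) ->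
     ck c <= ck b + 100 + 300 * size nds + 60 * size (encs (size nds)) -> Q c) ->
  wp w S out_code Q b.
Proof.
move=> nds0 hQ.
have h1 := nnS; have h2 := SU; have h3 := n20; have h4 := Nn.
have nS : 2 * n < S by move: h1 h3; clear; nia.
have [[[b3 b4 b5 b16 b17 bI] _ _ _ _ _] _ _ _] := bS.
have ndsS : size nds < S by have := nds_size; move: h1 h3; clear; nia.
rewrite /out_code /=; ws.
pose I i c := [/\ oframe Rout b c, outl c (0 :: encs i), rg c 40 = nused i &
  ck c <= ck b + 30 + 300 * i + 60 * size (encs i)].
apply: (@wp_for w S w0 19 12 13 out_body I 1 (size nds));
  [by []|by []|by []|by []|by []|exact: b13|exact: nds0| |exact: b3| | |].
- by move: ndsS h2; clear; lia.
- split=> /=; [by split=> //; fr|by split=> // -[]|by []|by clear; lia].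
- move=> i c /andP [i0 iN] [fc cL c40 ckc] c12 c13 c3.
  have [f1 f2] := fc.
  have iS : i < S by apply: ltn_trans iN ndsS.
  rewrite /out_body /= c12 (f2 10 isT) (m7 bM) iN; ws.
  move=> q qE; apply: And3; first by [].
  + rewrite qE => q0.
    have ui : used i by rewrite /used lt0n.
    set d := Ast _ _ _ _.
    have fd : oframe [:: 20] c d by split=> //; fr.
    apply: (@emitP d _ i i0 iN ui).
    * split; last by move=> x hx; rewrite fd.2 // f2.
      by move=> x hx; rewrite fd.1 ?f1 //; nin hx.
    * by [].
    * by [].
    * by case: cL => cL1 cL2; split.
    * by [].
    move=> c' g1 g2 gL g40 ck'.
    rewrite !g2.1 //; split=> //.
    split.
    * split; last by move=> x hx; rewrite /= g1.2.
      by move=> x hx; have := g1.1 x hx; move: x hx; fr.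
    * by case: gL => gL1 gL2; split.
    * by [].
    * have : size (encs i) <= size (encs i.+1) by rewrite encsS // size_cat leq_addr.
      by move: ck' ckc; rewrite /d /=; clear; lia.
  + rewrite qE => q0.
    have ui : used i = false by rewrite /used q0.
    have eE : encs i.+1 = encs i by rewrite encsS // ui cats0.
    apply: And3; [by []|by move: h2 nS; clear; lia|].
    split=> //=.
    split.
    * by split; [move=> x hx; have := f1 x hx; move: x hx; fr|].
    * by rewrite eE; case: cL => cL1 cL2; split.
    * by rewrite nusedS // ui addn0.
    * by rewrite eE /=; move: ckc; clear; lia.
- move=> c [[f1 f2] [c39 cL] c40 ckc] _ _ _.
  rewrite /= c40; ws.
  apply: hQ => /=.
  + split.
      move=> x hx; have e : rg c x = rg b x by apply: f1; nin hx.
      by rewrite -e {e}; move: x hx; fr.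
    by move=> x hx; rewrite /= eqnE (negbTE hx) f2.
  + move=> i; rewrite updmE; case: i => [|i] //= il.
    by rewrite cL.
  + by move: ckc; clear; lia.
Qed.
End Verif.
End Output.

(** * Program: composition of the phases *)

Module Program.
Import WordRam Phrases Prepass Tables Updates Stream Output.
Set Implicit Arguments.
Unset Strict Implicit.
Unset Printing Implicit Defensive.
Local Open Scope nat_scope.

Definition main_prog := prepass;; kloop;; elloop;; params;; coins;; pascal;; main_code;;
  finish_code;; out_code.

(** The prologue computes the distance S = n^4 between arrays, and the epilogue
    the address 15 * S of the output. *)
Definition prog : com :=
  Seq (Read 4 5) (Seq (Op OMul 2 4 4) (Seq (Op OMul 2 2 2)
    (Seq (compile main_prog) (Seq (Const 0 15) (Op OMul 0 0 2))))).

Opaque prepass kloop elloop params coins pascal main_code finish_code out_code.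

Lemma wp_seqE w S c1 c2 Q a : wp w S (c1;; c2) Q a = wp w S c1 (wp w S c2 Q) (tick a 1).
Proof. by []. Qed.

Section Verif.
Variables (w n N : nat) (nm : nat -> nat) (adj : nat -> seq nat) (inp : seq nat) (rnd : seq nat).
Let S := n ^ 4.
Hypothesis w0 : 0 < w.
Hypothesis n20 : 20 <= n.
Hypothesis Nn : N <= n.
Hypothesis nU : n ^ 6 <= 2 ^ w.
Hypothesis inp_size : size inp <= S.
Hypothesis inp_lt : all (fun x => x <= n) inp.
Hypothesis rnd_lt : all (fun x => x < 2 ^ w) rnd.
Local Notation st := (st adj).
Local Notation inpf := (nth 0 inp).
Hypothesis inp0 : inpf 0 = n.
Hypothesis inp1 : inpf 1 = N.
Hypothesis inp_nm : forall u, u < N -> inpf (st u) = nm u.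
Hypothesis inp_dg : forall u, u < N -> inpf (st u + 1) = size (adj u).
Hypothesis inp_nb : forall u j, u < N -> j < size (adj u) ->
  inpf (st u + 2 + j) = nm (nth 0 (adj u) j).
Hypothesis nm_lt : forall u, u < N -> nm u < n.
Hypothesis nm_inj : forall u v, u < N -> v < N -> nm u = nm v -> u = v.
Hypothesis adj_lt : forall u v, u < N -> v \in adj u -> v < N.
Hypothesis adj_size : forall u, u < N -> size (adj u) < N.
Hypothesis adj_uniq : forall u, u < N -> uniq (adj u).

Hypothesis adj_irr : forall u, u \notin adj u.

Let D := maxmin N adj N.
Let fphrases v := phrases (Bf N) (Xf N D) (Mf N D) (Stream.row N adj rnd N v).

(** What the combinatorial part needs to know about the trie and the list of
    closed phrases at the end. *)
Definition final (nds : seq (seq nat)) (Z : seq (seq nat * nat)) :=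
  [/\ uniq nds /\ exists nds', nds = [::] :: nds',
      forall v, v < N -> [seq z.1 | z <- Z & z.2 == v] = fphrases v &
      [/\ uniq Z, all (fun z => z.2 < N) Z & forall z, z \in Z -> z.1 \in nds]].

(** The phases are composed, and their clocks are added up.  The tables of coins
    and binomials have O(k^2) = O(N) cells, so everything is linear in N and in
    the lengths of input and output. *)
Lemma prog_run : exists T nds Z, [/\ final nds Z,
  T <= 2500 * N + 1000 * st N + 3000 + 60 * size (encs nm nds Z (size nds)) &
  forall T', T <= T' -> let s := run w prog inp rnd T' in
    todo s = [::] /\
    forall i, i < (size (encs nm nds Z (size nds))).+1 ->
      memory s (regs s 0 + i) = nth 0 (nused nds Z (size nds) :: encs nm nds Z (size nds)) i].
Proof.
have S4 : S = n * n * n * n by rewrite /S !expnS expn0; clear; lia.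
have nnS2 : 10 * n * n * n + 100 * n * n < S by rewrite S4; move: n20; clear; nia.
have nnS : n * n * n + 100 * n * n < S by move: nnS2; clear; nia.
have SU : 20 * S <= 2 ^ w.
  apply: leq_trans nU; rewrite (expnD n 4 2) -/S mulnC leq_mul2l; apply/orP; right.
  by rewrite expnS expn1; move: n20; clear; nia.
have DN : D <= N by exact: (maxmin_le adj_size (leqnn N)).
pose a := Ast (upd (fun=> 0) 4 n) (fun i => if eqn i 0 then inpf else fun=> 0) rnd 0.
have nS : n < S by move: nnS n20; clear; nia.
pose rep0 := rep w S (fun x => if x == 2 then S else if x == 4 then n else 0) inpf rnd a.
have R : rep0.
  split=> //.
  - move=> x x2 /=; rewrite eqnE; have -> : (x == 2) = false by apply/eqP; move: x2; clear; lia.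
    by split=> //; case: (x == 4); move: nS SU; clear; lia.
  - move=> i j jS /=; case: i => [|i] /=.
      rewrite mul0n add0n; split=> //.
      have [js|js] := ltnP j (size inp); last by rewrite nth_default //; move: nS SU; clear; lia.
      by have /= := allP inp_lt _ (mem_nth 0 js); move: nS SU; clear; lia.
    split; last by move: nS SU; clear; lia.
    by rewrite nth_default //; apply: leq_trans inp_size _; rewrite mulSn -addnA leq_addr.
pose Q (b : ast) := exists nds Z, [/\ final nds Z, size (encs nm nds Z (size nds)) < S,
  ck b <= 2500 * N + 1000 * st N + 2900 + 60 * size (encs nm nds Z (size nds)) &
  forall i, i < (size (encs nm nds Z (size nds))).+1 ->
    ar b 15 i = nth 0 (nused nds Z (size nds) :: encs nm nds Z (size nds)) i].
have W : wp w S main_prog Q a.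
  rewrite /main_prog wp_seqE; apply: (prepassP (adj := adj) (nm := nm) w0 n20 Nn SU nnS inp0 inp1 inp_nm inp_dg nm_lt nm_inj adj_size (t := rnd)) => //.
    by move=> i i0 /=; case: i i0.
  move=> b1 [B1 [_ _] b14 P1 [z1 t1 k1]]; rewrite -/D in b14.
  rewrite wp_seqE; apply: (kloopP w0 n20 Nn SU nnS (inp := inpf)); first by case: B1; split.
  move=> b2 B2 a2 t2 k2 r6 r14.
  rewrite wp_seqE; apply: (elloopP w0 n20 Nn SU nnS (inp := inpf)); first by case: B2; split.
  move=> b3 B3 a3 t3 k3 r15 r6' r14'.
  rewrite wp_seqE; apply: (paramsP w0 n20 Nn SU nnS (inp := inpf) (D := D)) => //.
  - by case: B3; split.
  - by rewrite /= r14' /= r14.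
  - by rewrite /= r6' /= r6.
  move=> b4 E4 a4 t4 k4.
  rewrite wp_seqE; apply: (coinsP w0 n20 Nn SU nnS (inp := inpf) (D := D) (t := rnd)) => //.
  - by case: E4 => -[*]; split=> //; split.
  - by rewrite /= t4 /= t3 /= t2.
  move=> b5 E5 a5 c5 k5.
  rewrite wp_seqE; apply: (pascalP w0 n20 Nn SU nnS (inp := inpf) (D := D)).
    by case: E5 => -[*]; split=> //; split.
  move=> b6 E6 a6 c6 k6.
  have arE x : x != 3 -> x != 4 -> ar b6 x = ar b1 x.
    by move=> h3 h4; rewrite a6 //= a5 //= a4 /= a3 /= a2.
  have S6 : Static n N inpf rnd D nm b6.
    split=> //.
    - by rewrite !arE.
    - by move=> i j ik jk; rewrite a6 //= c5.
  rewrite wp_seqE; apply: (mainP w0 n20 Nn SU nnS inp_dg inp_nb nm_lt adj_lt adj_size adj_uniq (t := rnd) (D := D)).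
  - by apply: Static_frame S6 (frame_tick b6 1) isT.
  - move=> x /andP [x5 x14] /=; rewrite arE ?z1 //.
    + by apply: leq_trans x5.
    + by apply/eqP; move: x5; clear; lia.
    + by apply/eqP; move: x5; clear; lia.
  move=> b7 nds Z7 S7 M7 r13 n7 k7.
  rewrite wp_seqE; apply: (finishP w0 n20 Nn SU nnS adj_size (t := rnd) (D := D) (nds := nds) (Z := Z7) (nm := nm) (inp := inpf)) => //.
    by apply: Static_frame S7 (frame_tick b7 1) isT.
  move=> b8 Z S8 M8 r13' k8.
  have sN := st_S Nn adj_size (leqnn N).
  have [u5 [nds' e5] _] := m5 M8.
  have nds0 : 0 < size nds by rewrite e5.
  have rowlt v : v < N -> all (fun x => x < N) (Stream.row N adj rnd N v) by move=> _; apply: Stream.row_lt.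
  have rowsz v : v < N -> size (Stream.row N adj rnd N v) < n.
    move=> vN; apply: leq_trans Nn.
    have : {subset v :: Stream.row N adj rnd N v <= iota 0 N}.
      move=> x; rewrite inE => /orP [/eqP ->|]; first by rewrite mem_iota.
      by rewrite mem_filter => /andP [].
    move/uniq_leq_size; rewrite size_iota; apply; rewrite /= filter_uniq ?iota_uniq // andbT.
    by rewrite mem_filter negb_and negb_and adj_irr.
  have nsz : size nds <= n * n + 2 * n + 3 by apply: leq_trans n7 _; move: sN; clear; lia.
  have rE v : v < N -> pflat (pclose (parse (Bf N) (Xf N D) (Mf N D) (Stream.row N adj rnd N v))) = Stream.row N adj rnd N v.
    by move=> _; rewrite pflat_close pflat_parse.
  apply: (outP w0 n20 Nn SU nnS2 (t := rnd) (D := D) (nm := nm) (inp := inpf)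
    (row := Stream.row N adj rnd N) rE rowlt rowsz nsz (b := b8)
    S8 M8 r13').
    exact: nds0.
  move=> b9 f9 o9 k9; exists nds, Z; split.
  - split; first by split=> //; exists nds'.
    + by move=> v vN; rewrite (m10 M8 vN).
    + exact: m11 M8.
  - by have := encs_lt nm n20 Nn nnS2 (row := Stream.row N adj rnd N) rE rowlt rowsz nsz M8 nds0 (leqnn _); rewrite addn1; apply: ltnW.
  - have K4 := kf_le4 N; have K0 := kf_gt0 N.
    have XK : Xf N D <= kf N by rewrite /Xf geq_minr.
    have e1 : (Xf N D + 1) * (Xf N D + 1) <= 16 * N + 4 by move: K4 XK K0; rewrite expnS expn1; clear; nia.
    have e2 : kf N * kf N <= 4 * N + 1 by rewrite expnS expn1 in K4.
    move: k1 k2 k3 k4 k5 k6 k7 k8 k9 e1 e2 n7 => /=.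
    move: (size (encs nm nds Z (size nds))) => se.
    clear; lia.
  - by move=> i il; rewrite o9.
have [T [r' [m' [t' [a' [s1 ka Ra [nds [Z [hF hS hT hO]]]]]]]]] := wp_sound w0 W R.
have [g1 g2 g3 _] := Ra.
exists (7 + T + 3), nds, Z; split=> //.
  by move: hT; rewrite ka /=; clear; lia.
move=> T' hT'; cbv zeta.
pose tl := Seq (Const 0 15) (Op OMul 0 0 2).
have first7 : iter 7 (step w) (Config [:: prog] (fun=> 0) inpf rnd) =
    Config [:: compile main_prog; tl] (fun x => if x == 2 then S else if x == 4 then n else 0) inpf rnd.
  have n4 : n * n < 2 ^ w by move: nnS SU n20; clear; nia.
  have n5 : n * n * (n * n) = S by rewrite S4; clear; lia.
  rewrite /= inp0 (modn_small n4) n5 modn_small; last by move: nS SU; clear; lia.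
  congr Config; apply/funext => x /=.
  by case: (x == 2) => //; case: (x == 4).
have S15 : 15 * S < 2 ^ w by move: nS SU; clear; lia.
have last3 : iter 3 (step w) (Config [:: tl] r' m' t') =
    Config [::] [eta [eta r' with 0 |-> 15] with 0 |-> 15 * S] m' t'.
  rewrite /= g2 (modn_small (_ : 15 < 2 ^ w)); last by move: nS n20 SU; clear; lia.
  by rewrite modn_small.
have stay d r m u : iter d (step w) (Config [::] r m u) = Config [::] r m u by elim: d => //= d ->.
have -> : run w prog inp rnd T' =
  Config [::] [eta [eta r' with 0 |-> 15] with 0 |-> 15 * S] m' t'.
  rewrite /run -(subnKC hT') addnC iterD [7 + T + 3]addnC iterD [7 + T]addnC iterD first7 s1 last3.
  exact: stay.
split=> //= i il.
have iS : i < S.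
  apply: leq_trans il _; exact: hS.
by have [-> _] := g3 15 i iS; rewrite hO.
Qed.
End Verif.
End Program.

(** * The number of phrases of a row *)

Module PhraseCount.
Import Phrases.
Set Implicit Arguments.
Unset Strict Implicit.
Unset Printing Implicit Defensive.
Local Open Scope nat_scope.

(** One term of the Vandermonde convolution. *)
Lemma leq_bin_mul a b c d : 'C(a + b, b) * 'C(c + d, d) <= 'C(a + c + (b + d), b + d).
Proof.
rewrite [a + c + _]addnACA -(binomial.Vandermonde (a + b) (c + d) (b + d)).
have lt : b < (b + d).+1 by rewrite ltnS leq_addr.
by rewrite (bigD1 (Ordinal lt)) //= addKn leq_addr.
Qed.

Lemma leq_bin_mono a b c d : a <= c -> b <= d -> 'C(a + b, b) <= 'C(c + d, d).
Proof.
move=> ac bd; apply: (@leq_trans 'C(c + b, b)); first by rewrite leq_bin2l // leq_add2r.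
have -> : 'C(c + b, b) = 'C(c + b, c) by rewrite -bin_sub ?leq_addl // addnK.
have -> : 'C(c + d, d) = 'C(c + d, c) by rewrite -bin_sub ?leq_addl // addnK.
by rewrite leq_bin2l // leq_add2l.
Qed.

Lemma bin_step a c : 'C(a + c.+1, c.+1) <= (a + c.+1) * 'C(a + c, c).
Proof.
have := mul_bin_diag (a + c).+1 c; rewrite addnS /= => ->.
by rewrite mulSn leq_addr.
Qed.

(** Let E be membership in the row of a vertex whose own block is [bv], and let
    [elig] single out the other blocks in which the vertex is responsible; outside
    its own block, responsibility is constant on blocks. *)
Section Cuts.
Variables (B X M bv : nat) (E elig : pred nat).
Hypothesis B0 : 0 < B.
Hypothesis X0 : 0 < X.
Hypothesis M0 : 0 < M.
Hypothesis elig_blk : forall p y, p %/ B = y %/ B -> elig p = elig y.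
Hypothesis elig_E : forall p, E p -> p %/ B != bv -> elig p.

Definition zc y := count (fun i => elig i && ~~ E i) (iota 0 y).
Definition oc y := count (fun i => elig i && E i) (iota 0 y).
Definition own y := count (fun i => (i %/ B == bv) && E i) (iota 0 y).
Definition ones y := seq.filter E (iota 0 y).

Lemma iota_cut p y : p <= y -> iota 0 y = iota 0 p ++ iota p (y - p).
Proof. by move=> py; rewrite -{1}(subnKC py) iotaD add0n. Qed.

Lemma count_cut (a : pred nat) p y : p <= y ->
  count a (iota 0 y) = count a (iota 0 p) + count a (iota p (y - p)).
Proof. by move=> py; rewrite (iota_cut py) count_cat. Qed.

Lemma count_mono (a : pred nat) p y : p <= y -> count a (iota 0 p) <= count a (iota 0 y).
Proof. by move=> py; rewrite (count_cut a py) leq_addr. Qed.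

(** The q phrases closed before position p, classified by the reason of the cut:
    f because of the pattern bound M, g because of the span, h at the end of a
    block, o inside the block [bv]; one more for the empty phrase at the
    beginning. *)
Definition stats (p f g h o q : nat) :=
  [/\ q <= f + g + h + o + 1, g * X <= p, h <= p %/ B, o <= own p &
   [/\ M ^ f <= X ^ f * 'C(zc p + oc p, oc p), f <= zc p & f <= oc p]].

Definition inv y := let st := parse B X M (ones y) in
  ones y = [::] \/
  exists p f g h j, [/\ p < y, E p, st.2 = seq.filter E (iota p (y - p)) & stats p f g h j (size st.1)].

Lemma head_filter p y : p < y -> E p -> head 0 (seq.filter E (iota p (y - p))) = p.
Proof. by move=> py Ep; rewrite -(subnSK py) /= Ep. Qed.

Lemma onesS y : ones y.+1 = if E y then rcons (ones y) y else ones y.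
Proof. by rewrite /ones -addn1 iotaD filter_cat add0n /=; case: ifP; rewrite ?cats1 ?cats0. Qed.

Lemma filter_iotaS p y : p <= y -> seq.filter E (iota p (y.+1 - p)) =
  if E y then rcons (seq.filter E (iota p (y - p))) y else seq.filter E (iota p (y - p)).
Proof.
move=> py; rewrite subSn // -addn1 iotaD filter_cat /= subnKC //.
by case: ifP; rewrite ?cats1 ?cats0.
Qed.

Lemma bin_pos z o : 0 < 'C(z + o, o).
Proof. by rewrite bin_gt0 leq_addl. Qed.

(** Induction on the position; the current phrase starts at p.  Suppose that it is
    closed because of M, with c elements and a skipped positions.  Then
    M < 'C(a + c.+1, c.+1) <= X * 'C(a + c, c), and 'C(a + c, c) is absorbed by the
    binomial coefficient of all eligible positions so far.  The phrase lies in an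
    eligible block, so that every position from p on is counted in zc or oc. *)
Lemma invP y : inv y.
Proof.
elim: y => [|y IH]; first by left.
rewrite /inv onesS; case: ifP => Ey; last first.
  case: IH => [->|[p [f [g [h [j [py Ep e2 hs]]]]]]]; [by left|right].
  exists p, f, g, h, j; split=> //; first exact: ltnW.
  by rewrite filter_iotaS ?Ey // ltnW.
right; rewrite parse_rcons.
case: IH => [e0|[p [f [g [h [j [py Ep e2 hs]]]]]]].
  rewrite e0; exists y, 0, 0, 0, 0; split=> //.
    by rewrite /pstep /ppush /pclose /= subSnn /= Ey; case: ifP.
  split=> //; last by split=> //; rewrite !expn0 mul1n bin_pos.
  by rewrite /pstep /ppush /pclose /=; case: ifP.
set st := parse B X M (ones y) in e2 hs *.
have [hok|hok] := boolP (ok B X M st.2 y).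
  exists p, f, g, h, j; rewrite /pstep hok /ppush /=; split=> //; first exact: ltnW.
  by rewrite filter_iotaS ?Ey ?e2 // ltnW.
have sz : size (pstep B X M st y).1 = (size st.1).+1 by rewrite /pstep (negbTE hok) /ppush /pclose /= size_rcons.
have cE : (pstep B X M st y).2 = seq.filter E (iota y (y.+1 - y)).
  by rewrite /pstep (negbTE hok) /ppush /pclose /= subSnn /= Ey.
have [q1 q2 q3 q4 [q5 q6 q7]] := hs.
have pyw := ltnW py.
have zm : zc p <= zc y := count_mono _ pyw.
have om : oc p <= oc y := count_mono _ pyw.
have wm : own p <= own y := count_mono _ pyw.
have q5' : M ^ f <= X ^ f * 'C(zc y + oc y, oc y).
  by apply: leq_trans q5 _; rewrite leq_mul2l leq_bin_mono ?orbT.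
have hm : p %/ B <= y %/ B by apply: leq_div2r.
exists y, (if [&& p %/ B == y %/ B, y - p < X & p %/ B != bv] then f.+1 else f),
  (if (p %/ B == y %/ B) && (X <= y - p) then g.+1 else g),
  (if p %/ B != y %/ B then h.+1 else h),
  (if [&& p %/ B == y %/ B, y - p < X & p %/ B == bv] then j.+1 else j).
split=> //; rewrite sz /stats.
have [blk|nblk] /= := eqVneq (p %/ B) (y %/ B); last first.
  split; first by move: q1; clear; lia.
  - by apply: leq_trans q2 pyw.
  - by apply: leq_ltn_trans q3 _; rewrite ltn_neqAle nblk.
  - exact: leq_trans q4 wm.
  - by split; [|exact: leq_trans q6 zm|exact: leq_trans q7 om].
have [lt|ge] := ltnP (y - p) X; rewrite /= ?andbF; last first.
  split; first by move: q1; clear; lia.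
  - by rewrite mulSn; move: q2 ge py; clear; lia.
  - exact: leq_trans q3 hm.
  - exact: leq_trans q4 wm.
  - by split; [|exact: leq_trans q6 zm|exact: leq_trans q7 om].
have hM : M < 'C(y - p - size st.2 + (size st.2).+1, (size st.2).+1).
  by move: hok; rewrite /ok e2 head_filter // -e2 blk eqxx lt /= -ltnNge.
have [ow|now] := eqVneq (p %/ B) bv; rewrite /=.
  split; first by move: q1; clear; lia.
  - by apply: leq_trans q2 pyw.
  - exact: leq_trans q3 hm.
  - apply: leq_ltn_trans q4 _; rewrite /own (count_cut _ pyw) -(subnSK py) /= ow eqxx Ep /=.
    by clear; lia.
  - by split; [|exact: leq_trans q6 zm|exact: leq_trans q7 om].
have ep : elig p by apply: elig_E.
have eall i : i \in iota p (y - p) -> elig i.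
  rewrite mem_iota subnKC // => /andP [pi iy]; rewrite -(@elig_blk p i) //.
  by apply/eqP; rewrite eqn_leq leq_div2r //= blk leq_div2r // ltnW.
have ocE : oc y = oc p + size st.2.
  rewrite /oc (count_cut _ pyw) e2 size_filter; congr (_ + _).
  by apply: eq_in_count => i /eall ->.
have zcE : zc y = zc p + (y - p - size st.2).
  rewrite /zc (count_cut _ pyw) e2 size_filter; congr (_ + _).
  have -> : y - p - count E (iota p (y - p)) = count (predC E) (iota p (y - p)).
    by have := count_predC E (iota p (y - p)); rewrite size_iota => {1}<-; rewrite addKn.
  by apply: eq_in_count => i /eall ->.
set c := size st.2 in ocE zcE hM; set a := y - p - c in zcE hM.
have c0 : 0 < c by rewrite /c e2 -(subnSK py) /= Ep.
(* If no position were skipped, the binomial coefficient would be 1. *)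
have a0 : 0 < a.
  by case: (a) hM => // ; rewrite add0n binn ltnS leqNgt M0.
have cle : c <= y - p by rewrite /c e2 size_filter (leq_trans (count_size _ _)) ?size_iota.
have acX : a + c.+1 <= X by move: lt cle; rewrite /a; clear; lia.
split; first by move: q1; clear; lia.
- by apply: leq_trans q2 pyw.
- exact: leq_trans q3 hm.
- exact: leq_trans q4 wm.
split; last 2 first.
- by rewrite zcE; move: q6 a0; clear; lia.
- by rewrite ocE; move: q7 c0; clear; lia.
rewrite !expnS; apply: (@leq_trans ((X * 'C(a + c, c)) * (X ^ f * 'C(zc p + oc p, oc p)))).
  apply: leq_mul q5; apply: leq_trans (ltnW hM) _.
  by apply: leq_trans (bin_step _ _) _; rewrite leq_mul2r acX orbT.
rewrite -mulnA -mulnA leq_mul2l; apply/orP; right.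
rewrite mulnCA leq_mul2l; apply/orP; right.
by rewrite mulnC zcE ocE leq_bin_mul.
Qed.

(** The block [bv] has B vertices. *)
Lemma own_le y : own y <= B.
Proof.
rewrite /own -size_filter.
have sub : {subset [seq i <- iota 0 y | (i %/ B == bv) && E i] <= iota (bv * B) B}.
  move=> i; rewrite mem_filter => /andP [/andP [/eqP e _] _].
  by rewrite mem_iota -e leq_divM addnC -mulSn ltn_ceil.
by have := uniq_leq_size (filter_uniq _ (iota_uniq _ _)) sub; rewrite size_iota.
Qed.

Lemma phrases_count N : exists f, [/\ size (phrases B X M (ones N)) <= f + N %/ X + N %/ B + B + 2,
  M ^ f <= X ^ f * 'C(zc N + oc N, oc N), f <= zc N & f <= oc N].
Proof.
have := invP N; rewrite /inv /phrases size_rcons.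
case=> [->|[p [f [g [h [j [pN Ep _ [q1 q2 q3 q4 [q5 q6 q7]]]]]]]]].
  by exists 0; split; rewrite ?expn0 ?mul1n ?bin_pos //= addnC.
have pw := ltnW pN.
have zm : zc p <= zc N := count_mono _ pw.
have om : oc p <= oc N := count_mono _ pw.
exists f; split.
- have g1 : g <= N %/ X by rewrite leq_divRL //; apply: leq_trans q2 pw.
  have h1 : h <= N %/ B by apply: leq_trans q3 _; apply: leq_div2r.
  by have := own_le p; move: q1 g1 h1 q4; clear; lia.
- by apply: leq_trans q5 _; rewrite leq_mul2l leq_bin_mono ?orbT.
- exact: leq_trans q6 zm.
- exact: leq_trans q7 om.
Qed.
End Cuts.
End PhraseCount.

(** * The number of phrases through a vertex *)

Module PatternCount.
Import Phrases.
Set Implicit Arguments.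
Unset Strict Implicit.
Unset Printing Implicit Defensive.
Local Open Scope nat_scope.

Section Good.
Variables (B X M : nat).
Hypothesis X0 : 0 < X.
Hypothesis M0 : 0 < M.

Definition good (S : seq nat) := [&& S != [::], sorted ltn S, last 0 S - head 0 S < X &
  'C((last 0 S - head 0 S).+1, size S) <= M].

Lemma good1 u : good [:: u].
Proof. by rewrite /good /= subnn X0. Qed.

Lemma sorted_rcons_lt (l : seq nat) u : sorted ltn (rcons l u) ->
  sorted ltn l /\ all (fun x => x < u) l.
Proof.
rewrite -cats1 !(sorted_pairwise ltn_trans) pairwise_cat /= => /and3P [h -> _].
by split=> //; move: h; rewrite allrel1r.
Qed.

(** Every extension passed the test [ok], and a singleton satisfies the pattern
    bound because M > 0. *)
Lemma phrases_good l S : sorted ltn l -> S \in phrases B X M l -> S != [::] -> good S.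
Proof.
elim/last_ind: l S => [|l u IH] S sl; first by rewrite inE => /eqP -> /eqP.
have [s1 s2] := sorted_rcons_lt sl.
have IH' S' : S' \in (parse B X M l).1 -> S' != [::] -> good S'.
  by move=> h; apply: IH => //; rewrite mem_rcons inE h orbT.
have IH2 : (parse B X M l).2 != [::] -> good (parse B X M l).2.
  by move=> h; apply: IH => //; rewrite mem_rcons inE eqxx.
rewrite /phrases parse_rcons /pstep mem_rcons inE; case: ifP => hok; rewrite /ppush /pclose /=.
  case/orP => [/eqP ->|/IH' //] _.
  have cs := cu_span B X M s1 s2.
  move: hok cs IH2; set cu := (parse B X M l).2 => hok cs IH2.
  case E : cu hok cs IH2 => [|p cu'] hok cs IH2; first exact: good1.
  have /and4P [_ so _ _] := IH2 isT.
  move: hok cs so; rewrite /ok /= => /and3P [_ h2 h3] cs so.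
  rewrite /good /= last_rcons size_rcons rcons_path so /=.
  have lu : last p cu' < u.
    apply: (allP s2); have [l' e] := cu_suffix B X M l; rewrite e -/cu E mem_cat mem_last orbT //.
  by rewrite lu h2 /=; move: h3; have -> : u - p - (size cu').+1 + (size cu').+2 = (u - p).+1 by move: cs; clear; lia.
rewrite mem_rcons inE => /or3P [/eqP ->|/eqP -> //|/IH' //] _; first exact: good1.
Qed.

Section Count.
Variable x : nat.

Lemma good_bounds S y : good S -> y \in S -> head 0 S <= y <= last 0 S.
Proof.
case: S => [|p S] //= /and4P [_ so _ _] yS.
have hp := order_path_min ltn_trans so.
apply/andP; split.
  by move: yS; rewrite inE => /orP [/eqP -> //|/(allP hp) /ltnW].
have := so; rewrite [p :: S]lastI.
elim/last_ind: S so hp yS => [|S z IH] /= so hp; first by rewrite inE => /eqP ->.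
rewrite last_rcons -rcons_cons mem_rcons inE => /orP [/eqP -> //|yS _].
have [_ /allP h] : sorted ltn (p :: S) /\ all (fun x => x < z) (p :: S).
  by apply: sorted_rcons_lt; rewrite rcons_cons.
exact/ltnW/h.
Qed.

(** Distance from the start of the phrase to x, span, and size: with these fixed,
    only the choice of the elements inside a known interval is left. *)
Definition key (S : seq nat) : 'I_X * 'I_X * 'I_X :=
  (insubd (Ordinal X0) (x - head 0 S), insubd (Ordinal X0) (last 0 S - head 0 S),
   insubd (Ordinal X0) (size S).-1).

Lemma size_span (S : seq nat) : S != [::] -> sorted ltn S -> size S <= (last 0 S - head 0 S).+1.
Proof.
case: S => [|p S] //= _ so.
elim: S p so => [|q S IH] p /=; first by rewrite subnn.
case/andP => pq so; have h1 := IH _ so.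
have ql : q <= last q S.
  have /allP h := order_path_min ltn_trans so.
  by have := mem_last q S; rewrite inE => /orP [/eqP ->|/h /ltnW].
by move: h1 pq ql; clear; lia.
Qed.

Lemma key_inj_vals S S' : good S -> good S' -> x \in S -> x \in S' -> key S = key S' ->
  [/\ head 0 S = head 0 S', last 0 S = last 0 S' & size S = size S'].
Proof.
move=> gS gS' xS xS'.
have /and4P [n1 so1 l1 _] := gS; have /and4P [n2 so2 l2 _] := gS'.
have /andP [b1 b2] := good_bounds gS xS; have /andP [b3 b4] := good_bounds gS' xS'.
have z1 := size_span n1 so1; have z2 := size_span n2 so2.
case=> /(congr1 val) k1 /(congr1 val) k2 /(congr1 val) k3.
rewrite !insubdK // in k1; rewrite ?inE; [|by move: b4 l2 b3; clear; lia|by move: b2 l1 b1; clear; lia].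
rewrite !insubdK // in k2.
rewrite !insubdK // in k3; [|by move: z2 l2; clear; lia|by move: z1 l1; clear; lia].
have s1 : 0 < size S by case: (S) n1.
have s2 : 0 < size S' by case: (S') n2.
by split; [move: k1 b1 b3|move: k1 k2 b1 b2 b3 b4|move: k3 s1 s2]; clear; lia.
Qed.

Definition pattern p b (S : seq nat) : {set 'I_b.+1} := [set i : 'I_b.+1 | p + i \in S]%SET.

Lemma pattern_card S : good S ->
  #|pattern (head 0 S) (last 0 S - head 0 S) S| = size S.
Proof.
move=> gS; have /and4P [n1 so1 l1 _] := gS.
set p := head 0 S; set b := last 0 S - p.
have pe : perm_eq S [seq p + (i : 'I_b.+1) | i <- enum (pattern p b S)].
  apply: uniq_perm.
  - exact: sorted_uniq ltn_trans ltnn _ so1.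
  - by rewrite map_inj_uniq ?enum_uniq // => i j /addnI /val_inj.
  - move=> y; apply/idP/mapP => [yS|[i]]; last by rewrite mem_enum inE => h ->.
    have /andP [py yl] := good_bounds gS yS.
    have lt : y - p < b.+1 by rewrite ltnS leq_sub2r.
    by exists (Ordinal lt); rewrite ?mem_enum ?inE /= subnKC.
by rewrite [RHS](perm_size pe) size_map cardE.
Qed.

(** The sets of a given size inside the interval are counted by the binomial
    coefficient that the definition of [good] bounds by M. *)
Lemma class_count (Ss : seq (seq nat)) k0 : uniq Ss -> all good Ss -> all (fun S => x \in S) Ss ->
  all (fun S => key S == k0) Ss -> size Ss <= M.
Proof.
case: Ss => [//|S0 Ss']; set Ss := S0 :: Ss' => uS gS xS kS.
have S0in : S0 \in Ss by rewrite inE eqxx.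
have g0 : good S0 := allP gS _ S0in.
set p := head 0 S0; set b := last 0 S0 - p.
have vals S : S \in Ss -> [/\ head 0 S = p, last 0 S - head 0 S = b & size S = size S0].
  move=> h; have [e1 e2 e3] : [/\ head 0 S = head 0 S0, last 0 S = last 0 S0 & size S = size S0].
    apply: key_inj_vals; [exact: (allP gS)|done|exact: (allP xS)|exact: (allP xS)|].
    by rewrite (eqP (allP kS _ h)) (eqP (allP kS _ S0in)).
  by rewrite e1 e2.
have inj : {in Ss &, injective (pattern p b)}.
  move=> S S' hS hS' e.
  have [v1 v2 v3] := vals _ hS; have [v1' v2' v3'] := vals _ hS'.
  have gSS := allP gS _ hS; have gSS' := allP gS _ hS'.
  have /and4P [_ so1 _ _] := gSS; have /and4P [_ so2 _ _] := gSS'.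
  apply: (irr_sorted_eq ltn_trans ltnn so1 so2) => y.
  have sub T T' : T \in Ss -> T' \in Ss -> pattern p b T = pattern p b T' -> y \in T -> y \in T'.
    move=> hT hT' eT yT; have [w1 w2 w3] := vals _ hT.
    have := good_bounds (allP gS _ hT) yT; rewrite w1 => /andP [py yl].
    have lt : y - p < b.+1 by rewrite ltnS -w2 w1 leq_sub2r.
    have : Ordinal lt \in pattern p b T by rewrite inE /= subnKC.
    by rewrite eT inE /= subnKC.
  by apply/idP/idP; apply: sub.
have sub : {subset map (pattern p b) Ss <= [set A : {set 'I_b.+1} | #|A| == size S0]%SET}.
  move=> A /mapP [S hS ->]; have [w1 w2 w3] := vals _ hS.
  by rewrite inE -w3 -pattern_card ?(allP gS) // w2 w1.
have /and4P [_ _ _ hM] := g0.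
apply: leq_trans hM; rewrite -/p -/b -(size_map (pattern p b)).
have -> : 'C(b.+1, size S0) = #|[set A : {set 'I_b.+1} | #|A| == size S0]%SET|.
  by rewrite card_draws card_ord.
rewrite cardE; apply: uniq_leq_size; first by rewrite map_inj_in_uniq.
by move=> A /sub; rewrite mem_enum.
Qed.

Lemma good_count (Ss : seq (seq nat)) : uniq Ss -> all good Ss -> all (fun S => x \in S) Ss ->
  size Ss <= X * X * X * M.
Proof.
move=> uS gS xS.
have -> : size Ss = \sum_(k0 : 'I_X * 'I_X * 'I_X) size [seq S <- Ss | key S == k0].
  rewrite -sum1_size (partition_big key xpredT) //=.
  by apply: eq_bigr => k0 _; rewrite -sum1_size big_filter.
apply: (@leq_trans (\sum_(k0 : 'I_X * 'I_X * 'I_X) M)); last first.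
  by rewrite sum_nat_const !card_prod !card_ord.
apply: leq_sum => k0 _; apply: (@class_count _ k0); first exact: filter_uniq.
- by apply/allP => S; rewrite mem_filter => /andP [_ /(allP gS)].
- by apply/allP => S; rewrite mem_filter => /andP [_ /(allP xS)].
- by apply/allP => S; rewrite mem_filter => /andP [].
Qed.
End Count.
End Good.
End PatternCount.

(** * Loads in terms of phrases *)

Module Loads.
Import Phrases Output PatternCount.
Set Implicit Arguments.
Unset Strict Implicit.
Unset Printing Implicit Defensive.
Local Open Scope nat_scope.

Lemma uniq_flatten_eq (ss : seq (seq nat)) S S' v : uniq (flatten ss) ->
  S \in ss -> S' \in ss -> v \in S -> v \in S' -> S = S'.
Proof.
elim: ss => // T ss IH /=; rewrite cat_uniq => /and3P [_ /hasPn h u].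
rewrite !inE => /orP [/eqP ->|h1] /orP [/eqP ->|h2] v1 v2 //.
- have := h v; rewrite v1; case/(_ _)/negP => //.
  by apply/flattenP; exists S'.
- have := h v; rewrite v2; case/(_ _)/negP => //.
  by apply/flattenP; exists S.
- exact: IH.
Qed.

Section Loads.
Variables (N : nat) (nm : nat -> nat) (nds : seq (seq nat)) (Z : seq (seq nat * nat)).
Variable ph : nat -> seq (seq nat).
Hypothesis u_nds : uniq nds.
Hypothesis nds0 : exists nds', nds = [::] :: nds'.
Hypothesis Zph : forall v, v < N -> [seq z.1 | z <- Z & z.2 == v] = ph v.
Hypothesis uZ : uniq Z.
Hypothesis ZN : all (fun z => z.2 < N) Z.
Hypothesis Znds : forall z, z \in Z -> z.1 \in nds.
Hypothesis ph_uniq : forall v, v < N -> uniq (flatten (ph v)).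

(** The nodes whose phrases are nonempty and have been closed by some vertex:
    one biclique each. *)
Definition J := [seq j <- iota 1 (size nds - 1) | used nds Z j].
Notation nd j := (nth [::] nds j).
Notation mem j := (members Z (nd j)).

Lemma uniq_J : uniq J.
Proof. by apply: filter_uniq; apply: iota_uniq. Qed.

Lemma J_lt j : j \in J -> [/\ 0 < j, j < size nds, nd j != [::] & mem j != [::]].
Proof.
rewrite mem_filter mem_iota => /andP [ju /andP [j0 jN]].
have [nds' e] := nds0.
have jn : j < size nds by move: jN; rewrite e /=; clear; lia.
split=> //; last by move: ju; rewrite /used; case: (mem j).
apply/eqP => e0; move: u_nds; rewrite e /= => /andP [nn _].
by case/negP: nn; move: j0 jn e0; rewrite e; case: (j) => //= i _ il <-; rewrite mem_nth.
Qed.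

Lemma members_P v j : (v \in mem j) = ((nd j, v) \in Z).
Proof.
apply/mapP/idP => [[[a b]]|h]; last by exists (nd j, v); rewrite // mem_filter eqxx.
by rewrite mem_filter /= => /andP [/eqP <- h] ->.
Qed.

Lemma ph_P v S : v < N -> (S \in ph v) = ((S, v) \in Z).
Proof.
move=> vN; rewrite -Zph //; apply/mapP/idP => [[[a b]]|h]; last by exists (S, v); rewrite // mem_filter /= eqxx.
by rewrite mem_filter /= => /andP [/eqP -> h] ->.
Qed.

Lemma Z_lt S v : (S, v) \in Z -> v < N.
Proof. by move/(allP ZN). Qed.

Lemma J_index S v : (S, v) \in Z -> S != [::] -> index S nds \in J /\ nd (index S nds) = S.
Proof.
move=> hZ S0; have Sn := Znds hZ; rewrite /= in Sn.
have e := nth_index [::] Sn; split=> //.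
have i0 : 0 < index S nds.
  by rewrite lt0n; apply/eqP => e0; case/eqP: S0; rewrite -e e0; have [nds' ->] := nds0.
have il : index S nds < size nds by rewrite index_mem.
rewrite mem_filter mem_iota i0; apply/andP; split; last by move: il i0; clear; lia.
rewrite /used lt0n size_eq0; apply/eqP => h.
have : v \in mem (index S nds) by rewrite members_P e.
by rewrite h.
Qed.

Lemma nd_inj : {in J &, injective (fun j => nd j)}.
Proof.
move=> i j /J_lt [_ i1 _ _] /J_lt [_ j1 _ _] /eqP; rewrite nth_uniq //; exact: eqP.
Qed.

Lemma load_mem v : v < N -> count (fun j => v \in mem j) J <= size (ph v).
Proof.
move=> vN; rewrite -size_filter -(size_map (fun j => nd j)).
apply: uniq_leq_size.
  rewrite map_inj_in_uniq; first exact: (filter_uniq _ uniq_J). move=> i j.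
  by rewrite 2!(mem_filter _ _ J) => /andP [_ hi] /andP [_ hj]; exact: nd_inj.
by move=> S /mapP [j]; rewrite mem_filter => /andP [h _] ->; rewrite ph_P // -members_P.
Qed.

Lemma J_good j X M : j \in J -> (forall v S, v < N -> S \in ph v -> S != [::] -> good X M S) ->
  good X M (nd j).
Proof.
move=> jJ h; have [j0 jn n0 m0] := J_lt jJ.
case E : (mem j) m0 => [//|v ms] _.
have vm : v \in mem j by rewrite E inE eqxx.
rewrite members_P in vm; have vN := Z_lt vm.
by apply: (h v) => //; rewrite ph_P.
Qed.

Lemma load_side v X M : 0 < X -> (forall v S, v < N -> S \in ph v -> S != [::] -> good X M S) ->
  count (fun j => v \in nd j) J <= X * X * X * M.
Proof.
move=> X0 h; rewrite -size_filter -(size_map (fun j => nd j)).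
apply: (good_count X0 (x := v)).
- rewrite map_inj_in_uniq; first exact: (filter_uniq _ uniq_J). move=> i j.
  by rewrite 2!(mem_filter _ _ J) => /andP [_ hi] /andP [_ hj]; exact: nd_inj.
- by apply/allP => S /mapP [j]; rewrite mem_filter => /andP [_ jJ] ->; exact: J_good.
- by apply/allP => S /mapP [j]; rewrite mem_filter => /andP [? _] ->.
Qed.

(** A biclique with v on the phrase side is determined by any vertex of its other
    side, as the phrases of one row are disjoint. *)
Lemma load_side_N v : count (fun j => v \in nd j) J <= N.
Proof.
rewrite -size_filter -(size_map (fun j => head 0 (mem j))) -[X in _ <= X](size_iota 0 N).
have hd j : j \in J -> (nd j, head 0 (mem j)) \in Z.
  move=> /J_lt [_ _ _ m0]; rewrite -members_P.
  by case: (mem j) m0 => //= u ms _; rewrite inE eqxx.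
apply: uniq_leq_size.
  rewrite map_inj_in_uniq; first exact: (filter_uniq _ uniq_J). move=> i j.
  rewrite 2!(mem_filter _ _ J) => /andP [vi hi] /andP [vj hj] e.
  apply: nd_inj => //; have zi := hd _ hi; have zj := hd _ hj; rewrite -e in zj.
  have uN := Z_lt zi.
  by apply: (uniq_flatten_eq (ph_uniq uN) _ _ vi vj); rewrite ph_P.
by move=> u /mapP [j]; rewrite mem_filter => /andP [_ /hd h] ->; rewrite mem_iota /= (Z_lt h).
Qed.

(** Distinct phrases of one row start at distinct vertices. *)
Lemma load_mem_N v : v < N -> (forall S, S \in ph v -> all (fun x => x < N) S) ->
  count (fun j => v \in mem j) J <= N.
Proof.
move=> vN hN; rewrite -size_filter -(size_map (fun j => head 0 (nd j))) -[X in _ <= X](size_iota 0 N).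
have hd j : j \in J -> head 0 (nd j) \in nd j.
  by move=> /J_lt [_ _ n0 _]; case: (nd j) n0 => //= u ms _; rewrite inE eqxx.
have hp j : v \in mem j -> nd j \in ph v by rewrite members_P ph_P.
apply: uniq_leq_size.
  rewrite map_inj_in_uniq; first exact: (filter_uniq _ uniq_J). move=> i j.
  rewrite 2!(mem_filter _ _ J) => /andP [vi hi] /andP [vj hj] e.
  apply: nd_inj => //; have zi := hd _ hi; have zj := hd _ hj; rewrite -e in zj.
  by apply: (uniq_flatten_eq (ph_uniq vN) _ _ zi zj); apply: hp.
move=> u /mapP [j]; rewrite mem_filter => /andP [vj jJ] ->; rewrite mem_iota /=.
by apply: (allP (hN _ (hp _ vj))); exact: hd.
Qed.

Lemma sum_Z : \sum_(z <- Z) size z.1 = \sum_(v < N) size (flatten (ph v)).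
Proof.
have e (v : 'I_N) : size (flatten (ph v)) = \sum_(z <- Z | z.2 == v) size z.1.
  by rewrite size_flatten /shape -Zph // sumnE big_map big_map big_filter.
under [RHS]eq_bigr => v _ do rewrite e.
rewrite (exchange_big_dep xpredT) //=; apply: eq_big_seq => z zZ.
have zN : z.2 < N by apply: (allP ZN).
rewrite (bigD1 (Ordinal zN)) ?eqxx //= big1 ?addn0 // => v /andP [/eqP h1 /eqP h2].
by case: h2; apply/val_inj; rewrite /= h1.
Qed.

(** A biclique with sides of sizes c and q takes 2 + c + q <= 4 * (c * q) cells,
    and the products c * q add up to the total length of the rows. *)
Lemma encs_total : size (encs nm nds Z (size nds)) <= 4 * \sum_(v < N) size (flatten (ph v)).
Proof.
rewrite -sum_Z /encs -/J size_flatten /shape sumnE big_map big_map.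
apply: (@leq_trans (\sum_(j <- J) 4 * \sum_(z <- Z | z.1 == nd j) size z.1)).
  rewrite big_seq [X in _ <= X]big_seq; apply: leq_sum => j jJ.
  have [_ _ n0 m0] := J_lt jJ.
  have -> : \sum_(z <- Z | z.1 == nd j) size z.1 = size (mem j) * size (nd j).
    rewrite -big_filter (eq_big_seq (fun=> size (nd j))) => [|z]; last by rewrite mem_filter => /andP [/eqP ->].
    by rewrite big_const_seq count_predT iter_addn_0 mulnC /members size_map.
  rewrite /enc /= size_cat (size_map _ (nd j)) (size_map _ (mem j)).
  have : 0 < size (nd j) by rewrite lt0n size_eq0.
  have : 0 < size (mem j) by rewrite lt0n size_eq0.
  by move: (size (nd j)) (size (mem j)) => c q; clear; nia.
rewrite -big_distrr leq_mul2l /=.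
rewrite (exchange_big_dep xpredT) //=; apply: leq_sum => z _.
rewrite -big_filter; set K := [seq j <- J | z.1 == nd j].
have : size K <= 1.
  have uK : uniq K by apply: filter_uniq; exact: uniq_J.
  case E : K uK => [|i [|i' K']] //= /andP [nn _].
  have hi : i \in K by rewrite E inE eqxx.
  have hi' : i' \in K by rewrite E !inE eqxx orbT.
  move: hi hi'; rewrite 2!(mem_filter _ _ J) => /andP [/eqP e1 j1] /andP [/eqP e2 j2].
  by move: nn; rewrite (nd_inj j1 j2) ?inE ?eqxx // -e1 -e2.
by case: K => [|i [|]] //=; rewrite ?big_nil ?big_seq1.
Qed.
End Loads.
End Loads.

(** * The phrases form a biclique partition *)

Module Partition.
Import Phrases Tables Stream Output Program PhraseCount PatternCount Loads.
Set Implicit Arguments.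
Unset Strict Implicit.
Unset Printing Implicit Defensive.
Local Open Scope nat_scope.

Lemma nth_flatten_off (T : Type) (x0 : T) (ss : seq (seq T)) u i :
  u < size ss -> i < size (nth [::] ss u) ->
  nth x0 (flatten ss) (sumn (shape (take u ss)) + i) = nth x0 (nth [::] ss u) i.
Proof.
elim: ss u => [|s ss IH] [|u] //= us il; first by rewrite add0n nth_cat il.
by rewrite nth_cat ifF -?addnA ?addKn ?IH //; apply/negbTE; rewrite -leqNgt leq_addr.
Qed.

Section Graph.
Variables (n : nat) (G : sgraph 'I_n).

Lemma edge_card e : e \in edges G -> #|e| = 2.
Proof. by move=> eG; have /forallP/(_ e)/implyP/(_ eG)/eqP := edges_card2 G. Qed.

Lemma edge_neq x y : [set x; y]%SET \in edges G -> x != y.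
Proof. by move/edge_card => h; apply/eqP => e; move: h; rewrite e finset.setUid cards1. Qed.

Lemma handshake : \sum_(v : 'I_n) degree G v = 2 * #|edges G|.
Proof.
rewrite /degree; under eq_bigr => v _ do rewrite -sum1_card.
have -> : 2 * #|edges G| = \sum_(e in edges G) \sum_(v in e) 1.
  rewrite (eq_bigr (fun=> 2)) ?sum_nat_const 1?mulnC // => e eG.
  by rewrite sum1_card (edge_card eG).
rewrite (exchange_big_dep (mem (edges G))) /=; last by move=> v e _; rewrite inE => /andP [].
by apply: eq_bigr => e eG; apply: eq_bigl => v; rewrite inE eG.
Qed.

Lemma degree_nb v : #|neighbours G v| = degree G v.
Proof.
have nv u : u \in neighbours G v -> u != v.
  by rewrite inE => /edge_neq; rewrite eq_sym.
rewrite -(card_in_imset (f := fun u => [set v; u]%SET)); last first.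
  move=> u u' /nv h /nv h' /setP /(_ u); rewrite !inE eqxx orbT (negbTE h) /=.
  by move/esym/eqP.
rewrite /degree; apply: eq_card => e; rewrite inE; apply/imsetP/andP => [[u]|[eG ve]].
  by rewrite inE => h ->; rewrite h !inE eqxx.
have /cards2P [a [b [ab e2]]] : #|e| == 2 by rewrite edge_card.
move: ve; rewrite e2 !inE => /orP [/eqP ->|/eqP ->].
  by exists b; rewrite ?inE -?e2.
by exists a; rewrite ?inE ?(finset.setUC [set b]%SET) -?e2 //.
Qed.

Variables (vs : seq 'I_n) (nb : 'I_n -> seq 'I_n) (inp : seq nat).
Hypothesis n20 : 20 <= n.
Hypothesis vsP : perm_eq vs [seq v <- enum 'I_n | 0 < degree G v].
Hypothesis nbP : forall v, perm_eq (nb v) (enum (neighbours G v)).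
Hypothesis inpP : inp = [:: n, size vs & flatten
        [seq [:: val v, size (nb v) & [seq val u | u <- nb v]] | v <- vs]].

(** The listed vertices are renumbered by their position in the input; isolated
    vertices thereby disappear. *)
Definition v0 : 'I_n := Ordinal (leq_trans (isT : 0 < 20) n20).
Definition N := size vs.
Definition vtx u := nth v0 vs u.
Definition nm u : nat := vtx u.
Definition adj u := if u < N then [seq index x vs | x <- nb (vtx u)] else [::].

Lemma mem_vs x : (x \in vs) = (0 < degree G x).
Proof. by rewrite (perm_mem vsP) mem_filter mem_enum andbT. Qed.

Lemma uniq_vs : uniq vs.
Proof. by rewrite (perm_uniq vsP) filter_uniq // enum_uniq. Qed.

Lemma mem_nb x y : (y \in nb x) = ([set x; y]%SET \in edges G).
Proof. by rewrite (perm_mem (nbP x)) mem_enum inE. Qed.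

Lemma uniq_nb x : uniq (nb x).
Proof. by rewrite (perm_uniq (nbP x)) enum_uniq. Qed.

Lemma nb_vs x y : y \in nb x -> y \in vs.
Proof.
rewrite mem_nb mem_vs => h; rewrite /degree card_gt0; apply/set0Pn.
by exists [set x; y]%SET; rewrite inE h !inE eqxx orbT.
Qed.

Lemma size_nb x : size (nb x) = degree G x.
Proof. by rewrite (perm_size (nbP x)) -cardE degree_nb. Qed.

Lemma index_vtx u : u < N -> index (vtx u) vs = u.
Proof. by move=> uN; rewrite /vtx index_uniq // uniq_vs. Qed.

Lemma vtx_index x : x \in vs -> vtx (index x vs) = x.
Proof. by move=> h; rewrite /vtx nth_index. Qed.

Lemma vtx_inj u v : u < N -> v < N -> vtx u = vtx v -> u = v.
Proof. by move=> uN vN e; rewrite -(index_vtx uN) e index_vtx. Qed.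

Lemma nm_lt u : nm u < n.
Proof. exact: ltn_ord. Qed.

Lemma nm_inj u v : u < N -> v < N -> nm u = nm v -> u = v.
Proof. by move=> uN vN /val_inj; apply: vtx_inj. Qed.

Lemma mem_adj u v : u < N -> v < N -> (v \in adj u) = ([set vtx u; vtx v]%SET \in edges G).
Proof.
move=> uN vN; rewrite /adj uN -mem_nb; apply/mapP/idP => [[x xn e]|h].
  by rewrite e vtx_index // (nb_vs xn).
by exists (vtx v); rewrite ?index_vtx.
Qed.

Lemma adj_lt u v : v \in adj u -> v < N.
Proof. by rewrite /adj; case: ifP => // uN /mapP [x /nb_vs xv ->]; rewrite index_mem. Qed.

Lemma adj_irr u : u \notin adj u.
Proof.
have [uN|uN] := ltnP u N; last by rewrite /adj ltnNge uN.
by rewrite mem_adj //; apply/negP => /edge_neq; rewrite eqxx.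
Qed.

Lemma adj_sym u v : u < N -> v < N -> (v \in adj u) = (u \in adj v).
Proof. by move=> uN vN; rewrite !mem_adj // finset.setUC. Qed.

Lemma adj_uniq u : uniq (adj u).
Proof.
rewrite /adj; case: ifP => // _; rewrite map_inj_in_uniq ?uniq_nb // => x y hx hy e.
by rewrite -(vtx_index (nb_vs hx)) e vtx_index // (nb_vs hy).
Qed.

Lemma adj_size u : u < N -> size (adj u) < N.
Proof.
move=> uN; have sub : {subset u :: adj u <= iota 0 N}.
  by move=> v; rewrite inE mem_iota => /orP [/eqP ->|/adj_lt].
by have := uniq_leq_size _ sub; rewrite /= size_iota; apply; rewrite adj_irr adj_uniq.
Qed.

Lemma adj_degree u : u < N -> size (adj u) = degree G (vtx u).
Proof. by move=> uN; rewrite /adj uN size_map size_nb. Qed.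

Lemma Nn : N <= n.
Proof. by rewrite /N -(card_uniqP uniq_vs); apply: leq_trans (max_card _) _; rewrite card_ord. Qed.

Definition blk v := [:: val v, size (nb v) & [seq val u | u <- nb v]].

Lemma st_sum u : u <= N -> Prepass.st adj u = 2 + sumn (shape (take u [seq blk v | v <- vs])).
Proof.
elim: u => [|u IH] uN; first by rewrite take0.
rewrite /= IH; last exact: ltnW.
rewrite (take_nth [::]) ?size_map // /shape map_rcons sumn_rcons (nth_map v0) //=.
by rewrite size_map /adj uN size_map /vtx -!addnA.
Qed.

Lemma inp_at u i : u < N -> i < size (blk (vtx u)) ->
  nth 0 inp (Prepass.st adj u + i) = nth 0 (blk (vtx u)) i.
Proof.
move=> uN il; rewrite st_sum; last exact: ltnW.
rewrite inpP -addnA /= -(nth_map v0 [::] blk) // nth_flatten_off ?size_map //.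
by rewrite (nth_map v0).
Qed.

Lemma inp_nm u : u < N -> nth 0 inp (Prepass.st adj u) = nm u.
Proof. by move=> uN; rewrite -[Prepass.st adj u]addn0 inp_at. Qed.

Lemma inp_dg u : u < N -> nth 0 inp (Prepass.st adj u + 1) = size (adj u).
Proof. by move=> uN; rewrite inp_at // /adj uN size_map. Qed.

Lemma inp_nb u j : u < N -> j < size (adj u) ->
  nth 0 inp (Prepass.st adj u + 2 + j) = nm (nth 0 (adj u) j).
Proof.
move=> uN; rewrite /adj uN size_map => js; rewrite -addnA inp_at //=; last by rewrite size_map.
rewrite (nth_map v0) // (nth_map v0) // /nm vtx_index //.
by apply: (@nb_vs (vtx u)); rewrite mem_nth.
Qed.

Lemma size_inp : size inp = Prepass.st adj N.
Proof.
rewrite st_sum // inpP take_oversize ?size_map //= size_flatten.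
by rewrite add2n.
Qed.

Lemma inp_lt : all (fun x => x <= n) inp.
Proof.
rewrite inpP /= leqnn Nn /=; apply/allP => x /flattenP [s /mapP [v _ ->]].
rewrite !inE => /or3P [/eqP ->|/eqP ->|/mapP [u _ ->]]; try exact/ltnW/ltn_ord.
by rewrite size_nb -degree_nb; apply: leq_trans (max_card _) _; rewrite card_ord.
Qed.

Lemma sum_deg : \sum_(u < N) size (adj u) = 2 * #|edges G|.
Proof.
rewrite -handshake (bigID (mem vs)) /= [X in _ = _ + X]big1 ?addn0 => [|v]; last first.
  by rewrite mem_vs -eqn0Ngt => /eqP.
rewrite -big_uniq ?uniq_vs // (big_nth v0) big_mkord.
by apply: eq_bigr => u _; rewrite adj_degree.
Qed.

Lemma st_total : Prepass.st adj N = 2 + 2 * N + 2 * #|edges G|.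
Proof.
rewrite -sum_deg; move: N => q; elim: q => [|q IH]; first by rewrite big_ord0.
by rewrite big_ord_recr /= IH; move: (\sum_(i < q) _) (size (adj q)) => a b; clear; lia.
Qed.

Lemma N_le : N <= 2 * #|edges G|.
Proof.
rewrite -sum_deg -[X in X <= _]card_ord -sum1_card; apply: leq_sum => u _.
by rewrite adj_degree // -mem_vs mem_nth.
Qed.

Variable rnd : seq nat.
Notation D := (Prepass.maxmin N adj N).
Notation B := (Bf N).
Notation X := (Xf N D).
Notation M := (Mf N D).
Notation rsp := (resp N rnd).
Definition rows v := Stream.row N adj rnd N v.
Definition ph v := phrases B X M (rows v).

Lemma coinC i j : coin N rnd i j = coin N rnd j i.
Proof. by rewrite /coin maxnC minnC. Qed.

Lemma resp_anti u v : u != v -> rsp u v = ~~ rsp v u.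
Proof.
move=> uv; rewrite /resp coinC.
have : coin N rnd (v %/ B) (u %/ B) < 2 by rewrite ltn_mod.
case: (ltngtP u v) uv => // _ _; case: (coin _ _ _ _) => [|[|]] //.
Qed.

Lemma rows_P v u : (u \in rows v) = [&& u < N, v \in adj u & rsp v u].
Proof. by rewrite mem_filter mem_iota /= andbC. Qed.

Lemma uniq_rows v : uniq (rows v).
Proof. by apply: filter_uniq; apply: iota_uniq. Qed.

Lemma flatten_ph v : flatten (ph v) = rows v.
Proof. exact: flatten_phrases. Qed.

Lemma size_rows v : v < N -> size (rows v) <= size (adj v).
Proof.
move=> vN; apply: uniq_leq_size; first exact: uniq_rows.
by move=> u; rewrite rows_P => /and3P [uN h _]; rewrite adj_sym.
Qed.

Lemma ph_lt v S : S \in ph v -> all (fun x => x < N) S.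
Proof.
move=> hS; apply/allP => x xS; have : x \in rows v by rewrite -flatten_ph; apply/flattenP; exists S.
by rewrite rows_P => /andP [].
Qed.

Variables (nds : seq (seq nat)) (Z : seq (seq nat * nat)).
Hypothesis hF : final N adj rnd nds Z.

Lemma fU : uniq nds. Proof. by case: hF => [[]]. Qed.
Lemma f0 : exists nds', nds = [::] :: nds'. Proof. by case: hF => [[]]. Qed.
Lemma fZ v : v < N -> [seq z.1 | z <- Z & z.2 == v] = ph v. Proof. by case: hF => _ h _; exact: h. Qed.
Lemma fuZ : uniq Z. Proof. by case: hF => _ _ []. Qed.
Lemma fZN : all (fun z => z.2 < N) Z. Proof. by case: hF => _ _ []. Qed.
Lemma fZn z : z \in Z -> z.1 \in nds. Proof. by case: hF => _ _ [_ _]; apply. Qed.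
Lemma ph_uniq v : v < N -> uniq (flatten (ph v)).
Proof. by rewrite flatten_ph uniq_rows. Qed.

Notation JJ := (J nds Z).
Notation nd j := (nth [::] nds j).
Notation mem j := (members Z (nd j)).

Lemma mem_P j v : (v \in mem j) = ((nd j, v) \in Z).
Proof. exact: members_P. Qed.

Lemma mem_lt j : all (fun x => x < N) (mem j).
Proof. by apply/allP => v; rewrite mem_P => /(allP fZN). Qed.

Lemma mem_uniq j : uniq (mem j).
Proof.
rewrite map_inj_in_uniq ?filter_uniq ?fuZ // => -[a c] [d e].
by rewrite !mem_filter /= => /andP [/eqP -> _] /andP [/eqP -> _] ->.
Qed.

Lemma mem_ph j v : v \in mem j -> v < N /\ nd j \in ph v.
Proof.
move=> h; have vN := allP (mem_lt j) _ h; split=> //.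
by rewrite (ph_P fZ) // -mem_P.
Qed.

Lemma J_mem j : j \in JJ -> exists2 v, v < N & nd j \in ph v.
Proof.
move=> /(J_lt fU f0) [_ _ _]; case E : (mem j) => [//|v ms] _.
by have [|vN h] := @mem_ph j v; [rewrite E inE eqxx|exists v].
Qed.

Lemma nd_lt j : j \in JJ -> all (fun x => x < N) (nd j).
Proof. by move=> /J_mem [v vN /ph_lt]. Qed.

Lemma nd_uniq j : j \in JJ -> uniq (nd j).
Proof.
move=> /J_mem [v vN h]; have := ph_uniq vN.
by case/splitPr: h => s1 s2; rewrite flatten_cat /= !cat_uniq => /and3P [_ _ /andP []].
Qed.

Definition bic j : seq 'I_n * seq 'I_n := ([seq vtx x | x <- nd j], [seq vtx x | x <- mem j]).
Definition outL := [seq bic j | j <- JJ].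
Definition outP := [seq ([set v in K.1]%SET, [set v in K.2]%SET) | K <- outL].

Lemma mem_map_vtx (s : seq nat) u : all (fun x => x < N) s -> u < N -> (vtx u \in [seq vtx x | x <- s]) = (u \in s).
Proof.
move=> sN uN; apply/mapP/idP => [[x xs e]|us]; last by exists u.
by rewrite (vtx_inj uN _ e) // (allP sN).
Qed.

Lemma map_vtx_uniq (s : seq nat) : all (fun x => x < N) s -> uniq s -> uniq [seq vtx x | x <- s].
Proof.
move=> sN us; rewrite map_inj_in_uniq // => x y xs ys.
by apply: vtx_inj; apply: (allP sN).
Qed.

Lemma enc_outL : encode_bicliques outL = nused nds Z (size nds) :: encs nm nds Z (size nds).
Proof.
rewrite /encode_bicliques /outL size_map; congr (_ :: flatten _).
rewrite -map_comp; apply: eq_map => j /=.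
by rewrite /enc /= !size_map map_cat -!map_comp.
Qed.

Lemma cross_edge j x y : x \in nd j -> y \in mem j ->
  [/\ x < N, y < N, x \in rows y & [set vtx x; vtx y]%SET \in edges G].
Proof.
move=> xS yv; have [yN yp] := mem_ph yv.
have xr : x \in rows y by rewrite -flatten_ph; apply/flattenP; exists (nd j).
have := xr; rewrite {1}rows_P => /and3P [xN h _].
by have := mem_adj xN yN; rewrite h => /esym e; split.
Qed.

Lemma bic_biclique : all (is_biclique G) outP.
Proof.
apply/allP => K /mapP [K0 /mapP [j jJ ->] ->] /=.
have [_ _ n0 m0] := J_lt fU f0 jJ.
apply/and4P; split => /=.
- by case: (nd j) n0 => // x s _; apply/set0Pn; exists (vtx x); rewrite inE /= inE eqxx.
- by case: (mem j) m0 => // x s _; apply/set0Pn; exists (vtx x); rewrite inE /= inE eqxx.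
- rewrite -setI_eq0; apply/eqP/setP => z; rewrite !inE; apply/negP => /andP [].
  move=> /mapP [x xS ->] /mapP [y yv e]; have [xN yN xr eG] := cross_edge xS yv.
  by move/edge_neq: eG; rewrite e eqxx.
- apply/fintype.subsetP => e /imset2P [a b]; rewrite !inE => /mapP [x xS ->] /mapP [y yv ->] ->.
  by have [] := cross_edge xS yv.
Qed.

(** The orientation tells on which side each end of an edge must lie. *)
Lemma in_bic j u v : j \in JJ -> u < N -> v < N -> rsp v u -> u != v ->
  ([set vtx u; vtx v]%SET \in bedges ([set z in (bic j).1]%SET, [set z in (bic j).2]%SET)) =
  (u \in nd j) && (v \in mem j).
Proof.
move=> jJ uN vN rv uv; apply/imset2P/andP => [[a b]|[us vm]]; last first.
  by exists (vtx u) (vtx v); rewrite // inE map_f.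
rewrite !inE => /mapP [x xS ->] /mapP [y ym ->] e.
have [xN yN xr _] := cross_edge xS ym.
have : vtx x \in [set vtx u; vtx v]%SET by rewrite e !inE eqxx.
have : vtx y \in [set vtx u; vtx v]%SET by rewrite e !inE eqxx orbT.
have xy : x != y.
  by move: xr; rewrite rows_P => /and3P [_ h _]; apply: contraTneq h => ->; exact: adj_irr.
rewrite !inE => /orP [] /eqP /vtx_inj h1 /orP [] /eqP /vtx_inj h2.
- by move: xy; rewrite (h1 yN uN) (h2 xN uN) eqxx.
- move: xr; rewrite rows_P (h1 yN uN) (h2 xN vN) => /and3P [_ _].
  by rewrite resp_anti // rv.
- by rewrite -(h1 yN vN) -(h2 xN uN).
- by move: xy; rewrite (h1 yN vN) (h2 xN vN) eqxx.
Qed.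

(** An edge occurs in the row of exactly one of its ends, and there in exactly
    one phrase, because the phrases of a row are disjoint. *)
Lemma outP_partition : biclique_partition G outP.
Proof.
apply/andP; split; first exact: bic_biclique.
apply/forallP => e; apply/implyP => eG.
have /cards2P [a [b [ab e2]]] : #|e| == 2 by rewrite edge_card.
have eab : [set a; b]%SET \in edges G by rewrite -e2.
have bN : b \in vs by apply: (@nb_vs a); rewrite mem_nb.
have aN : a \in vs by apply: (@nb_vs b); rewrite mem_nb finset.setUC.
have [u [v [[uN vN rv uv] e']]] : exists u v, [/\ u < N, v < N, rsp v u & u != v] /\ e = [set vtx u; vtx v]%SET.
  have iab : index a vs != index b vs.
    by apply: contraNneq ab => h; rewrite -(vtx_index aN) h vtx_index.
  have [r|r] := boolP (rsp (index b vs) (index a vs)).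
    by exists (index a vs), (index b vs); rewrite !index_mem !vtx_index.
  exists (index b vs), (index a vs); rewrite !index_mem !vtx_index // finset.setUC; split=> //.
  by split=> //; [rewrite resp_anti ?r // |rewrite eq_sym].
have uvG : [set vtx u; vtx v]%SET \in edges G by rewrite -e'.
rewrite e'.
have ur : u \in rows v by rewrite rows_P uN rv andbT /= mem_adj.
have /flattenP [S Sph uS] : u \in flatten (ph v) by rewrite flatten_ph.
have SZ : (S, v) \in Z by rewrite -(ph_P fZ).
have S0 : S != [::] by apply: contraTneq uS => ->.
have [iJ iE] := J_index f0 fZn SZ S0.
rewrite /outP /outL -map_comp count_map.
rewrite (eq_in_count (a2 := pred1 (index S nds))); last first.
  move=> j jJ; rewrite /= in_bic //; apply/andP/eqP => [[uj vj]|->]; last first.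
    by split; [rewrite iE|rewrite mem_P iE].
  have [_ jph] := mem_ph vj.
  have e1 : nd j = S by apply: (uniq_flatten_eq (ph_uniq vN) jph Sph uj uS).
  by apply: (nd_inj fU f0 jJ iJ); rewrite iE.
by rewrite count_uniq_mem ?iJ // uniq_J.
Qed.

Lemma load_out x : x \in vs -> load outP x <=
  count (fun j => index x vs \in nd j) JJ + count (fun j => index x vs \in mem j) JJ.
Proof.
move=> xV; rewrite /load /outP /outL -map_comp count_map -count_predUI -[X in X <= _]addn0.
apply: leq_add => //; rewrite (@eq_in_count _ _ (predU (fun j => index x vs \in nd j) (fun j => index x vs \in mem j))) // => j jJ /=.
rewrite /bvertices !inE /=; congr (_ || _).
  by rewrite -{1}(vtx_index xV) mem_map_vtx ?nd_lt ?index_mem.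
by rewrite -{1}(vtx_index xV) mem_map_vtx ?mem_lt ?index_mem.
Qed.

Lemma load_out0 x : x \notin vs -> load outP x = 0.
Proof.
move=> xV; rewrite /load /outP /outL -map_comp count_map; apply/eqP.
rewrite -[_ == 0]negbK -lt0n -has_count; apply/hasPn => j jJ /=.
rewrite /bvertices !inE /=; apply/negP => /orP [] /mapP [u us e].
  by case/negP: xV; rewrite e mem_nth //; exact: (allP (nd_lt jJ)).
by case/negP: xV; rewrite e mem_nth //; exact: (allP (mem_lt j)).
Qed.

Lemma load_2N x : load outP x <= 2 * N.
Proof.
have [xV|xV] := boolP (x \in vs); last by rewrite load_out0.
have vN : index x vs < N by rewrite index_mem.
apply: leq_trans (load_out xV) _; rewrite mul2n -addnn; apply: leq_add.
  exact: (load_side_N fU f0 fZ fZN ph_uniq).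
by apply: (load_mem_N fU f0 fZ ph_uniq vN) => S; exact: ph_lt.
Qed.

(** The non-neighbours and the neighbours outside the block of v for which v is
    responsible: as functions of the tape, these are sums of coins. *)
Definition zeros v := count (fun i => [&& i %/ B != v %/ B, rsp v i & v \notin adj i]) (iota 0 N).
Definition onesv v := count (fun i => [&& i %/ B != v %/ B, rsp v i & v \in adj i]) (iota 0 N).

(** Outside the block of v, responsibility is constant on blocks, which is what
    the count of phrases requires. *)
Lemma load_f x : 0 < M -> x \in vs -> exists f,
  [/\ load outP x <= X * X * X * M + (f + N %/ X + N %/ B + B + 2),
      M ^ f <= X ^ f * 'C(zeros (index x vs) + onesv (index x vs), onesv (index x vs)),
      f <= zeros (index x vs) & f <= onesv (index x vs)].
Proof.
move=> M0 xV; have X0 : 0 < X by apply: Xf_gt0.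
set v := index x vs; have vN : v < N by rewrite index_mem.
have B0 : 0 < B by rewrite /Bf addn1.
pose E := fun i => (v \in adj i) && rsp v i.
pose el := fun i => (i %/ B != v %/ B) && rsp v i.
have eb p y : p %/ B = y %/ B -> el p = el y.
  rewrite /el => e; rewrite e; case: eqP => //= ne; rewrite /resp e; congr (_ == _ :> nat).
  have [vp|pv] := ltnP v p; have [vy|yv] := ltnP v y => //.
    by case: ne; apply/eqP; rewrite eqn_leq leq_div2r //= -e leq_div2r // ltnW.
  by case: ne; apply/eqP; rewrite eqn_leq -{1}e leq_div2r //= leq_div2r // ltnW.
have eE p : E p -> p %/ B != v %/ B -> el p by rewrite /E /el => /andP [_ ->] ->.
have [f [f1 f2 f3 f4]] := @phrases_count B X M (v %/ B) E el B0 X0 M0 eb eE N.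
have zE : zc E el N = zeros v.
  by apply: eq_count => i; rewrite /el /E /=; case: (_ != _); case: (resp _ _ _ _); case: (_ \in _).
have oE : oc E el N = onesv v.
  by apply: eq_count => i; rewrite /el /E /=; case: (_ != _); case: (resp _ _ _ _); case: (_ \in _).
rewrite zE oE in f2 f3 f4.
exists f; split=> //; apply: leq_trans (load_out xV) _; apply: leq_add.
  apply: (load_side fU f0 fZ fZN _ X0) => u S uN hS n0.
  by apply: phrases_good hS n0 => //; exact: row_sorted.
by apply: leq_trans (load_mem fU f0 fZ vN) _; exact: f1.
Qed.
End Graph.
End Partition.

(** * Correctness and running time for every tape *)

Module Algorithm.
Import Tables Output Program Loads Partition.
Set Implicit Arguments.
Unset Strict Implicit.
Unset Printing Implicit Defensive.
Local Open Scope nat_scope.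

Lemma word_size_pow n : n ^ 6 <= 2 ^ word_size 6 n.
Proof.
rewrite /word_size mulnC expnM leq_exp2r // ltnW //.
exact: trunc_log_ltn.
Qed.

Section Alg.
Variables (n : nat) (G : sgraph 'I_n) (vs : seq 'I_n) (nb : 'I_n -> seq 'I_n) (inp : seq nat).
Hypothesis n20 : 20 <= n.
Hypothesis vsP : perm_eq vs [seq v <- enum 'I_n | 0 < degree G v].
Hypothesis nbP : forall v, perm_eq (nb v) (enum (neighbours G v)).
Hypothesis inpP : inp = [:: n, size vs & flatten
        [seq [:: val v, size (nb v) & [seq val u | u <- nb v]] | v <- vs]].
Notation w := (word_size 6 n).
Notation N := (size vs).
Notation adj := (adj vs nb n20).
Notation D := (Prepass.maxmin N adj N).
Notation B := (Bf N).
Notation X := (Xf N D).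
Notation M := (Mf N D).

(** Words of [word_size 6 n] bits hold n^6, which leaves room for all addresses,
    below 20 * n^4.  The running time is O(N + m) with N <= 2 * m; the constant
    absorbs the lower-order costs, also for the empty graph. *)
Lemma algorithm (rnd : seq nat) time : all (fun x => x < 2 ^ w) rnd ->
  170 * 100 * maxn 1 #|edges G| <= time ->
  exists P, [/\ outputs_bicliques (run w prog inp rnd time) P, biclique_partition G P,
    forall x, load P x <= 2 * N,
    forall x, x \notin vs -> load P x = 0 &
    0 < M -> forall x, x \in vs -> exists f,
  [/\ load P x <= X * X * X * M + (f + N %/ X + N %/ B + B + 2),
      M ^ f <= X ^ f * 'C(zeros vs nb n20 rnd (index x vs) + onesv vs nb n20 rnd (index x vs),
                         onesv vs nb n20 rnd (index x vs)),
      f <= zeros vs nb n20 rnd (index x vs) & f <= onesv vs nb n20 rnd (index x vs)]].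
Proof.
move=> hr ht.
have w0 : 0 < w by [].
have sT : Prepass.st adj N = 2 + 2 * N + 2 * #|edges G| := st_total n20 vsP nbP.
have N2 : N <= 2 * #|edges G| := N_le n20 vsP nbP.
have Nn' : N <= n := Nn vsP.
have szi : size inp <= n ^ 4.
  rewrite (size_inp n20 inpP) -[Partition.N _]/N.
  have := Prepass.st_S Nn' (adj_size n20 vsP nbP) (leqnn N).
  rewrite !expnS expn0 => h; apply: leq_trans (ltnW h) _; move: n20; clear; nia.
have i0 : nth 0 inp 0 = n by rewrite inpP.
have i1 : nth 0 inp 1 = N by rewrite inpP.
have [T [nds [Z [hF hT hR]]]] := @prog_run w n N (nm vs n20) adj inp rnd w0 n20 Nn' (word_size_pow n) szi
  (inp_lt vsP nbP inpP) hr i0 i1 (inp_nm n20 inpP) (inp_dg n20 inpP)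
  (inp_nb vsP nbP inpP) (fun u _ => nm_lt vs n20 u)
  (nm_inj vsP) (fun u v _ => @adj_lt n G vs nb n20 vsP nbP u v)
  (adj_size n20 vsP nbP) (fun u _ => @adj_uniq n G vs nb n20 vsP nbP u) (adj_irr n20 vsP nbP).
have Tt : T <= time.
  have se := encs_total (nm vs n20) (fU hF) (f0 hF) (fZ hF) (fZN hF).
  have sr : \sum_(v < N) size (flatten (ph vs nb n20 rnd v)) <= 2 * #|edges G|.
    rewrite -(sum_deg n20 vsP nbP); apply: leq_sum => v _.
    by rewrite flatten_ph (size_rows n20 vsP nbP).
  apply: leq_trans hT (leq_trans _ ht); rewrite sT.
  move: se sr N2; move: (size (encs _ _ _ _)) (\sum_(v < N) _) #|edges G| => a b m h1 h2 h3.
  have h4 : m <= maxn 1 m by rewrite leq_maxr.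
  have h5 : 1 <= maxn 1 m by rewrite leq_maxl.
  by move: (maxn 1 m) h1 h2 h3 h4 h5; clear; lia.
have [e1 e2] := hR _ Tt.
exists (outP vs n20 nds Z); split.
- exists (outL vs n20 nds Z); split=> //.
  + apply/allP => K /mapP [j jJ ->] /=.
    apply/andP; split; apply: (map_vtx_uniq n20 vsP).
    * exact: nd_lt hF _ jJ.
    * exact: nd_uniq hF _ jJ.
    * exact: mem_lt hF _.
    * exact: mem_uniq hF _.
  + split=> // i; rewrite enc_outL => il; exact: e2.
- exact: (outP_partition vsP nbP hF).
- exact: (load_2N vsP hF).
- exact: (load_out0 hF).
- move=> M0 x xV; exact: (load_f vsP hF M0 xV).
Qed.
End Alg.
End Algorithm.

(** * A Chernoff bound for sums of shared fair coins *)

Module Chernoff.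
Set Implicit Arguments.
Unset Strict Implicit.
Unset Printing Implicit Defensive.
Local Open Scope ring_scope.

Section Chernoff.
Variables (R : realType) (Q T : nat).
Hypothesis Qeven : ~~ odd Q.

Definition sgn (x : nat) : R := (-1) ^+ x.

Lemma sum_sgn : \sum_(x < Q) sgn x = 0.
Proof.
rewrite -(even_halfK Qeven); elim: Q./2 => [|q IH]; first by rewrite big_ord0.
by rewrite doubleS !big_ord_recr /= IH add0r /sgn exprS mulN1r subrr.
Qed.

(** The coins are fair and independent, so that each factor has mean 1. *)
Lemma sum_prod (a : 'I_T -> R) :
  \sum_(t : T.-tuple 'I_Q) \prod_(e < T) (1 + a e * sgn (tnth t e)) = Q%:R ^+ T.
Proof.
rewrite (reindex (@tuple_of_finfun 'I_Q T)); last first.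
  by exists (@finfun_of_tuple 'I_Q T) => t _; [exact: tuple_of_finfunK|exact: finfun_of_tupleK].
under eq_bigr => f _ do under eq_bigr => e _ do rewrite tnth_mktuple.
rewrite -(bigA_distr_bigA (fun e (x : 'I_Q) => 1 + a e * sgn x)).
rewrite (eq_bigr (fun=> Q%:R)); first by rewrite prodr_const card_ord.
move=> e _; rewrite big_split /= -mulr_sumr sum_sgn mulr0 addr0.
by rewrite sumr_const card_ord.
Qed.

Lemma expR_le_quad (y : R) : `|y| <= 2^-1 -> expR (y - 2 * y ^+ 2) <= 1 + y.
Proof.
move=> hy; have [h1 h2] : - 2^-1 <= y /\ y <= 2^-1 by apply/andP; rewrite -ler_norml.
have h3 := expR_ge1Dx (- (y - 2 * y ^+ 2)).
have p0 : 0 < 1 + - (y - 2 * y ^+ 2) by nra.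
rewrite expRN in h3.
have e0 := expR_gt0 (y - 2 * y ^+ 2).
have h4 : (1 + - (y - 2 * y ^+ 2)) * expR (y - 2 * y ^+ 2) <= 1.
  by rewrite -ler_pdivlMr // mul1r.
have h5 : 1 <= (1 + - (y - 2 * y ^+ 2)) * (1 + y).
  have y2 : 0 <= y ^+ 2 by exact: sqr_ge0.
  have -> : (1 + - (y - 2 * y ^+ 2)) * (1 + y) = 1 + y ^+ 2 * (1 + 2 * y) by ring.
  by rewrite lerDl mulr_ge0 //; lra.
by rewrite -(ler_pM2l p0); apply: le_trans h4 h5.
Qed.

(** The product of the previous lemma dominates exp (sum - 2 * V), and Markov's
    inequality applies. *)
Lemma chernoff (a : 'I_T -> R) (V theta : R) :
  (forall e, `|a e| <= 2^-1) -> \sum_e a e ^+ 2 <= V ->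
  #|[pred t : T.-tuple 'I_Q | theta <= \sum_e a e * sgn (tnth t e)]|%:R * expR (theta - 2 * V)
    <= Q%:R ^+ T :> R.
Proof.
move=> ha hV; rewrite -(sum_prod a).
set E := [pred t | _].
have s2 x : sgn x ^+ 2 = 1 by rewrite /sgn -exprM mulnC exprM sqrrN !expr1n.
have s1 x : `|sgn x| = 1 by rewrite /sgn normrX normrN1 expr1n.
have hy (t : T.-tuple 'I_Q) e : `|a e * sgn (tnth t e)| <= 2^-1 by rewrite normrM s1 mulr1.
have hp (t : T.-tuple 'I_Q) : expR (\sum_e a e * sgn (tnth t e) - 2 * V) <=
    \prod_(e < T) (1 + a e * sgn (tnth t e)).
  apply: (@le_trans _ _ (\prod_(e < T) expR (a e * sgn (tnth t e) - 2 * (a e * sgn (tnth t e)) ^+ 2))).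
    rewrite -expR_sum ler_expR big_split /= lerD2l sumrN lerN2 -mulr_sumr ler_pM2l //.
    by under eq_bigr => e _ do rewrite exprMn s2 mulr1.
  by apply: ler_prod => e _; rewrite expR_ge0 expR_le_quad.
rewrite mulr_natl -sumr_const.
apply: (@le_trans _ _ (\sum_(t in E) \prod_(e < T) (1 + a e * sgn (tnth t e)))).
  apply: ler_sum => t; rewrite inE => h; apply: le_trans (hp t).
  by rewrite ler_expR lerB.
rewrite [X in _ <= X](bigID (mem E)) /= lerDl sumr_ge0 // => t _.
by apply: le_trans (hp t); rewrite expR_ge0.
Qed.

(** Index i counts if its coin c i agrees with g i, and a coin is shared by at
    most B indices.  Up to the mean, the count is half of a combination of the
    signs of the coins with coefficients C e of size at most B, whose squares
    add up to at most B * N. *)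
Lemma count_deviation (s : seq nat) (c : nat -> 'I_T) (g : nat -> bool) (B N : nat) (tau : R) :
  (0 < B)%N -> (0 < N)%N -> (forall e, count (fun i => c i == e) s <= B)%N -> (size s <= N)%N ->
  0 < tau <= N%:R ->
  #|[pred t : T.-tuple 'I_Q | (size s)%:R / 2 + tau <= (count (fun i => odd (tnth t (c i)) == g i) s)%:R :> R]|%:R
     * expR (tau ^+ 2 / (2 * B%:R * N%:R)) <= Q%:R ^+ T :> R.
Proof.
move=> B0 N0 hc hs /andP [t0 tN].
pose S i : R := (-1) ^+ (g i).
pose C e := \sum_(i <- s | c i == e) S i.
have B0' : 0 < B%:R :> R by rewrite ltr0n.
have N0' : 0 < N%:R :> R by rewrite ltr0n.
(* The multiplier that optimizes the exponent. *)
pose l : R := tau / (2 * B%:R * N%:R).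
have l0 : 0 < l by rewrite /l divr_gt0 // !mulr_gt0.
have S1 i : `|S i| = 1 by rewrite /S normrX normrN1 expr1n.
have hC0 e : `|C e| <= (count (fun i => c i == e) s)%:R.
  rewrite /C; apply: le_trans (ler_norm_sum _ _ _) _.
  under eq_bigr => i _ do rewrite S1.
  by rewrite -sum1_count natr_sum.
have hC e : `|C e| <= B%:R by apply: le_trans (hC0 e) _; rewrite ler_nat.
have hcs : \sum_e (count (fun i => c i == e) s)%:R = (size s)%:R :> R.
  rewrite -natr_sum; congr (_ %:R); rewrite -sum1_size.
  under eq_bigr => e _ do rewrite -sum1_count.
  rewrite (exchange_big_dep xpredT) //=; apply: eq_bigr => i _.
  by rewrite (big_pred1 (c i)) // => e; rewrite /= eq_sym.
have h2 : \sum_e (l * C e) ^+ 2 <= l ^+ 2 * (B%:R * N%:R).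
  under eq_bigr => e _ do rewrite exprMn.
  rewrite -mulr_sumr ler_pM2l ?exprn_gt0 //.
  apply: (@le_trans _ _ (B%:R * (size s)%:R)); last by rewrite ler_pM2l // ler_nat.
  rewrite -hcs mulr_sumr; apply: ler_sum => e _.
  by rewrite -real_normK ?num_real // expr2; apply: ler_pM.
have h1 e : `|l * C e| <= 2^-1.
  rewrite normrM gtr0_norm //.
  apply: (@le_trans _ _ (l * B%:R)); first by rewrite ler_pM2l.
  rewrite /l [X in X <= _](_ : _ = (tau / N%:R) / 2); last by field; rewrite !gt_eqF.
  by rewrite ler_pdivrMr // mulVf // ler_pdivrMr // mul1r.
have := @chernoff _ _ (l * (2 * tau)) h1 h2.
have -> : l * (2 * tau) - 2 * (l ^+ 2 * (B%:R * N%:R)) = tau ^+ 2 / (2 * B%:R * N%:R).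
  by rewrite /l; field; rewrite !gt_eqF.
apply: le_trans; rewrite ler_pM2r ?expR_gt0 // ler_nat; apply: subset_leq_card.
apply/fintype.subsetP => t; rewrite !inE.
have -> : \sum_e l * C e * sgn (tnth t e) = l * \sum_(i <- s) S i * sgn (tnth t (c i)).
  rewrite mulr_sumr.
  under eq_bigr => e _ do rewrite /C mulr_sumr mulr_suml.
  rewrite (exchange_big_dep xpredT) //=; apply: eq_bigr => i _.
  by rewrite (big_pred1 (c i)) ?mulrA // => e; rewrite /= eq_sym.
rewrite ler_pM2l //.
have -> : (count (fun i => odd (tnth t (c i)) == g i) s)%:R =
   (size s)%:R / 2 + (\sum_(i <- s) S i * sgn (tnth t (c i))) / 2 :> R.
  elim: (s) => [|i s' IH] /=; first by rewrite big_nil; field.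
  rewrite big_cons natrD IH -[X in _ = X%:R / 2 + _]addn1 natrD.
  have -> : (odd (tnth t (c i)) == g i)%:R = 2^-1 + (S i * sgn (tnth t (c i))) / 2 :> R.
    by rewrite /S /sgn -(signr_odd _ (tnth t (c i))); case: (odd _); case: (g i); rewrite /= ?expr0 ?expr1; field.
  by field.
by rewrite lerD2l ler_pdivlMr // mulrC.
Qed.
End Chernoff.
End Chernoff.

(** * Concentration of the row sizes *)

Module Coins.
Import Tables Stream Partition Chernoff.
Set Implicit Arguments.
Unset Strict Implicit.
Unset Printing Implicit Defensive.
Local Open Scope nat_scope.

Lemma sub_in_count (T : eqType) (a1 a2 : pred T) (s : seq T) :
  {in s, forall x, a1 x -> a2 x} -> count a1 s <= count a2 s.
Proof.
elim: s => //= x s IH h; apply: leq_add; last by apply: IH => y ys; apply: h; rewrite inE ys orbT.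
by move: (h x (mem_head x s)); case: (a1 x) => // ->.
Qed.

Lemma card_sum (T : finType) (P : pred T) : #|P| = \sum_t P t.
Proof.
rewrite -sum1_card big_mkcond; apply: eq_bigr => t _.
by rewrite unfold_in; case: (P t).
Qed.

Lemma count_block (N B b : nat) : 0 < B -> count (fun i => i %/ B == b) (iota 0 N) <= B.
Proof.
move=> B0; rewrite -size_filter -[X in _ <= X](size_iota (b * B)).
apply: uniq_leq_size; first by rewrite filter_uniq ?iota_uniq.
move=> i; rewrite mem_filter !mem_iota => /andP [/eqP <- _].
by rewrite leq_divM addnC -mulSn ltn_ceil.
Qed.

(** Seen from a fixed block, distinct blocks have distinct coins. *)
Lemma pair_index_inj k a b b' : a < k -> b < k -> b' < k ->
  maxn a b * k + minn a b = maxn a b' * k + minn a b' -> b = b'.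
Proof.
move=> ak bk bk' e.
have k0 : 0 < k by apply: leq_ltn_trans ak.
have mk x : minn a x < k by rewrite gtn_min ak.
have e1 : maxn a b = maxn a b'.
  have := congr1 (divn^~ k) e.
  by rewrite /= !divnMDl // !(divn_small (mk _)) !addn0.
have e2 : minn a b = minn a b' by apply/eqP; rewrite -(eqn_add2l (maxn a b * k)) e e1.
by move: e1 e2; clear; lia.
Qed.

Section Tape.
Variables (R : realType) (N w time : nat).
Hypothesis w0 : 0 < w.
Hypothesis N0 : 0 < N.
Hypothesis kt : kf N ^ 2 <= time.
Local Notation B := (Bf N).
Local Notation tape := (time.-tuple 'I_(2 ^ w)).

Lemma B0 : 0 < B. Proof. by rewrite /Bf addn1. Qed.

Lemma block_lt i : i < N -> i %/ B < kf N.
Proof. by move=> iN; apply: Updates.blk_lt. Qed.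

Lemma time0 : 0 < time.
Proof. by apply: leq_trans kt; rewrite expn_gt0 kf_gt0. Qed.

(** The place on the tape of the coin for the blocks of v and i. *)
Definition coord (v i : nat) : 'I_time :=
  insubd (Ordinal time0) (maxn (v %/ B) (i %/ B) * kf N + minn (v %/ B) (i %/ B)).

Lemma coordE v i : v < N -> i < N ->
  coord v i = maxn (v %/ B) (i %/ B) * kf N + minn (v %/ B) (i %/ B) :> nat.
Proof.
move=> vN iN; rewrite val_insubd ifT //; apply: leq_trans kt; rewrite expnS expn1.
by apply: idx_lt; [rewrite gtn_max|rewrite gtn_min]; rewrite !block_lt.
Qed.

Lemma resp_coord (t : tape) v i : v < N -> i < N ->
  resp N (map val t) v i = (odd (tnth t (coord v i)) == (v < i)).
Proof.
move=> vN iN; rewrite /resp /coin -coordE // modn2 (tnth_nth (Ordinal (expn_gt0 2 w))).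
rewrite (nth_map (Ordinal (expn_gt0 2 w))) ?size_tuple //.
by case: odd; case: (v < i).
Qed.

(** From the point of view of v, each coin decides one block only, hence at most B
    vertices. *)
Lemma resp_deviation (v : nat) (Y : pred nat) (m : nat) (tau : R) : v < N ->
  count Y (iota 0 N) <= m -> (0 < tau <= N%:R)%R ->
  (#|[pred t : tape | m%:R / 2 + tau <= (count (fun i => [&& i %/ B != v %/ B, resp N (map val t) v i & Y i])
        (iota 0 N))%N%:R :> R]|%:R * expR (tau ^+ 2 / (2 * B%:R * N%:R)) <= (2 ^ w)%:R ^+ time :> R)%R.
Proof.
move=> vN hm ht.
pose s := [seq i <- iota 0 N | (i %/ B != v %/ B) && Y i].
have sN i : i \in s -> i < N by rewrite mem_filter mem_iota => /andP [_].
have ev : ~~ odd (2 ^ w) by rewrite oddX; case: (w) w0.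
have hc e : count (fun i => coord v i == e) s <= B.
  case: (boolP (has (fun i => coord v i == e) s)) => [/hasP [j js /eqP je]|]; last first.
    by rewrite has_count -leqNgt leqn0 => /eqP ->.
  apply: leq_trans (count_block N (j %/ B) B0).
  rewrite /s count_filter; apply: sub_in_count => i; rewrite mem_iota => iN /andP [/eqP ie _].
  apply/eqP; apply: (@pair_index_inj (kf N) (v %/ B)); rewrite ?block_lt ?(sN j) //.
  by rewrite -!coordE ?(sN j) // je ie.
have hs : size s <= N by rewrite -[X in _ <= X](size_iota 0); rewrite /s size_filter; exact: count_size.
have := @count_deviation R (2 ^ w) time ev s (coord v) (fun i => v < i) B N tau B0 N0 hc hs ht.
apply: le_trans; rewrite ler_pM2r ?expR_gt0 // ler_nat; apply: subset_leq_card.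
apply/fintype.subsetP => t; rewrite !inE => h; apply: (@le_trans _ _ (m%:R / 2 + tau)%R).
  rewrite lerD2r ler_pM2r // ler_nat; apply: leq_trans hm.
  by rewrite /s size_filter; apply: sub_count => i /andP [].
apply: le_trans h _; rewrite ler_nat count_filter.
apply: sub_in_count => i; rewrite mem_iota => iN /and3P [h1 h2 h3].
by rewrite /= h1 h3 -resp_coord // h2.
Qed.
End Tape.

Section Graph.
Variables (R : realType) (n : nat) (G : sgraph 'I_n).
Variables (vs : seq 'I_n) (nb : 'I_n -> seq 'I_n).
Hypothesis n20 : 20 <= n.
Hypothesis vsP : perm_eq vs [seq v <- enum 'I_n | 0 < degree G v].
Hypothesis nbP : forall v, perm_eq (nb v) (enum (neighbours G v)).
Variables (w time : nat).
Hypothesis w0 : 0 < w.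
Local Notation N := (Partition.N vs).
Local Notation adj := (adj vs nb n20).
Local Notation B := (Bf N).
Local Notation tape := (time.-tuple 'I_(2 ^ w)).
Hypothesis N0 : 0 < N.
Hypothesis kt : kf N ^ 2 <= time.
Variable tau : R.
Hypothesis tau_range : (0 < tau <= N%:R)%R.

Lemma count_adj v : v < N -> count (fun i => v \in adj i) (iota 0 N) = size (adj v).
Proof.
move=> vN; rewrite (eq_in_count (a2 := mem (adj v))); last first.
  by move=> i; rewrite mem_iota => iN; exact: (adj_sym n20 vsP nbP iN vN).
rewrite -size_filter; apply/perm_size/uniq_perm.
- by rewrite filter_uniq ?iota_uniq.
- exact: (adj_uniq n20 vsP nbP).
move=> i; rewrite mem_filter mem_iota /= andbC.
by case: (boolP (i \in adj v)) => [/(adj_lt vsP nbP)->|]; rewrite ?andbF.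
Qed.

Lemma count_notadj v : v < N -> count (fun i => v \notin adj i) (iota 0 N) = N - size (adj v).
Proof.
by move=> vN; rewrite -(count_adj vN) -{2}(size_iota 0 N) -(count_predC (fun i => v \in adj i) (iota 0 N)) addKn.
Qed.

Lemma zeros_le t v : v < N -> zeros vs nb n20 t v <= N - 1 - size (adj v).
Proof.
move=> vN; have h : 1 + size (adj v) = count (predU (pred1 v) (fun i => v \in adj i)) (iota 0 N).
  have e1 : count (pred1 v) (iota 0 N) = 1 by rewrite (count_uniq_mem v (iota_uniq 0 N)) mem_iota vN.
  rewrite -{1}e1 -(count_adj vN) -count_predUI.
  rewrite [X in _ + X](eq_in_count (a2 := pred0)) ?count_pred0 ?addn0 // => i _ /=.
  by apply/negbTE/negP => /andP [/eqP -> hv]; move: (adj_irr n20 vsP nbP v); rewrite hv.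
rewrite -subnDA h -[X in X - _](size_iota 0) -(count_predC (predU (pred1 v) (fun i => v \in adj i)) (iota 0 N)) addKn.
apply: sub_count => i /= /and3P [h1 _ h2].
by rewrite negb_or h2 andbT; apply: contra h1 => /eqP ->.
Qed.

Lemma onesv_le t v : v < N -> onesv vs nb n20 t v <= size (adj v).
Proof. by move=> vN; rewrite -(count_adj vN); apply: sub_count => i /and3P []. Qed.

Definition bad0 v (t : tape) :=
  ((N - size (adj v))%:R / 2 + tau <= (zeros vs nb n20 (map val t) v)%:R :> R)%R.
Definition bad1 v (t : tape) :=
  ((size (adj v))%:R / 2 + tau <= (onesv vs nb n20 (map val t) v)%:R :> R)%R.

(** Union bound over all vertices and both kinds of deviation. *)
Lemma bad_card : (#|[pred t : tape | has (fun v => bad0 v t || bad1 v t) (iota 0 N)]|%:R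
   * expR (tau ^+ 2 / (2 * B%:R * N%:R)) <= (2 * N)%:R * (2 ^ w)%:R ^+ time :> R)%R.
Proof.
set E := expR _.
have h : #|[pred t : tape | has (fun v => bad0 v t || bad1 v t) (iota 0 N)]| <=
    \sum_(v < N) (#|bad0 v| + #|bad1 v|).
  rewrite -sum1_card big_mkcond /=.
  apply: (@leq_trans (\sum_(t : tape) \sum_(v < N) ((bad0 v t : nat) + bad1 v t))).
    apply: leq_sum => t _; rewrite inE; case: ifP => // /hasP [v]; rewrite mem_iota => /= vN hv.
    rewrite (bigD1 (Ordinal vN)) //=; apply: leq_trans (leq_addr _ _).
    by move: hv; case: bad0; case: bad1.
  rewrite exchange_big /=; apply: leq_sum => v _.
  by rewrite big_split /= -!card_sum.
apply: (@le_trans _ _ ((\sum_(v < N) (#|bad0 v| + #|bad1 v|))%:R * E)%R).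
  by rewrite ler_pM2r ?expR_gt0 // ler_nat.
rewrite natr_sum mulr_suml mulnC natrM -mulrA -[X in (X%:R * _)%R]card_ord mulr_natl -sumr_const.
apply: ler_sum => v _; rewrite natrD mulrDl mulrDl mul1r; apply: lerD.
  exact: (@resp_deviation R N w time w0 N0 kt v (fun i => (v : nat) \notin adj i) _ tau
    (ltn_ord v) (eq_leq (count_notadj (ltn_ord v))) tau_range).
exact: (@resp_deviation R N w time w0 N0 kt v (fun i => (v : nat) \in adj i) _ tau
    (ltn_ord v) (eq_leq (count_adj (ltn_ord v))) tau_range).
Qed.
End Graph.
End Coins.

(** * Entropy and binomial coefficients *)

Module Entropy.
Set Implicit Arguments.
Unset Strict Implicit.
Unset Printing Implicit Defensive.
Local Open Scope ring_scope.

Section Entropy.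
Variable R : realType.

(** Binary entropy in natural units; the factors ln 2 of h2 and lg cancel in
    the bound of the theorem. *)
Definition ent (x : R) : R := - x * ln x - (1 - x) * ln (1 - x).

Lemma ln2_gt0 : 0 < ln 2 :> R.
Proof. by rewrite ln_gt0 // ltr1n. Qed.

Lemma ln2_ge : 2^-1 <= ln 2 :> R.
Proof.
have h : ln (1 + - 2^-1) <= - 2^-1 :> R by apply: le_ln1Dx; lra.
rewrite (_ : 1 + - 2^-1 = 2^-1 :> R) in h; last by field.
by rewrite lnV ?posrE // in h; lra.
Qed.

Lemma lbp_boundE (eps rho : R) n :
  lbp_bound eps rho n = (2^-1 + eps) * ent rho * (n%:R / ln n%:R).
Proof.
rewrite /lbp_bound /h2 /lg /ent.
have e : ln 2 != 0 :> R by rewrite gt_eqF // ln2_gt0.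
have [->|e'] := eqVneq (ln n%:R : R) 0; first by rewrite mul0r invr0 !mulr0.
by field; rewrite e e'.
Qed.

Section Rho.
Variable rho : R.
Hypothesis rho0 : 0 < rho.
Hypothesis rho2 : rho <= 2^-1.
Local Notation a := (- ln rho).
Local Notation b := (- ln (1 - rho)).

(** Copies the section hypotheses on rho into the local context for [lra]. *)
Ltac rlra := have ? := rho0; have ? := rho2; lra.

Lemma b_ge0 : 0 <= b.
Proof. by rewrite oppr_ge0; apply: ln_le0; rewrite gerBl ltW. Qed.

Lemma b_le_a : b <= a.
Proof. by rewrite lerN2 ler_ln ?posrE //; rlra. Qed.

Lemma ent_ge : rho / 2 <= ent rho.
Proof.
have h1 : ln 2 <= a.
  by rewrite -[2]invrK lnV ?posrE ?invr_gt0 // lerN2 ler_ln ?posrE ?invr_gt0.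
have h2 := b_ge0; have h3 := ln2_ge.
rewrite /ent; move: h1 h2; set p := ln rho; set q := ln (1 - rho) => h1 h2.
have : 0 <= (1 - rho) * (- q) by apply: mulr_ge0; rlra.
have : rho * 2^-1 <= rho * (- p) by rewrite ler_pM2l //; rlra.
rlra.
Qed.

(** One term of the binomial expansion of (1 - p + p) to the power z + o. *)
Lemma bin_prob (z o : nat) (p : R) : 0 <= p <= 1 ->
  'C(z + o, o)%:R * p ^+ o * (1 - p) ^+ z <= 1.
Proof.
move=> /andP [p0 p1].
have e1 : 1 = (1 - p + p) ^+ (z + o) by rewrite subrK expr1n.
rewrite [X in _ <= X]e1.
have oz : (o < (z + o).+1)%N by rewrite ltnS leq_addl.
rewrite [X in _ <= X]exprDn (bigD1 (Ordinal oz)) //= addnK -mulrA [p ^+ o * _]mulrC.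
rewrite ler_wpDr //; last by rewrite mulr_natl.
  by rewrite sumr_ge0 // => i _; rewrite mulrn_wge0 // mulr_ge0 // exprn_ge0 // subr_ge0.
Qed.

Lemma ln_bin (z o : nat) : ln ('C(z + o, o)%:R) <= o%:R * a + z%:R * b.
Proof.
have r1 : 0 < 1 - rho by rlra.
have := @bin_prob z o rho; rewrite (ltW rho0) (_ : rho <= 1); last rlra.
move=> /(_ isT) h.
have C0 : 0 < ('C(z + o, o))%:R :> R by rewrite ltr0n bin_gt0 leq_addl.
have : ln ('C(z + o, o)%:R * rho ^+ o * (1 - rho) ^+ z) <= 0 by exact: ln_le0.
rewrite !lnM ?posrE ?mulr_gt0 ?exprn_gt0 // !lnXn // -[ln rho *+ o]mulr_natl -[ln (1 - rho) *+ z]mulr_natl.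
by rlra.
Qed.

(** As b <= a, the bound of [ln_bin] grows with e, which may be replaced by its
    upper bound; the last summand collects the deviations. *)
Lemma ln_bin_ent (z o : nat) (m e tau : R) : 0 <= tau ->
  o%:R <= e / 2 + tau -> z%:R <= (m - e) / 2 + tau -> e <= rho * m + 1 ->
  ln ('C(z + o, o)%:R) <= 2^-1 * m * ent rho + (2 * tau + 1) * a.
Proof.
move=> t0 ho hz he; apply: le_trans (ln_bin z o) _.
have b0 := b_ge0; have ba := b_le_a.
have h1 : o%:R * a <= (e / 2 + tau) * a by rewrite ler_wpM2r //; rlra.
have h2 : z%:R * b <= ((m - e) / 2 + tau) * b by rewrite ler_wpM2r.
have h3 : e * (a - b) <= (rho * m + 1) * (a - b) by rewrite ler_wpM2r //; rlra.
have h4 : tau * b <= tau * a by rewrite ler_wpM2l.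
have h5 : 0 <= tau * b by rewrite mulr_ge0.
rewrite /ent; move: h1 h2 h3 h4 h5 b0 ba; set p := ln rho; set q := ln (1 - rho).
move=> h1 h2 h3 h4 h5 b0 ba; nra.
Qed.
End Rho.
End Entropy.
End Entropy.

(** * Estimates for large n *)

Module Estimates.
Import Tables Entropy.
Set Implicit Arguments.
Unset Strict Implicit.
Unset Printing Implicit Defensive.
Local Open Scope ring_scope.

Lemma natr_divn_le (R : realType) (a b : nat) : (0 < b)%N -> (a %/ b)%N%:R <= a%:R / b%:R :> R.
Proof. by move=> b0; rewrite ler_pdivlMr ?ltr0n // -natrM ler_nat leq_divM. Qed.

Lemma natr_divn_gt (R : realType) (a b : nat) : (0 < b)%N -> a%:R / b%:R < (a %/ b)%N%:R + 1 :> R.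
Proof.
by move=> b0; rewrite ltr_pdivrMr ?ltr0n // natr1 -natrM ltr_nat ltn_ceil.
Qed.

Section Large.
Variables (R : realType) (n N D : nat) (rho y eta : R).
Local Notation L := (ln n%:R : R).
Local Notation k := (kf N).
Local Notation ell := (ellf N).
Local Notation B := (Bf N).
Local Notation X := (Xf N D).
Local Notation M := (Mf N D).

(** y is the small power n^eta of n; it dominates ln n and 1 / rho, and all error
    terms below are compared with n / y^3.  The power 100 leaves room for every
    exponent that occurs. *)
Definition large := [/\ 100 <= y, 2 <= L, L <= y, y ^+ 100 <= n%:R & ln y = eta * L]
  /\ [/\ 0 < eta, 68 * eta <= 1, y^-1 <= rho & rho <= 2^-1].

Hypothesis hl : large.
Hypothesis Nn : (N <= n)%N.
Hypothesis NL : rho * n%:R / L ^+ 2 < N%:R.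
Hypothesis Dr : D%:R <= rho * n%:R.

Lemma y100 : 100 <= y. Proof. by case: hl => [[]]. Qed.
Lemma L2 : 2 <= L. Proof. by case: hl => [[]]. Qed.
Lemma Ly : L <= y. Proof. by case: hl => [[]]. Qed.
Lemma yn : y ^+ 100 <= n%:R. Proof. by case: hl => [[]]. Qed.
Lemma lny : ln y = eta * L. Proof. by case: hl => [[]]. Qed.
Lemma eta0 : 0 < eta. Proof. by case: hl => _ []. Qed.
Lemma eta68 : 68 * eta <= 1. Proof. by case: hl => _ []. Qed.
Lemma rhoy : y^-1 <= rho. Proof. by case: hl => _ []. Qed.
Lemma rho2 : rho <= 2^-1. Proof. by case: hl => _ []. Qed.
Lemma y0 : 0 < y. Proof. by have := y100; lra. Qed.
Lemma y_ge0 : 0 <= y. Proof. exact: ltW y0. Qed.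
Lemma y1 : 1 <= y. Proof. by have := y100; lra. Qed.
Lemma L0 : 0 < L. Proof. by have := L2; lra. Qed.
Lemma rho0 : 0 < rho. Proof. by apply: lt_le_trans rhoy; rewrite invr_gt0 y0. Qed.
Lemma n0 : 0 < n%:R :> R. Proof. by apply: lt_le_trans yn; rewrite exprn_gt0 ?y0. Qed.

Lemma yX a b : (a <= b)%N -> y ^+ a <= y ^+ b.
Proof. by apply: ler_weXn2l; exact: y1. Qed.

Lemma y_n (a b : nat) : (a + b <= 100)%N -> y ^+ a <= n%:R / y ^+ b.
Proof.
move=> h; rewrite ler_pdivlMr ?exprn_gt0 ?y0 // -exprD.
by apply: le_trans (yX h) yn.
Qed.

Lemma n_y (a b : nat) : (b <= a)%N -> n%:R / y ^+ a <= n%:R / y ^+ b.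
Proof. by move=> h; rewrite ler_pM2l ?n0 // lef_pV2 ?posrE ?exprn_gt0 ?y0 // yX. Qed.

(** Error terms n / y^3 are negligible even after division by (ln n)^2. *)
Lemma n_rho : n%:R / y ^+ 3 <= rho * n%:R / L ^+ 2.
Proof.
rewrite ler_pdivrMr ?exprn_gt0 ?y0 // mulrAC ler_pdivlMr ?exprn_gt0 ?L0 // [_ * n%:R]mulrC -mulrA ler_pM2l ?n0 //.
have h1 : L ^+ 2 <= y ^+ 2 by rewrite lerXn2r ?nnegrE ?Ly // ltW ?L0 ?y0.
apply: le_trans h1 _; rewrite [y ^+ 3]exprS mulrA ler_peMl ?exprn_ge0 ?y_ge0 //.
by rewrite -ler_pdivrMr ?y0 // mul1r rhoy.
Qed.

Lemma N_ge : n%:R / y ^+ 3 <= N%:R.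
Proof. exact: le_trans n_rho (ltW NL). Qed.

Lemma N0 : (0 < N)%N.
Proof. by rewrite -(ltr0n R); apply: lt_le_trans N_ge; rewrite divr_gt0 ?n0 ?exprn_gt0 ?y0. Qed.

(** Otherwise the eighth power of the number of blocks would not exceed N. *)
Lemma k_ge : y ^+ 12 <= k%:R.
Proof.
rewrite leNgt; apply/negP => h.
have h1 : k%:R ^+ 8 <= (y ^+ 12) ^+ 8 by rewrite lerXn2r ?nnegrE ?exprn_ge0 ?y_ge0 // ltW.
have h2 : N%:R < k%:R ^+ 8 :> R by rewrite -natrX ltr_nat ltn_kf.
have := lt_le_trans h2 (le_trans h1 _); rewrite -exprM => /(_ (n%:R / y ^+ 3) (y_n _)).
by move/(_ isT); rewrite ltNge N_ge.
Qed.

Lemma k_le : k%:R <= n%:R / y ^+ 3.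
Proof.
rewrite -(@ler_pXn2r _ 2) ?nnegrE ?divr_ge0 ?exprn_ge0 ?(ltW y0) ?(ltW n0) //.
have h1 : k%:R ^+ 2 <= 5 * n%:R :> R.
  rewrite -natrX -natrM ler_nat; apply: leq_trans (kf_le4 N) _.
  by move: Nn N0; clear; lia.
apply: le_trans h1 _; rewrite (_ : (n%:R / y ^+ 3) ^+ 2 = n%:R * (n%:R / y ^+ 6)).
  rewrite [5 * _]mulrC ler_pM2l ?n0 //; apply: le_trans (y_n (a := 1) (b := 6) isT).
  by have := y100; rewrite expr1; lra.
by field; rewrite gt_eqF ?y0.
Qed.

Lemma one_le : 1 <= n%:R / y ^+ 3.
Proof. by apply: le_trans (y_n (a := 0) (b := 3) isT); rewrite expr0. Qed.

Lemma Nk_le : N%:R / k%:R <= n%:R / y ^+ 12.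
Proof.
rewrite ler_pM ?invr_ge0 // ?ler_nat // lef_pV2 ?posrE ?exprn_gt0 ?y0 ?k_ge //.
by rewrite ltr0n kf_gt0.
Qed.

Lemma B_le : B%:R <= 2 * (n%:R / y ^+ 3).
Proof.
rewrite /Bf natrD; have h1 := natr_divn_le R N (kf_gt0 N).
have h2 := Nk_le; have h3 := n_y (a := 12) (b := 3) isT; have h4 := one_le; lra.
Qed.

Lemma B_le2 : B%:R <= 2 * N%:R / k%:R :> R.
Proof.
rewrite /Bf natrD; have h1 := natr_divn_le R N (kf_gt0 N).
have h2 : 1 <= N%:R / k%:R :> R.
  by rewrite ler_pdivlMr ?ltr0n ?kf_gt0 // mul1r; apply: le_trans k_le N_ge.
by rewrite -mulrA; lra.
Qed.

Lemma NB_le : (N %/ B)%N%:R <= n%:R / y ^+ 3.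
Proof.
apply: le_trans k_le; rewrite ler_nat ltnW // ltn_divLR /Bf ?addn1 // mulnC.
by rewrite ltn_ceil ?kf_gt0.
Qed.

Lemma lnN_ge : 2^-1 * L <= ln N%:R.
Proof.
have h : ln (n%:R / y ^+ 3) <= ln N%:R :> R.
  by rewrite ler_ln ?posrE ?ltr0n ?N0 ?N_ge // divr_gt0 ?n0 ?exprn_gt0 ?y0.
apply: le_trans h; rewrite lnM ?posrE ?invr_gt0 ?exprn_gt0 ?y0 ?n0 // lnV ?posrE ?exprn_gt0 ?y0 //.
rewrite lnXn ?y0 // -[ln y *+ _]mulr_natl lny.
have := eta68; have := L0 => hL he.
have : 68 * eta * L <= 1 * L by rewrite ler_pM2r.
lra.
Qed.

Lemma ell_ge : 2^-1 * L <= ell%:R.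
Proof.
apply: le_trans lnN_ge _.
have : ln N%:R <= ln ((2 : R) ^+ ell).
  by rewrite ler_ln ?posrE ?ltr0n ?N0 ?exprn_gt0 // -natrX ler_nat ltnW // ltn_ellf.
rewrite lnXn // -[ln 2 *+ _]mulr_natl => h; apply: le_trans h _.
rewrite ler_piMr //; have := @le_ln1Dx R 1; rewrite (_ : 1 + 1 = 2) // => -> //; lra.
Qed.

Lemma ell_le : ell%:R <= 3 * y.
Proof.
have [-> |e0] := posnP ell; first by have := y0; lra.
have h1 : (2 ^ ell.-1 <= N)%N.
  rewrite leqNgt; apply/negP => h; move: h; rewrite /ellf in e0 *.
  by case: ex_minnP e0 => m _ hm m0 /hm; rewrite leqNgt ltn_predL m0.
have : ln ((2 : R) ^+ ell.-1) <= L.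
  by rewrite ler_ln ?posrE ?exprn_gt0 ?n0 // -natrX ler_nat (leq_trans h1).
rewrite lnXn // -[ln 2 *+ _]mulr_natl => h2.
have h3 : ell.-1%:R * 2^-1 <= ell.-1%:R * ln 2 :> R by rewrite ler_wpM2l ?ln2_ge.
have h4 := Ly; have h5 := y100; rewrite -(prednK e0) -natr1; lra.
Qed.

Lemma X_gt0 : (0 < X)%N. Proof. exact: Xf_gt0. Qed.

(** Either X is the number of blocks, or X >= N * ell^2 / (D + 1) and D is at most
    rho * n. *)
Lemma NX_le : (N %/ X)%N%:R <= 2 * (n%:R / y ^+ 3) + 4 * (rho * n%:R / L ^+ 2).
Proof.
apply: le_trans (natr_divn_le R N X_gt0) _.
have r0 := rho0; have hn := n0; have hL := L0.
have p1 : 0 < rho * n%:R / L ^+ 2 by rewrite divr_gt0 ?mulr_gt0 ?exprn_gt0.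
have o1 := one_le.
case: (leqP k (N * ell ^ 2 %/ (D + 1) + 1)) => h.
  have -> : X = k by rewrite /Xf (minn_idPr h).
  have := Nk_le; have := n_y (a := 12) (b := 3) isT; lra.
have eX : X = (N * ell ^ 2 %/ (D + 1) + 1)%N by rewrite /Xf; apply/minn_idPl/ltnW.
have e0 : 0 < ell%:R :> R by apply: lt_le_trans ell_ge; rewrite mulr_gt0.
have h1 : N%:R * ell%:R ^+ 2 / (D%:R + 1) <= X%:R :> R.
  rewrite eX natrD; have := @natr_divn_gt R (N * ell ^ 2) (D + 1).
  by rewrite addn1 natrM natrX -natr1 => /(_ isT) /ltW.
have D1 : 0 < D%:R + 1 :> R by rewrite natr1 ltr0n.
have h2 : N%:R / X%:R <= (D%:R + 1) / ell%:R ^+ 2 :> R.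
  rewrite ler_pdivrMr ?ltr0n ?X_gt0 // mulrAC ler_pdivlMr ?exprn_gt0 //.
  by rewrite ler_pdivrMr // in h1; rewrite [X in _ <= X]mulrC.
apply: le_trans h2 _.
have h3 : (ell%:R ^+ 2)^-1 <= 4 / L ^+ 2 :> R.
  rewrite -[4]invrK -invfM lef_pV2 ?posrE ?exprn_gt0 ?mulr_gt0 ?exprn_gt0 ?invr_gt0 //.
  rewrite (_ : 4^-1 * L ^+ 2 = (2^-1 * L) ^+ 2); last by field.
  by rewrite lerXn2r ?nnegrE ?ell_ge // ltW // mulr_gt0.
have h4 : (D%:R + 1) / ell%:R ^+ 2 <= (rho * n%:R + 1) * (4 / L ^+ 2).
  apply: ler_pM; [exact: ltW|by rewrite invr_ge0 exprn_ge0|by have := Dr; lra|exact: h3].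
apply: le_trans h4 _; rewrite mulrDl mul1r.
have h5 : 4 / L ^+ 2 <= 1 by rewrite ler_pdivrMr ?exprn_gt0 // mul1r; have := L2; nra.
have -> : rho * n%:R * (4 / L ^+ 2) = 4 * (rho * n%:R / L ^+ 2) by ring.
lra.
Qed.

Lemma XM_le : (X * X * X * M <= N %/ X)%N.
Proof.
rewrite leq_divRL ?X_gt0 //; apply: leq_trans (leq_divM N (X ^ 4)).
by rewrite /Mf !expnS expn0; nia.
Qed.

Lemma overhead : (X * X * X * M + (N %/ X + N %/ B + B + 2))%N%:R <=
  9 * (n%:R / y ^+ 3) + 8 * (rho * n%:R / L ^+ 2).
Proof.
have h1 : (X * X * X * M)%N%:R <= (N %/ X)%N%:R :> R by rewrite ler_nat XM_le.
have := B_le; have := NB_le; move: (Bf N) => b; rewrite !natrD.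
have := NX_le; have := one_le; lra.
Qed.

Section Phrases.
Variables f z o : nat.
Hypothesis fM : (M ^ f <= X ^ f * 'C(z + o, o))%N.
Local Notation E := (ent rho).

Lemma entE : rho / 2 <= E.
Proof. exact: (ent_ge rho0 rho2). Qed.

Lemma ln_rho : - ln rho <= L.
Proof.
rewrite -lnV ?posrE ?rho0 // ler_ln ?posrE ?invr_gt0 ?rho0 ?n0 //.
rewrite -[_%:R]invrK lef_pV2 ?posrE ?invr_gt0 ?rho0 ?n0 //; apply: le_trans rhoy.
rewrite lef_pV2 ?posrE ?n0 ?y0 //; have := y_n (a := 1) (b := 0) isT.
by rewrite expr0 divr1 expr1.
Qed.

(** The base of the exponential estimate for the number of phrases is
    n^(1 - 34 * eta). *)
Lemma M_ge : X%:R <= y ^+ 6 -> n%:R / y ^+ 34 * X%:R <= M%:R.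
Proof.
move=> hX; have X0 : 0 < X%:R :> R by rewrite ltr0n X_gt0.
have := @natr_divn_gt R N (X ^ 4); rewrite expn_gt0 X_gt0 -/(Mf N D) natrX => /(_ isT) h1.
have h2 : N%:R / y ^+ 24 <= N%:R / X%:R ^+ 4.
  rewrite ler_pM2l ?ltr0n ?N0 // lef_pV2 ?posrE ?exprn_gt0 ?y0 //.
  have -> : y ^+ 24 = (y ^+ 6) ^+ 4 by rewrite -exprM.
  by rewrite lerXn2r ?nnegrE ?exprn_ge0 ?y_ge0.
have h3 : n%:R / y ^+ 27 <= N%:R / y ^+ 24.
  rewrite (_ : 27%N = (3 + 24)%N) // exprD invfM mulrA.
  by rewrite ler_pM2r ?invr_gt0 ?exprn_gt0 ?y0 ?N_ge.
have h4 : y ^+ 1 <= n%:R / y ^+ 27 by exact: y_n.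
have h5 : n%:R / y ^+ 34 * X%:R <= n%:R / y ^+ 28.
  apply: le_trans (_ : n%:R / y ^+ 34 * y ^+ 6 <= _).
    by rewrite ler_pM2l // divr_gt0 ?n0 ?exprn_gt0 ?y0.
  by rewrite le_eqVlt; apply/orP; left; apply/eqP; field; rewrite gt_eqF ?y0.
have h6 : n%:R / y ^+ 28 * 100 <= n%:R / y ^+ 27.
  apply: le_trans (_ : n%:R / y ^+ 28 * y <= _).
    by rewrite ler_pM2l ?y100 // divr_gt0 ?n0 ?exprn_gt0 ?y0.
  by rewrite le_eqVlt; apply/orP; left; apply/eqP; field; rewrite gt_eqF ?y0.
have := y100; rewrite expr1 in h4; lra.
Qed.

(** Taking logarithms, f * (1 - 34 * eta) * ln n is at most the logarithm of the
    binomial coefficient; e is the degree or the codegree of the vertex. *)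
Lemma f_small (e tau : R) : X%:R <= y ^+ 6 -> 0 <= tau <= n%:R / y ^+ 3 ->
  o%:R <= e / 2 + tau -> z%:R <= (n%:R - e) / 2 + tau -> e <= rho * n%:R + 1 ->
  f%:R <= (2^-1 + 34 * eta) * (E * n%:R / L) + 6 * (n%:R / y ^+ 3).
Proof.
move=> hX /andP [t0 tn] ho hz he.
have X0 : 0 < X%:R :> R by rewrite ltr0n X_gt0.
have C0 : (0 < 'C(z + o, o))%N by rewrite bin_gt0 leq_addl.
have h1 := ln_bin_ent rho0 rho2 t0 ho hz he.
have ny : 0 < n%:R / y ^+ 34 by rewrite divr_gt0 ?n0 ?exprn_gt0 ?y0.
have h2 : (n%:R / y ^+ 34) ^+ f <= 'C(z + o, o)%:R.
  rewrite -(@ler_pM2r _ (X%:R ^+ f)) ?exprn_gt0 // -exprMn.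
  apply: (@le_trans _ _ (M%:R ^+ f)).
    by rewrite lerXn2r ?nnegrE ?ler0n ?M_ge // mulr_ge0 // ltW.
  by rewrite -!natrX -natrM ler_nat mulnC.
have h3 : f%:R * ((1 - 34 * eta) * L) <= ln ('C(z + o, o)%:R).
  have : ln ((n%:R / y ^+ 34) ^+ f) <= ln ('C(z + o, o)%:R) by rewrite ler_ln ?posrE ?exprn_gt0 ?ltr0n.
  rewrite lnXn // -[ln _ *+ f]mulr_natl lnM ?posrE ?invr_gt0 ?exprn_gt0 ?y0 ?n0 //.
  rewrite lnV ?posrE ?exprn_gt0 ?y0 // lnXn ?y0 // -[ln y *+ _]mulr_natl lny.
  by rewrite (_ : L + - (34%:R * (eta * L)) = (1 - 34 * eta) * L) //; ring.
have h4 : (2 * tau + 1) * - ln rho <= 3 * (n%:R / y ^+ 3) * L.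
  apply: (@le_trans _ _ ((2 * tau + 1) * L)).
    by rewrite ler_wpM2l ?ln_rho //; lra.
  by rewrite ler_pM2r ?L0 //; have := one_le; lra.
have e0 := eta0; have e68 := eta68; have hL := L0.
set w := n%:R / y ^+ 3 in h4 *; set P := E * n%:R / L.
have eP : 2^-1 * n%:R * E = 2^-1 * P * L by rewrite /P; field; rewrite gt_eqF.
have h5 : f%:R * (1 - 34 * eta) <= 2^-1 * P + 3 * w.
  rewrite -(ler_pM2r hL); rewrite eP in h1.
  by rewrite -mulrA [X in _ <= X]mulrDl; apply: le_trans h3 (le_trans h1 _); rewrite lerD2l.
have P0 : 0 <= 2^-1 * P + 3 * w.
  by apply: le_trans h5; rewrite mulr_ge0 //; lra.
have h6 : 1 <= (1 - 34 * eta) * (1 + 68 * eta).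
  rewrite (_ : (1 - 34 * eta) * (1 + 68 * eta) = 1 + 34 * eta * (1 - 68 * eta)); last by ring.
  by rewrite lerDl mulr_ge0 //; lra.
have h7 : f%:R <= (1 + 68 * eta) * (2^-1 * P + 3 * w).
  apply: (@le_trans _ _ (f%:R * ((1 - 34 * eta) * (1 + 68 * eta)))).
    by rewrite ler_peMr.
  by rewrite mulrA mulrC ler_wpM2l //; lra.
have w0 : 0 <= w by rewrite divr_ge0 ?ltW ?exprn_gt0 ?n0 ?y0.
have h8 : 68 * eta * w <= 1 * w by rewrite ler_wpM2r.
have -> : (2^-1 + 34 * eta) * P = (1 + 68 * eta) * (2^-1 * P) by field.
apply: le_trans h7 _; rewrite mulrDr lerD2l mulrDl; lra.
Qed.

(** A large span bound means that D + 1 is at most about N * ell^2 / X. *)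
Lemma D_small : y ^+ 6 < X%:R -> D%:R <= n%:R / y ^+ 3.
Proof.
move=> hX; have X0 := X_gt0.
have h1 : (X.-1 * (D + 1) <= N * ell ^ 2)%N.
  apply: leq_trans (leq_divM _ (D + 1)); rewrite leq_mul2r; apply/orP; right.
  by rewrite -ltnS (prednK X0) /Xf geq_min addn1 leqnn.
have h2 : y ^+ 6 - 1 <= X.-1%:R by move: hX; rewrite -{1}(prednK X0) -natr1; lra.
have h3 : ell%:R ^+ 2 <= 9 * y ^+ 2.
  by rewrite (_ : 9 * y ^+ 2 = (3 * y) ^+ 2) ?lerXn2r ?nnegrE ?ell_le ?mulr_ge0 ?y_ge0 //; ring.
have h4 : (y ^+ 6 - 1) * D%:R <= n%:R * (9 * y ^+ 2).
  apply: (@le_trans _ _ (X.-1%:R * (D + 1)%N%:R)).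
    have : 1 <= y ^+ 6 by rewrite exprn_ege1 ?y1.
    by move=> h; apply: ler_pM; rewrite ?h2 ?ler_nat ?leq_addr //; lra.
  apply: (@le_trans _ _ (N * ell ^ 2)%N%:R); first by rewrite -natrM ler_nat.
  by rewrite natrM natrX ler_pM ?exprn_ge0 // ler_nat.
have h5 : 18 * y ^+ 5 <= y ^+ 6 - 1.
  have -> : y ^+ 6 = y * y ^+ 5 by rewrite -exprS.
  have : 100 * y ^+ 5 <= y * y ^+ 5 by rewrite ler_pM2r ?y100 ?exprn_gt0 ?y0.
  have : 1 <= y ^+ 5 by rewrite exprn_ege1 ?y1.
  lra.
rewrite ler_pdivlMr ?exprn_gt0 ?y0 //.
have h6 : 18 * y ^+ 5 * D%:R <= n%:R * (9 * y ^+ 2) by apply: le_trans h4; rewrite ler_wpM2r.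
have e5 : 18 * y ^+ 5 * D%:R = (D%:R * y ^+ 3) * (18 * y ^+ 2) by ring.
rewrite -(@ler_pM2r _ (18 * y ^+ 2)) ?mulr_gt0 ?exprn_gt0 ?y0 // -e5.
apply: le_trans h6 _; rewrite ler_pM2l ?n0 // ler_pM2r ?exprn_gt0 ?y0 //; lra.
Qed.
End Phrases.

End Large.
End Estimates.

(** * The load bound for fixed n *)

Module LoadBound.
Import Tables Stream Program Partition Algorithm Coins Entropy Estimates.
Set Implicit Arguments.
Unset Strict Implicit.
Unset Printing Implicit Defensive.
Local Open Scope ring_scope.

Section FixedSize.
Variables (R : realType) (n : nat) (G : sgraph 'I_n) (rho y eta : R).
Variables (vs : seq 'I_n) (nb : 'I_n -> seq 'I_n) (inp : seq nat).
Hypothesis n20 : (20 <= n)%N.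
Hypothesis vsP : perm_eq vs [seq v <- enum 'I_n | (0 < degree G v)%N].
Hypothesis nbP : forall v, perm_eq (nb v) (enum (neighbours G v)).
Hypothesis inpP : inp = [:: n, size vs & flatten
  [seq [:: val v, size (nb v) & [seq val u | u <- nb v]] | v <- vs]].
Hypothesis hl : large n rho y eta.
Hypothesis hd : degree_cond G rho.
Local Notation L := (ln n%:R : R).
Local Notation N := (Partition.N vs).
Local Notation adj := (adj vs nb n20).
Local Notation D := (Prepass.maxmin N adj N).
Local Notation B := (Bf N).
Local Notation X := (Xf N D).
Local Notation M := (Mf N D).
Local Notation w := (word_size 6 n).

(** The + 1 accounts for the vertex itself, which is no neighbour. *)
Lemma degree_cases v : (v < N)%N ->
  (size (adj v))%:R <= rho * n%:R \/ n%:R - (size (adj v))%:R <= rho * n%:R + 1.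
Proof.
move=> vN; rewrite (adj_degree n20 nbP vN).
have /forallP/(_ (vtx vs n20 v)) := hd.
set d := degree _ _ => hm.
have n1 : 0 < n.-1%:R :> R by rewrite ltr0n; move: n20; clear; lia.
have r0 := rho0 hl.
have rn : rho * n.-1%:R <= rho * n%:R by rewrite ler_pM2l // ler_nat leq_pred.
move: hm; rewrite ge_min => /orP [h|h]; [left|right].
  by rewrite ler_pdivrMr // in h; apply: le_trans h rn.
have : n.-1%:R - d%:R <= rho * n.-1%:R.
  by rewrite -(ler_pM2r n1) mulrBl mul1r divfK ?gt_eqF // in h.
rewrite -[in n%:R - _](@prednK n) ?(leq_trans _ n20) // -natr1; lra.
Qed.

Lemma min_le_D v : (v < N)%N -> (minn (size (adj v)) (N - 1 - size (adj v)) <= D)%N.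
Proof.
move=> vN; rewrite /Prepass.maxmin.
exact: (@leq_bigmax_cond _ xpredT (fun i : 'I_N => minn (size (adj i)) (N - 1 - size (adj i))) (Ordinal vN)).
Qed.

Lemma D_le : D%:R <= rho * n%:R.
Proof.
have rn : 0 <= rho * n%:R by rewrite mulr_ge0 ?ltW ?(rho0 hl) ?(n0 hl).
rewrite /Prepass.maxmin; elim/big_ind: _ => [//|a b ha hb|i _]; first by rewrite natr_max ge_max ha.
have iN := ltn_ord i; case: (degree_cases iN) => h.
  by apply: le_trans h; rewrite ler_nat geq_minl.
have Nn := Nn vsP.
apply: (@le_trans _ _ (N - 1 - size (adj i))%N%:R); first by rewrite ler_nat geq_minr.
have [le|gt] := leqP (size (adj i)) (N - 1); last first.
  by rewrite (eqP (_ : (N - 1 - size (adj i) == 0)%N)) // subn_eq0 ltnW.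
rewrite natrB // natrB ?(leq_ltn_trans _ iN) //.
have : N%:R <= n%:R :> R by rewrite ler_nat.
lra.
Qed.

(** What is required of the tape: the rows have at most their expected numbers of
    neighbours and of skipped non-neighbours, up to tau. *)
Definition good (tau : R) (t : seq nat) := forall v, (v < N)%N ->
  (zeros vs nb n20 t v)%:R <= (N - size (adj v))%N%:R / 2 + tau /\
  (onesv vs nb n20 t v)%:R <= (size (adj v))%:R / 2 + tau.

(** The quantity that the load is compared with, without the constant. *)
Local Notation P := (ent rho * n%:R / L).

Lemma P_ge : rho * n%:R / L ^+ 2 <= 2 * P / L.
Proof.
have hL := L0 hl; have -> : 2 * P / L = 2 * ent rho * n%:R / L ^+ 2 by field; rewrite gt_eqF.
by rewrite ler_pM2r ?invr_gt0 ?exprn_gt0 // ler_pM2r ?(n0 hl) //; have := entE hl; lra.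
Qed.

Lemma P_gt0 : 0 < P.
Proof.
rewrite divr_gt0 ?mulr_gt0 ?(L0 hl) ?(n0 hl) //.
by have := entE hl; have := rho0 hl; lra.
Qed.

(** If N is small, then every tape gives a load of at most 2 * N.  Otherwise the
    load is the overhead plus the number f of phrases closed because of M, and f is
    bounded by entropy if X is at most y^6 and by D if not. *)
Lemma load_bound tau (rnd : seq nat) time : all (fun x => x < 2 ^ w)%N rnd ->
  (170 * 100 * maxn 1 #|edges G| <= time)%N ->
  0 <= tau <= n%:R / y ^+ 3 ->
  (rho * n%:R / L ^+ 2 < N%:R -> good tau rnd) ->
  exists Q, [/\ outputs_bicliques (run w prog inp rnd time) Q, biclique_partition G Q &
    forall x, (load Q x)%:R <= (2^-1 + 34 * eta + 46 / L) * P].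
Proof.
move=> hr ht htau hgood.
have [Q [h1 h2 h3 h4 h5]] := algorithm n20 vsP nbP inpP hr ht.
exists Q; split=> // x; have hL := L0 hl; have p0 := P_gt0; have pg := P_ge.
have e0 := eta0 hl.
have c0 : 0 <= 46 / L by rewrite divr_ge0 // ltW.
have eP : 46 / L * P = 23 * (2 * P / L) by field; rewrite gt_eqF.
have eQ : (2^-1 + 34 * eta + 46 / L) * P = (2^-1 + 34 * eta) * P + 23 * (2 * P / L).
  by rewrite -eP -mulrDl.
have q0 : 0 < 2 * P / L by apply: divr_gt0 => //; apply: mulr_gt0.
have g0 : 0 <= (2^-1 + 34 * eta) * P by apply: mulr_ge0; [lra|exact: ltW].
case: (leP N%:R (rho * n%:R / L ^+ 2)) => hN.
  apply: (@le_trans _ _ (2 * N)%N%:R); first by rewrite ler_nat.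
  by rewrite eQ natrM; lra.
case: (boolP (x \in vs)) => xV; last by rewrite h4 // eQ; lra.
have {}hgood := hgood hN; have Nn := Nn vsP; have hD := D_le.
have iN : (index x vs < N)%N by rewrite index_mem.
have M0 : (0 < M)%N.
  rewrite /Mf divn_gt0 ?expn_gt0 ?Xf_gt0 //.
  apply: (@leq_trans (kf N ^ 4)); first by rewrite leq_exp2r // /Xf geq_minr.
  have N257 : (257 <= N)%N.
    rewrite -(ler_nat R); apply: le_trans (N_ge hl hN).
    apply: le_trans (y_n hl (a := 2) (b := 3) isT).
    have := y100 hl => hy; rewrite expr2; nra.
  have k8 := kf8 N.
  by rewrite -(@leq_exp2r _ _ 2) // -expnM; apply: leq_trans k8 _; move: N257; clear; nia.
have [f [f1 f2 f3 f4]] := h5 M0 x xV.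
have [gz go] := hgood _ iN.
clear h1 h2 h3 h4 h5 hr ht hgood M0.
set v := index x vs in f2 f3 f4 gz go iN.
have ov := overhead hl Nn hN hD.
have nr := n_rho hl.
apply: (@le_trans _ _ ((X * X * X * M + (N %/ X + N %/ B + B + 2))%N%:R + f%:R)).
  by rewrite -natrD ler_nat; apply: leq_trans f1 _; move: (X * X * X * M)%N (N %/ X)%N (N %/ B)%N (Bf N) => a b c d; clear; lia.
suff hf : f%:R <= (2^-1 + 34 * eta) * P + 6 * (n%:R / y ^+ 3).
  by rewrite eQ; clear f1 f2 f3 f4 gz go htau g0 c0 e0; lra.
case: (leP X%:R (y ^+ 6)) => hX; last first.
  have hDs := D_small hl Nn hX.
  apply: (@le_trans _ _ D%:R); last by clear f1 f2 f3 f4 gz go htau; have := one_le hl; lra.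
  rewrite ler_nat; apply: leq_trans (min_le_D iN); rewrite leq_min.
  rewrite (leq_trans f4 (onesv_le n20 vsP nbP rnd iN)).
  by rewrite (leq_trans f3 (zeros_le n20 vsP nbP rnd iN)).
have sN : (size (adj v) <= N)%N by rewrite ltnW // (adj_size n20 vsP nbP).
rewrite natrB // in gz.
have Nr : N%:R <= n%:R :> R by rewrite ler_nat.
have rn : 0 < rho * n%:R by rewrite mulr_gt0 ?(rho0 hl) ?(n0 hl).
case: (degree_cases iN) => hdeg.
  by apply: (f_small hl hN f2 hX htau go); lra.
(* For high degree the roles of neighbours and non-neighbours are exchanged. *)
have f2' : (M ^ f <= X ^ f * 'C(onesv vs nb n20 rnd v + zeros vs nb n20 rnd v, zeros vs nb n20 rnd v))%N.
  by rewrite -bin_sub ?leq_addl // addnK addnC.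
by apply: (f_small hl hN f2' hX htau (e := n%:R - (size (adj v))%:R)); clear hX f2 f2' htau; lra.
Qed.

Lemma prob_bound time : time = (170 * 100 * maxn 1 #|edges G|)%N ->
  1 - n%:R^-1 <= prob R (fun rnd : time.-tuple 'I_(2 ^ w) =>
    exists Q, [/\ outputs_bicliques (run w prog inp (map val rnd) time) Q, biclique_partition G Q &
    forall x, (load Q x)%:R <= (2^-1 + 34 * eta + 46 / L) * P]).
Proof.
move=> htime.
have hr (t : time.-tuple 'I_(2 ^ w)) : all (fun x => x < 2 ^ w)%N (map val t).
  by apply/allP => x /mapP [z _ ->]; exact: ltn_ord.
have ht : (170 * 100 * maxn 1 #|edges G| <= time)%N by rewrite htime.
have n1 : 0 < n%:R^-1 :> R by rewrite invr_gt0 (n0 hl).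
set E := fun _ => _.
have T0 : 0 < #|{: time.-tuple 'I_(2 ^ w)}|%:R :> R by rewrite card_tuple card_ord natrX exprn_gt0 // ltr0n expn_gt0.
have hy := y0 hl.
have ny : 0 <= n%:R / y ^+ 3 by rewrite divr_ge0 ?exprn_ge0 ?(ltW hy).
rewrite /prob ler_pdivlMr //.
case: (leP N%:R (rho * n%:R / L ^+ 2)) => hN.
  have -> : #|[pred t | `[< E t >]]| = #|{: time.-tuple 'I_(2 ^ w)}|.
    apply: eq_card => t; rewrite !inE; apply/asboolP.
    by apply: (@load_bound 0 (map val t) time) => //; rewrite ?lexx // ltNge hN.
  by rewrite ler_piMl ?ltW //; lra.
have Nn := Nn vsP; have N0 := N0 hl hN; have Nr : 0 < N%:R :> R by rewrite ltr0n.
(* This deviation is negligible against rho * n / ln n, and yet its square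
   divided by 2 * B * N is at least y^6 / 4, which exceeds 3 * ln n. *)
pose tau : R := N%:R / y ^+ 3.
have t0 : 0 < tau by rewrite divr_gt0 ?exprn_gt0.
have y31 : 1 <= y ^+ 3 by rewrite exprn_ege1 // (y1 hl).
have tN : tau <= N%:R by rewrite ler_pdivrMr ?exprn_gt0 // ler_peMr // ltW.
have tn : tau <= n%:R / y ^+ 3 by rewrite ler_pM2r ?invr_gt0 ?exprn_gt0 // ler_nat.
have kt : (kf N ^ 2 <= time)%N.
  apply: leq_trans (kf_le4 N) _; rewrite htime.
  have := N_le n20 vsP nbP; rewrite -/N; move: N #|edges G| => a m; clear; lia.
have w0 : (0 < w)%N by [].
have tr : (0 < tau <= N%:R) by rewrite t0.
have := bad_card n20 vsP nbP w0 N0 kt tr.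
set bad := [pred t | _]; set e := expR _ => hb.
have Tc : (2 ^ w)%:R ^+ time = #|{: time.-tuple 'I_(2 ^ w)}|%:R :> R.
  by rewrite -natrX card_tuple card_ord.
rewrite Tc in hb.
have he : (2 * N)%:R * n%:R <= e.
  have k1 := k_ge hl hN; have b1 := B_le2 hl Nn hN; have k0 : 0 < (kf N)%:R :> R by rewrite ltr0n kf_gt0.
  have b0 : 0 < B%:R :> R by rewrite ltr0n B0.
  have x1 : y ^+ 6 / 4 <= tau ^+ 2 / (2 * B%:R * N%:R).
    have -> : tau ^+ 2 / (2 * B%:R * N%:R) = N%:R / (2 * B%:R * y ^+ 6).
      by rewrite /tau; field; rewrite !gt_eqF.
    rewrite ler_pdivlMr ?mulr_gt0 ?exprn_gt0 //.
    have -> : y ^+ 6 / 4 * (2 * B%:R * y ^+ 6) = (y ^+ 12 * B%:R) / 2 by field.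
    rewrite ler_pdivrMr //; apply: (@le_trans _ _ ((kf N)%:R * B%:R)); first by rewrite ler_pM2r.
    by rewrite ler_pdivlMr // in b1; rewrite mulrC [N%:R * 2]mulrC.
  have x2 : 3 * L <= y ^+ 6 / 4.
    have ly := Ly hl; have y100 := y100 hl.
    have : 100 * y <= y ^+ 6.
      rewrite (_ : y ^+ 6 = y ^+ 5 * y); last by rewrite exprSr.
      rewrite ler_pM2r //; apply: le_trans (_ : y ^+ 1 <= _); first by rewrite expr1.
      by rewrite ler_weXn2l // (y1 hl).
    lra.
  apply: (@le_trans _ _ (expR (3 * L))); last by rewrite ler_expR; apply: le_trans x2 x1.
  rewrite [3 * L]mulrC expRM_natr lnK ?posrE ?(n0 hl) // -natrM -natrX ler_nat.
  by move: Nn n20; move: N => a; clear; rewrite !expnS expn0; nia.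
have hb2 : #|bad|%:R * n%:R <= #|{: time.-tuple 'I_(2 ^ w)}|%:R :> R.
  have N2 : 0 < (2 * N)%:R :> R by rewrite ltr0n muln_gt0.
  rewrite -(ler_pM2l N2); apply: le_trans hb.
  by rewrite mulrCA ler_wpM2l.
have hc : (#|{: time.-tuple 'I_(2 ^ w)}| <= #|bad| + #|[pred t | `[< E t >]]|)%N.
  rewrite -(cardC bad) leq_add2l; apply: subset_leq_card; apply/fintype.subsetP => t.
  rewrite !inE -all_predC => /allP hg; apply/asboolP.
  apply/asboolP; apply: (@load_bound tau (map val t) time) => //; first by rewrite tn ltW.
  move=> _ v vN; have := hg v; rewrite mem_iota vN => /(_ isT) /=.
  by rewrite negb_or -!ltNge => /andP [/ltW ? /ltW ?].
have hc' : #|{: time.-tuple 'I_(2 ^ w)}|%:R <= #|bad|%:R + #|[pred t | `[< E t >]]|%:R :> R by rewrite -natrD ler_nat.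
have hb3 : #|bad|%:R <= n%:R^-1 * #|{: time.-tuple 'I_(2 ^ w)}|%:R :> R.
  by rewrite mulrC ler_pdivlMr ?(n0 hl).
by rewrite mulrBl mul1r; lra.
Qed.
End FixedSize.
End LoadBound.

(** * Passage to the limit *)

Module Asymptotics.
Import Program Entropy Estimates LoadBound.
Set Implicit Arguments.
Unset Strict Implicit.
Unset Printing Implicit Defensive.
Local Open Scope classical_set_scope.
Local Open Scope ring_scope.

Section Limits.
Variable R : realType.

Lemma near_ln_ge (c : R) : \forall n \near \oo, c <= ln n%:R.
Proof.
near=> n; rewrite -[c]expRK ler_ln ?posrE ?expR_gt0 //; last by rewrite ltr0n; near: n; exact: nbhs_infty_gt.
by near: n; exact: nbhs_infty_ger.
Unshelve. all: by end_near. Qed.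

Lemma near_powR_ge (e c : R) : 0 < e -> \forall n \near \oo, c <= n%:R `^ e.
Proof.
move=> e0; near=> n.
have n0 : 0 < n%:R :> R by rewrite ltr0n; near: n; exact: nbhs_infty_gt.
have h : c / e <= ln n%:R by near: n; exact: near_ln_ge.
have := expR_ge1Dx (e * ln (n%:R : R)); rewrite /powR gt_eqF //.
rewrite ler_pdivrMr // mulrC in h; lra.
Unshelve. all: by end_near. Qed.

(** With z = n^(e/2), ln n = (2/e) * ln z <= (2/e) * z <= z^2 for large n. *)
Lemma near_ln_le_powR (e : R) : 0 < e -> \forall n \near \oo, ln n%:R <= n%:R `^ e.
Proof.
move=> e0; have e2 : 0 < e / 2 by rewrite divr_gt0.
near=> n.
have n0 : 0 < n%:R :> R by rewrite ltr0n; near: n; exact: nbhs_infty_gt.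
have h : 2 / e <= n%:R `^ (e / 2) by near: n; exact: (near_powR_ge _ e2).
have -> : n%:R `^ e = n%:R `^ (e / 2) * n%:R `^ (e / 2) :> R.
  have ee : e = e / 2 + e / 2 by lra.
  by rewrite [in LHS]ee powRD // (gt_eqF n0) implybT.
have z0 : 0 < n%:R `^ (e / 2) :> R by exact: powR_gt0.
apply: (@le_trans _ _ (2 / e * n%:R `^ (e / 2))); last by rewrite ler_pM2r.
rewrite mulrAC ler_pdivlMr //.
have : ln (n%:R `^ (e / 2)) <= n%:R `^ (e / 2) :> R.
  have := @le_ln1Dx R (n%:R `^ (e / 2) - 1).
  rewrite (_ : 1 + (_ - 1) = n%:R `^ (e / 2)); last by lra.
  by move=> h'; apply: le_trans (h' _) _; lra.
rewrite ln_powR; set a := ln _; set b := powR _ _; lra.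
Unshelve. all: by end_near. Qed.

(** The subpolynomial hypothesis enters here: n^delta = 1 / rho forces rho > 0, and
    delta <= e for large n. *)
Lemma near_large (rho : nat -> R) (e : R) : (forall n, 0 <= rho n <= 2^-1) ->
  (exists2 delta : nat -> R, delta @ \oo --> (0 : R) &
      \forall n \near \oo, (rho n)^-1 = n%:R `^ delta n) ->
  0 < e -> 100 * e <= 1 -> \forall n \near \oo, large n (rho n) (n%:R `^ e) e.
Proof.
move=> hr [delta d0 hd] e0 e1; near=> n.
have n0 : 0 < n%:R :> R by rewrite ltr0n; near: n; exact: nbhs_infty_gt.
have n1 : 1 <= n%:R :> R by near: n; exact: nbhs_infty_ger.
split; split.
- by near: n; exact: near_powR_ge.
- by near: n; exact: near_ln_ge.
- by near: n; exact: near_ln_le_powR.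
- rewrite -powR_mulrn ?powR_ge0 // -powRrM -[X in _ <= X]powRr1 ?(ltW n0) //.
  by apply: ler_powR => //; rewrite mulrC.
- exact: ln_powR.
- by [].
- lra.
- have hdn : (rho n)^-1 = n%:R `^ delta n by near: n.
  rewrite -[rho n]invrK hdn lef_pV2 ?posrE ?powR_gt0 //.
  apply: ler_powR => //; apply: ltW; apply: le_lt_trans (ler_norm _) _.
  by near: n; move/cvgr0Pnorm_lt : d0; apply.
- by have /andP [] := hr n.
Unshelve. all: by end_near. Qed.

(** For eps = 1/(k+1) the property holds from some threshold T k on; at n, the
    largest k <= n with T k <= n is used. *)
Lemma diagonal (P : R -> nat -> Prop) : (forall e, 0 < e -> \forall n \near \oo, P e n) ->
  exists2 eps : nat -> R, eps @ \oo --> (0 : R) & \forall n \near \oo, P (eps n) n.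
Proof.
move=> h.
have {}h (k : nat) : exists N, forall n, (N <= n)%N -> P (k.+1%:R^-1) n.
  have [|N _ hN] := h (k.+1%:R^-1); first by rewrite invr_gt0.
  by exists N => n /hN.
have [T hT] := choice h.
pose k n := \max_(i < n.+1 | (T i <= n)%N) i.
have hk n j : (j <= n)%N -> (T j <= n)%N -> (j <= k n)%N.
  by move=> jn Tj; exact: (@leq_bigmax_cond _ _ (fun i : 'I_n.+1 => i : nat) (Ordinal (jn : (j < n.+1)%N)) Tj).
exists (fun n => (k n).+1%:R^-1); last first.
  near=> n; apply: hT.
  have T0 : (T 0 <= n)%N by near: n; exact: nbhs_infty_ge.
  have : (0 < #|[pred i : 'I_n.+1 | (T i <= n)%N]|)%N by apply/card_gt0P; exists ord0.
  by rewrite /k => /eq_bigmax_cond -/(_ (fun i : 'I_n.+1 => i : nat)) [i]; rewrite inE => Ti ->.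
apply/cvgr0Pnorm_lt => e e0; near=> n.
rewrite gtr0_norm ?invr_gt0 // -[e]invrK ltf_pV2 ?posrE ?invr_gt0 //.
pose j := Num.truncn e^-1.
have hj : e^-1 < j.+1%:R by exact: truncnS_gt.
apply: (lt_le_trans hj); rewrite ler_nat ltnS; apply: hk; near: n; exact: nbhs_infty_ge.
Unshelve. all: by end_near. Qed.

Lemma in_asbool (T : Type) (E : T -> Prop) t : (t \in [pred t | `[< E t >]]) = `[< E t >].
Proof. by []. Qed.

Lemma prob_sub (Omega : finType) (E F : Omega -> Prop) : (forall t, E t -> F t) -> prob R E <= prob R F.
Proof.
move=> h; rewrite /prob ler_wpM2r ?invr_ge0 // ler_nat; apply: subset_leq_card.
by apply/fintype.subsetP => t; rewrite !in_asbool => /asboolP ht; apply/asboolP; exact: h.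
Qed.

Lemma prob_gt0 (Omega : finType) (E : Omega -> Prop) : 0 < prob R E -> exists t, E t.
Proof.
rewrite /prob; case: (posnP #|[pred t | `[< E t >]]|) => [->|/card_gt0P [t]]; first by rewrite mul0r ltxx.
by rewrite in_asbool => /asboolP ht _; exists t.
Qed.

(** The second half of the theorem for one n and one eps.  The sign of the bound
    is recorded because a maximum over an empty family is 0. *)
Definition whp_bound (rho : nat -> R) (eps : R) (n : nat) : Prop :=
  [/\ (20 <= n)%N, 0 <= lbp_bound eps (rho n) n & forall (G : sgraph 'I_n) (inp : seq nat),
        degree_cond G (rho n) -> adjacency_list G inp ->
        let w := word_size 6 n in
        let time := (170 * 100 * maxn 1 #|edges G|)%N in
        1 - n%:R^-1 <= prob R (fun rnd : time.-tuple 'I_(2 ^ w) =>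
          exists P : seq ({set 'I_n} * {set 'I_n}),
          [/\ outputs_bicliques (run w prog inp (map val rnd) time) P,
              biclique_partition G P &
              forall v, (load P v)%:R <= lbp_bound eps (rho n) n])].

(** The choice of e makes 34 * e at most eps / 2; the rest of the error,
    46 / ln n, is at most eps / 2 for large n. *)
Lemma whp_bound_near (rho : nat -> R) : (forall n, 0 <= rho n <= 2^-1) ->
  (exists2 delta : nat -> R, delta @ \oo --> (0 : R) &
      \forall n \near \oo, (rho n)^-1 = n%:R `^ delta n) ->
  forall eps, 0 < eps -> \forall n \near \oo, whp_bound rho eps n.
Proof.
move=> hr hd eps eps0.
pose e : R := Num.min 200^-1 (eps / 68).
have e0 : 0 < e by rewrite lt_min invr_gt0 ltr0n divr_gt0.
have e1 : 100 * e <= 1.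
  have : e <= 200^-1 by rewrite ge_min lexx.
  lra.
have e2 : 34 * e <= eps / 2.
  have : e <= eps / 68 by rewrite ge_min lexx orbT.
  lra.
near=> n.
have hl : large n (rho n) (n%:R `^ e) e by near: n; exact: near_large.
have n20 : (20 <= n)%N by near: n; exact: nbhs_infty_ge.
have hL : 92 / eps <= ln (n%:R : R) by near: n; exact: near_ln_ge.
have L0 := L0 hl; have p0 := P_gt0 hl.
have e3 : 46 / ln (n%:R : R) <= eps / 2.
  by rewrite ler_pdivrMr //; rewrite ler_pdivrMr // in hL; lra.
have eB : lbp_bound eps (rho n) n = (2^-1 + eps) * (ent (rho n) * n%:R / ln n%:R).
  by rewrite lbp_boundE !mulrA.
split=> //; first by rewrite eB; apply: mulr_ge0; [lra|exact: ltW].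
move=> G inp dc [vs [nb [vsP nbP inpP]]]; cbv zeta.
apply: le_trans (prob_bound n20 vsP nbP inpP hl dc (erefl _)) _.
apply: prob_sub => t [Q [h1 h2 h3]]; exists Q; split=> // v.
apply: le_trans (h3 v) _; rewrite eB ler_pM2r //; lra.
Unshelve. all: by end_near. Qed.

Lemma adjacency_list_exists n (G : sgraph 'I_n) : exists inp, adjacency_list G inp.
Proof.
eexists; exists [seq v <- enum 'I_n | (0 < degree G v)%N], (fun v => enum (neighbours G v)).
by split.
Qed.

(** The program succeeds with positive probability, so that a partition with the
    required loads exists. *)
Lemma lbp_max_le (rho : nat -> R) eps n : whp_bound rho eps n ->
  (lbp_max n (rho n))%:R <= lbp_bound eps (rho n) n.
Proof.
move=> [n20 b0 h]; rewrite /lbp_max.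
elim/big_ind: _ => [//|a b ha hb|G dc]; first by rewrite natr_max ge_max ha.
have [inp hi] := adjacency_list_exists G.
have p0 : 0 < 1 - n%:R^-1 :> R.
  have n1 : (1 < n)%N by exact: leq_trans n20.
  by rewrite subr_gt0 invf_lt1 ?ltr1n ?ltr0n // ltnW.
have [t [P [_ hP hload]]] := prob_gt0 (lt_le_trans p0 (h G inp dc hi)).
pose m := \max_v load P v.
have hm : m%:R <= lbp_bound eps (rho n) n.
  by rewrite /m; elim/big_ind: _ => [//|a b ha hb|v _]; [rewrite natr_max ge_max ha|exact: hload].
apply: le_trans hm; rewrite ler_nat /lbp; case: ex_minnP => l _; apply.
apply/asboolP; exists P => // v; exact: (leq_bigmax v).
Qed.
End Limits.
End Asymptotics.
Import Asymptotics.
Local Open Scope classical_set_scope.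
Local Open Scope ring_scope.

Theorem mainTheorem8 (R : realType) (rho : nat -> R)
    (rho_range : forall n, 0 <= rho n <= 2^-1)
    (rho_subpoly : exists2 delta : nat -> R, delta @ \oo --> (0 : R) &
      \forall n \near \oo, (rho n)^-1 = n%:R `^ delta n) :
  (exists2 eps : nat -> R, eps @ \oo --> (0 : R) &
    \forall n \near \oo,
      (lbp_max n (rho n))%:R <= lbp_bound (eps n) (rho n) n)
  /\
  (exists (A : com) (K C : nat) (eps fail : nat -> R),
    [/\ (2 < K)%N, eps @ \oo --> (0 : R), fail @ \oo --> (0 : R) &
      \forall n \near \oo, forall (G : sgraph 'I_n) (inp : seq nat),
        degree_cond G (rho n) -> adjacency_list G inp ->
        let w := word_size K n in
        let time := (C * maxn 1 #|edges G|)%N in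
        1 - fail n <= prob R (fun rnd : time.-tuple 'I_(2 ^ w) =>
          exists P : seq ({set 'I_n} * {set 'I_n}),
          [/\ outputs_bicliques (run w A inp (map val rnd) time) P,
              biclique_partition G P &
              forall v, (load P v)%:R <= lbp_bound (eps n) (rho n) n])]).
Proof.
have [eps eps0 h] := diagonal (whp_bound_near rho_range rho_subpoly).
split.
  by exists eps => //; near=> n; apply: lbp_max_le; near: n.
exists Program.prog, 6, (170 * 100)%N, eps, (fun n => n%:R^-1); split=> //.
  apply/cvgr0Pnorm_lt => e e0; near=> n.
  have h1 : e^-1 + 1 <= n%:R by near: n; exact: nbhs_infty_ger.
  have e1 : 0 < e^-1 by rewrite invr_gt0.
  rewrite ger0_norm ?invr_ge0 // -[e]invrK ltf_pV2 ?posrE //; lra.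
by near=> n => G inp dc hi; have [_ _] : whp_bound rho (eps n) n by [near: n]; apply.
Unshelve. all: by end_near. Qed.
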